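(* Let $\Delta=\{\delta_1,\dots,\delta_m\}$ and let $(K,\Delta\cup\{D\})$ be a differential field of characteristic zero equipped with $m+1$ pairwise commuting derivations $\delta_1,\dots,\delta_m,D$. Then $(K,\Delta\cup\{D\})\models DCF_{0,m+1}$ if and only if both of the following hold: (1) $(K,\Delta)\models DCF_{0,m}$; (2) for every $n$, whenever $\Lambda$ is a characteristic set of a prime $\Delta$-ideal of $K\{x_1,\dots,x_n\}$, $O$ is a nonempty $\Delta$-open subset of $\mathcal V(\Lambda)$ with $O\cap\mathcal V(H_\Lambda)=\emptyset$, and $W\subseteq \mathcal V(f,\tau f:\ f\in\Lambda)\subseteq K^{2n}$ is a $\Delta$-closed set whose image under the projection $K^{2n}\to K^n$ onto the first $n$ coordinates contains $O$, there exists $\bar a\in O$ such that $(\bar a, D\bar a)\in W$, where $D\bar a=(Da_1,\dots,Da_n)$.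
   Context: $DCF_{0,k}$ denotes the theory of differentially closed fields of characteristic zero with $k$ commuting derivations. $K\{x_1,\dots,x_n\}$ is the ring of $\Delta$-polynomials over $K$ (polynomials in the variables $\theta x_i$, $\theta$ ranging over the monoid $\Theta$ of operators $\delta_1^{e_1}\cdots\delta_m^{e_m}$). For a set $S$ of $\Delta$-polynomials, $\mathcal V(S)$ denotes its common zero set in the appropriate power of $K$; $\Delta$-closed sets are sets of this form (Kolchin topology with respect to $\Delta$), and $\Delta$-open sets are their complements relative to a given $\Delta$-closed set. A characteristic set is taken with respect to a fixed ranking of the $\Delta$-variables; for a characteristic set $\Lambda$, $H_\Lambda$ is the product of the separants and initials of the elements of $\Lambda$. For $f\in K\{x_1,\dots,x_n\}$, $\tau f\in K\{x_1,\dots,x_n,y_1,\dots,y_n\}$ is the $\Delta$-polynomial $\tau f(\bar x,\bar y)=f^{D}(\bar x)+\sum_{i=1}^n\sum_{\theta\in\Theta}\frac{\partial f}{\partial(\theta x_i)}(\bar x)\,\theta y_i$, where $f^D$ is obtained from $f$ by applying $D$ to its coefficients; thus $D(f(\bar a))=\tau f(\bar a,D\bar a)$ for $\bar a\in K^n$. *)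

(* Defs.v *)
From HB Require Import structures.
From mathcomp Require Import all_boot all_order all_algebra.
From mathcomp Require Import finmap monalg.

Set Implicit Arguments.
Unset Strict Implicit.
Unset Printing Implicit Defensive.

Import GRing.Theory.
Local Open Scope fset_scope.
Local Open Scope ring_scope.

(* A Delta-variable theta x_i, with theta = delta_1^e_1...delta_m^e_m, *)
(* is the pair (i, e).                                                *)
Notation dvar n m := ('I_n * {ffun 'I_m -> nat})%type.

Notation dpoly K n m := {malg K[cmonom (dvar n m)]}.

Definition dX {K : comNzRingType} {V : choiceType} (v : V)
  : {malg K[cmonom V]} := << ucm v >>.

Definition theta_app {L : Type} {m : nat} (d : 'I_m -> L -> L)
  (e : {ffun 'I_m -> nat}) (x : L) : L :=
  foldr (fun j y => iter (e j) (d j) y) x (enum 'I_m).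

Definition dshift {m : nat} (j : 'I_m) (e : {ffun 'I_m -> nat})
  : {ffun 'I_m -> nat} := [ffun i => (e i + (i == j))%N].

Definition peval {V : choiceType} {K : comNzRingType} {R : comNzRingType}
  (iota : K -> R) (x : V -> R) (f : {malg K[cmonom V]}) : R :=
  \sum_(k <- msupp f) iota f@_k * \prod_(v <- finsupp k) x v ^+ k v.

Definition deval {K L : comNzRingType} {n m : nat} (iota : K -> L)
  (d : 'I_m -> L -> L) (a : 'I_n -> L) (f : dpoly K n m) : L :=
  peval iota (fun v : dvar n m => theta_app d v.2 (a v.1)) f.

Definition pvars {K : comNzRingType} {V : choiceType} (f : {malg K[cmonom V]})
  : {fset V} := (\bigcup_(k <- msupp f) finsupp k)%fset.

Definition pderiv {K : comNzRingType} {V : choiceType} (v : V)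
  (f : {malg K[cmonom V]}) : {malg K[cmonom V]} :=
  \sum_(k <- msupp f) (f@_k *+ k v)%:MP *
     \prod_(w <- finsupp k) dX w ^+ (if w == v then (k w).-1 else k w).

Definition pmapc {K : comNzRingType} {V : choiceType} (phi : K -> K)
  (f : {malg K[cmonom V]}) : {malg K[cmonom V]} :=
  peval (fun c => (phi c)%:MP) dX f.

Definition pdelta {K : comNzRingType} {n m : nat} (d : 'I_m -> K -> K)
  (j : 'I_m) (f : dpoly K n m) : dpoly K n m :=
  pmapc (d j) f + \sum_(v <- pvars f) pderiv v f * dX (v.1, dshift j v.2).

(* K{x} -> K{x,y} (x_i = variable lshift i, y_i = variable rshift i) *)
Definition xpart {K : comNzRingType} {n m : nat} (f : dpoly K n m)
  : dpoly K (n + n) m :=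
  peval (fun c => c%:MP) (fun v : dvar n m => dX (lshift n v.1, v.2)) f.

Definition tau {K : comNzRingType} {n m : nat} (D : K -> K)
  (f : dpoly K n m) : dpoly K (n + n) m :=
  peval (fun c => (D c)%:MP) (fun v : dvar n m => dX (lshift n v.1, v.2)) f
  + \sum_(v <- pvars f) xpart (pderiv v f) * dX (rshift n v.1, v.2).

Definition cat_pt {T : Type} {n : nat} (a b : 'I_n -> T) : 'I_(n + n) -> T :=
  fun i => match split i with inl j => a j | inr j => b j end.

Definition Vset {K : comNzRingType} {n m : nat} (d : 'I_m -> K -> K)
  (S : dpoly K n m -> Prop) : ('I_n -> K) -> Prop :=
  fun a => forall f, S f -> deval id d a f = 0.

Definition dclosed {K : comNzRingType} {n m : nat} (d : 'I_m -> K -> K)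
  (X : ('I_n -> K) -> Prop) : Prop :=
  exists S : dpoly K n m -> Prop, forall a, X a <-> Vset d S a.

Definition dopen_in {K : comNzRingType} {n m : nat} (d : 'I_m -> K -> K)
  (X O : ('I_n -> K) -> Prop) : Prop :=
  exists S : dpoly K n m -> Prop, forall a, O a <-> (X a /\ ~ Vset d S a).

Definition is_prime_dideal {K : comNzRingType} {n m : nat}
  (d : 'I_m -> K -> K) (I : dpoly K n m -> Prop) : Prop :=
  [/\ I 0, (forall f g, I f -> I g -> I (f + g)),
      (forall f g, I g -> I (f * g)),
      (forall j f, I f -> I (pdelta d j f)) &
      ~ I 1 /\ (forall f g, I (f * g) -> I f \/ I g)].

Definition is_ranking {n m : nat} (rk : rel (dvar n m)) : Prop :=
  [/\ irreflexive rk, transitive rk,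
      (forall u v, u != v -> rk u v || rk v u),
      (forall (j : 'I_m) (u : dvar n m), rk u (u.1, dshift j u.2)) &
      (forall (j : 'I_m) (u v : dvar n m),
          rk u v -> rk (u.1, dshift j u.2) (v.1, dshift j v.2))].

Section CharSets.
Context {K : comNzRingType} {n m : nat} (rk : rel (dvar n m)).

(* leader: the highest ranking variable occurring (None for f in K) *)
Definition lead (f : dpoly K n m) : option (dvar n m) :=
  ohead [seq u <- enum_fset (pvars f) |
          all (fun v => (v == u) || rk v u) (enum_fset (pvars f))].

Definition pdeg (v : dvar n m) (f : dpoly K n m) : nat :=
  \max_(k <- msupp f) k v.

Definition initial_at (u : dvar n m) (f : dpoly K n m) : dpoly K n m :=
  \sum_(k <- msupp f | k u == pdeg u f)
     (f@_k)%:MP * \prod_(w <- finsupp k | w != u) dX w ^+ k w.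

Definition initial (f : dpoly K n m) : dpoly K n m :=
  if lead f is Some u then initial_at u f else f.

Definition separant (f : dpoly K n m) : dpoly K n m :=
  if lead f is Some u then pderiv u f else 0.

Definition H_of (Lam : seq (dpoly K n m)) : dpoly K n m :=
  \prod_(f <- Lam) (initial f * separant f).

Definition rank_lt (f g : dpoly K n m) : bool :=
  match lead f, lead g with
  | None, Some _ => true
  | Some u, Some v => rk u v || ((u == v) && (pdeg u f < pdeg v g)%N)
  | _, _ => false
  end.

Definition rank_eq (f g : dpoly K n m) : bool :=
  match lead f, lead g with
  | None, None => true
  | Some u, Some v => (u == v) && (pdeg u f == pdeg v g)
  | _, _ => false
  end.

Definition rank_le f g := rank_lt f g || rank_eq f g.

Definition proper_deriv (v u : dvar n m) : bool :=
  [&& v.1 == u.1, [forall j, (u.2 j <= v.2 j)%N] & v.2 != u.2].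

Definition reduced (g f : dpoly K n m) : bool :=
  if lead f is Some u then
    all (fun v => ~~ proper_deriv v u) (enum_fset (pvars g))
    && (pdeg u g < pdeg u f)%N
  else false.

Definition autoreduced (A : seq (dpoly K n m)) : Prop :=
  (forall f, f \in A -> lead f != None) /\
  (forall i j, (i < size A)%N -> (j < size A)%N -> i != j ->
     reduced (nth 0 A i) (nth 0 A j)).

Definition aset_lt (A B : seq (dpoly K n m)) : Prop :=
  let a := sort rank_le A in
  let b := sort rank_le B in
  (exists k, (k < minn (size a) (size b))%N /\
     (forall i, (i < k)%N -> rank_eq (nth 0 a i) (nth 0 b i)) /\
     rank_lt (nth 0 a k) (nth 0 b k))
  \/ ((size b < size a)%N /\
      forall i, (i < size b)%N -> rank_eq (nth 0 a i) (nth 0 b i)).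

Definition is_charset (I : dpoly K n m -> Prop) (Lam : seq (dpoly K n m))
  : Prop :=
  [/\ autoreduced Lam, (forall f, f \in Lam -> I f) &
      forall B, autoreduced B -> (forall f, f \in B -> I f) ->
        ~ aset_lt B Lam].

End CharSets.

Definition is_derivation {R : nzRingType} (d : R -> R) : Prop :=
  (forall x y, d (x + y) = d x + d y) /\
  (forall x y, d (x * y) = d x * y + x * d y).

Definition commuting_family {R : Type} {m : nat} (d : 'I_m -> R -> R) :=
  forall i j x, d i (d j x) = d j (d i x).

Definition diff_field0 (K : fieldType) (m : nat) (d : 'I_m -> K -> K) :=
  [/\ [pchar K] =i pred0, (forall j, is_derivation (d j)) &
      commuting_family d].

(* (K, d) |= DCF_{0,m}: a differential field of characteristic zero with
   m commuting derivations that is existentially closed: every finite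
   system of Delta-equations and Delta-inequations over K with a solution
   in some differential field extension has a solution in K. *)
Definition DCF (K : fieldType) (m : nat) (d : 'I_m -> K -> K) : Prop :=
  diff_field0 d /\
  forall (n : nat) (fs gs : seq (dpoly K n m)),
    (exists (L : fieldType) (iota : {rmorphism K -> L})
            (dL : 'I_m -> L -> L) (a : 'I_n -> L),
       [/\ (forall j, is_derivation (dL j)), commuting_family dL,
           (forall j c, iota (d j c) = dL j (iota c)),
           (forall f, f \in fs -> deval iota dL a f = 0) &
           (forall g, g \in gs -> deval iota dL a g != 0)]) ->
    exists a : 'I_n -> K,
      (forall f, f \in fs -> deval id d a f = 0) /\
      (forall g, g \in gs -> deval id d a g != 0).

Definition ext_der {K : Type} {m : nat} (d : 'I_m -> K -> K) (D : K -> K)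
  : 'I_m.+1 -> K -> K :=
  fun i => oapp d D (unlift ord_max i).

(* Main.v *)
(* Outside the zeros of H_Lam, a zero of the characteristic set Lam of a prime
   Delta-ideal P is a zero of P, because every element of P reduces to 0 modulo Lam.

   For the direct implication, take an ultrafilter on O containing the sets {a in O |
   h(a) != 0} for h not in P, and choose b with (a, b) in W for each a in O: the
   Delta-polynomials vanishing along the ultrafilter form a prime Delta-ideal, whose
   generic point (a, b) satisfies W with a generic for P. As tau f (a, b) = 0 for f in
   Lam, the rule D a = b defines a derivation of K{a}; it extends to some derivation
   of the ambient field, which need not commute with Delta. The jets of a for it still
   give an algebraic point over K for the variables of all m+1 derivations, and in
   characteristic zero the largest differential ideal inside the kernel of that point
   is prime. Its generic point solves W in an extension, so existential closedness
   gives one in K. The Delta-reduct is differentially closed by the same argument: D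
   extends from K to any Delta-extension of K.

   For the converse, let a be a solution of a system in an extension L, and r a bound
   for the order in D. Let P be the Delta-ideal of c = (D^k a_i), k <= r, and let W be given
   by f, tau f (f in Lam) and y_(i,k) = x_(i,k+1) for k < r. Only the values of y at the top
   level k = r are free; P constrains them by equations that are linear in Theta y, and by
   Dickson's lemma inverting finitely many leading coefficients makes these equations
   solvable by recursion along the ranking at every point of an open subset O of V(P). So
   W projects onto O, and (2) yields a point of O whose coordinates are the D-jets of a
   solution of the system in K. *)

Require Import Defs.
From HB Require Import structures.
From mathcomp Require Import all_boot all_order all_algebra.
From mathcomp Require Import finmap monalg.
From mathcomp Require Import boolp classical_sets filter.
From mathcomp Require Import ring_quotient fraction generic_quotient ring.

Set Implicit Arguments.
Unset Strict Implicit.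
Unset Printing Implicit Defensive.

Import GRing.Theory.
Local Open Scope ring_scope.

Local Notation "1" := mone : monom_scope.
Local Notation "x * y" := (mmul x y) : monom_scope.

(** * Polynomials and derivations *)

(** Commutation with [Delta] is lost twice, and one remedy serves both times. Neither a derivation
    of the ambient field nor the values that the recursion along the ranking gives to the [theta y]
    need be compatible with [Delta]; each is used only as a bare assignment of values to the
    differential variables. Passing to the generic point of the largest differential ideal keeps the
    equations, because they belong to a family that vanishes at the assignment and is stable under
    the derivations. It keeps the inequations, because that ideal lies in the kernel.

    The hypothesis on [W] concerns points of [O] over [K], and [K] need not contain a generic point
    of [P]; the ultrafilter makes up for this. It needs that no [h] outside [P] vanishes on all of
    [O], which is where closedness of the [Delta]-reduct enters. As closedness speaks of finite
    systems while [W] may be cut out by infinitely many equations, a basis theorem for zero sets is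
    also required, and an ultrafilter proves that as well. *)

(* Failing unifications between products of [malg] elements unfold the
   convolution product and blow up: [mpol] is the same ring with a locked
   product, and evaluation, variables and constants are locked as well. *)
Definition mpol (V : choiceType) (K : comNzRingType) := {malg K[cmonom V]}.

HB.lock Definition mulp (V : choiceType) (K : comNzRingType) (f g : mpol V K) : mpol V K :=
  (f : {malg K[cmonom V]}) * (g : {malg K[cmonom V]}).
HB.lock Definition onep (V : choiceType) (K : comNzRingType) : mpol V K :=
  (1 : {malg K[cmonom V]}).
HB.lock Definition mono (V : choiceType) (K : comNzRingType) (c : K) (k : {cmonom V}) : mpol V K :=
  << c *g k >>.
HB.lock Definition pC (V : choiceType) (K : comNzRingType) (c : K) : mpol V K := c%:MP.
HB.lock Definition pX (V : choiceType) (K : comNzRingType) (v : V) : mpol V K := dX v.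
HB.lock Definition ev (V : choiceType) (K R : comNzRingType) (phi : K -> R) (x : V -> R)
  (f : mpol V K) : R := peval phi x f.
HB.lock Definition pder (V : choiceType) (K : comNzRingType) (v : V) (f : mpol V K) : mpol V K :=
  pderiv v f.

Section MpolRing.
Context {V : choiceType} {K : comNzRingType}.

HB.instance Definition _ := GRing.Zmodule.copy (mpol V K) {malg K[cmonom V]}.
Lemma mulpA : associative (@mulp V K).
Proof. rewrite mulp.unlock; exact: mulrA. Qed.
Lemma mulpC : commutative (@mulp V K).
Proof. rewrite mulp.unlock; exact: mulrC. Qed.
Lemma mul1p : left_id (@onep V K) (@mulp V K).
Proof. rewrite mulp.unlock onep.unlock; exact: mul1r. Qed.
Lemma mulpDl : left_distributive (@mulp V K) +%R.
Proof. rewrite mulp.unlock; exact: mulrDl. Qed.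
Lemma onep_neq0 : (@onep V K) != 0.
Proof. rewrite onep.unlock; exact: oner_neq0. Qed.
HB.instance Definition _ := GRing.Zmodule_isComNzRing.Build (mpol V K)
  mulpA mulpC mul1p mulpDl onep_neq0.

Implicit Types f g : mpol V K.

Lemma malg_mulE f g : (f : {malg K[cmonom V]}) * (g : {malg K[cmonom V]}) = (f * g : mpol V K).
Proof. by rewrite /GRing.mul /= mulp.unlock. Qed.

Lemma malg_oneE : (1 : {malg K[cmonom V]}) = (1 : mpol V K).
Proof. by rewrite [RHS]/GRing.one /= onep.unlock. Qed.

Lemma malg_expE f n : (f : {malg K[cmonom V]}) ^+ n = (f ^+ n : mpol V K).
Proof.
elim: n => [|n IHn]; first by rewrite !expr0; exact: malg_oneE.
by rewrite !exprS IHn; exact: malg_mulE.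
Qed.

Lemma malg_prodE (I : Type) (r : seq I) (P : pred I) (F : I -> mpol V K) :
  \prod_(i <- r | P i) (F i : {malg K[cmonom V]}) = (\prod_(i <- r | P i) F i : mpol V K).
Proof.
elim: r => [|i r IHr]; first by rewrite !big_nil; exact: malg_oneE.
by rewrite !big_cons IHr; case: (P i) => //; exact: malg_mulE.
Qed.

Lemma mono_inj_eq (c : K) (k l : {cmonom V}) : (forall v, k v = l v) ->
  mono c k = mono c l.
Proof. by move=> kl; have -> : k = l by apply/eqP/cmP. Qed.

Lemma monoD (a b : K) (k : {cmonom V}) : mono (a + b) k = mono a k + mono b k.
Proof. by rewrite mono.unlock; exact: monalgUD. Qed.

Lemma mono_mul (a b : K) (k l : {cmonom V}) : mono a k * mono b l = mono (a * b) (k * l)%M.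
Proof. by rewrite -malg_mulE mono.unlock malgM_def fgmulUU. Qed.

Lemma pC_mono (c : K) : pC V c = mono c 1%M.
Proof. by rewrite pC.unlock mono.unlock. Qed.

Lemma pX_mono (v : V) : pX K v = mono 1 (ucm v).
Proof. by rewrite pX.unlock mono.unlock. Qed.

Lemma pC1 : pC V 1 = 1 :> mpol V K.
Proof. by rewrite -malg_oneE pC.unlock; exact: mpolyC1E. Qed.

Lemma pC_is_zmod_morphism : zmod_morphism (@pC V K).
Proof.
move=> a b; apply: (@addIr _ (pC V b)).
by rewrite -[RHS]addrA addNr addr0 !pC_mono -monoD subrK.
Qed.
HB.instance Definition _ := GRing.isZmodMorphism.Build K (mpol V K) (@pC V K)
  pC_is_zmod_morphism.

Lemma pC_is_monoid_morphism : monoid_morphism (@pC V K).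
Proof. by split=> [|a b]; rewrite ?pC1 // !pC_mono mono_mul mul1m. Qed.
HB.instance Definition _ := GRing.isMonoidMorphism.Build K (mpol V K) (@pC V K)
  pC_is_monoid_morphism.

Lemma mpolE f : f = \sum_(k <- msupp f) mono f@_k k.
Proof. by rewrite mono.unlock; exact: (monalgE f). Qed.

Lemma mono_ind (P : mpol V K -> Prop) :
  (forall c k, P (mono c k)) -> (forall f g, P f -> P g -> P (f + g)) ->
  forall f, P f.
Proof.
move=> PU PD f; rewrite (mpolE f); apply: big_ind => //.
by have := PU 0 1%M; rewrite -pC_mono rmorph0.
Qed.

Lemma mono_bilin (R : zmodType) (F G : mpol V K -> mpol V K -> R) :
  (forall f g h, F (f + g) h = F f h + F g h) -> (forall f g h, F h (f + g) = F h f + F h g) ->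
  (forall f g h, G (f + g) h = G f h + G g h) -> (forall f g h, G h (f + g) = G h f + G h g) ->
  (forall c k c' l, F (mono c k) (mono c' l) = G (mono c k) (mono c' l)) ->
  forall f g, F f g = G f g.
Proof.
move=> Fl Fr Gl Gr FG; apply: mono_ind => [c k|f1 f2 IH1 IH2] g.
  move: g; apply: mono_ind => [c' l|g1 g2 IH1 IH2]; first exact: FG.
  by rewrite Fr Gr IH1 IH2.
by rewrite Fl Gl IH1 IH2.
Qed.

End MpolRing.

(** A derivation of [A] with values in [R], made an [A]-module through [ev]. With [ev] the identity
    it is a derivation of a ring; with [ev] the evaluation at a point it is a tangent vector,
    twisted by a derivation of the coefficients. *)
Definition der_along {A R : comNzRingType} (ev E : A -> R) : Prop :=
  (forall x y, E (x + y) = E x + E y) /\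
  (forall x y, E (x * y) = E x * ev y + ev x * E y).

Section Monomials.
Context {V : choiceType} {R : comNzRingType}.
Implicit Types (x : V -> R) (k : {cmonom V}).

Definition mon_eval x k : R := \prod_(v <- finsupp k) x v ^+ k v.

Lemma mon_evalw (E : {fset V}) x k : (finsupp k `<=` E)%fset ->
  mon_eval x k = \prod_(v <- E) x v ^+ k v.
Proof.
move=> le; rewrite /mon_eval; apply: big_fset_incl => // v _.
by rewrite -cmE_eq0 => /eqP->; rewrite expr0.
Qed.

Lemma mon_evalM x k l : mon_eval x (k * l)%M = mon_eval x k * mon_eval x l.
Proof.
rewrite (@mon_evalw (finsupp k `|` finsupp l)%fset) ?mdomD //.
rewrite (@mon_evalw (finsupp k `|` finsupp l)%fset x k) ?fsubsetUl //.
rewrite (@mon_evalw (finsupp k `|` finsupp l)%fset x l) ?fsubsetUr //.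
by rewrite -big_split /=; apply: eq_bigr => v _; rewrite cmM exprD.
Qed.

Lemma mon_eval1 x : mon_eval x 1%M = 1.
Proof. by rewrite /mon_eval mdom1 big_seq_fset0. Qed.

Lemma mon_evalU x v : mon_eval x (ucm v) = x v.
Proof. by rewrite /mon_eval mdomU big_seq_fset1 cmUU expr1. Qed.

End Monomials.

Section MpolInduction.
Context {V : choiceType} {K : comNzRingType}.
Implicit Types f g : mpol V K.

Lemma mon_eval_pX (k : {cmonom V}) : mon_eval (pX K) k = mono 1 k.
Proof.
have dXn (v : V) n (l : {cmonom V}) : (forall w, l w = (n * (v == w))%N) ->
    pX K v ^+ n = mono 1 l.
  elim: n l => [|n IHn] l lE.
    rewrite expr0 -pC1 pC_mono.
    by apply: mono_inj_eq => w; rewrite lE cm1.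
  have [l' l'E] : exists l' : {cmonom V}, forall w, l' w = (n * (v == w))%N.
    elim: n {IHn lE} => [|n [l' l'E]].
      by exists 1%M => w; rewrite cm1.
    by exists (ucm v * l')%M => w; rewrite cmM ucmE l'E mulSn.
  rewrite exprS (IHn l') // pX_mono mono_mul mulr1.
  by apply: mono_inj_eq => w; rewrite cmM ucmE l'E lE mulSn.
have main (s : seq V) (l : {cmonom V}) : uniq s -> (forall w, l w = if w \in s then k w else 0)%N ->
    \prod_(v <- s) pX K v ^+ k v = mono 1 l.
  elim: s l => [|v s IHs] l /=.
    move=> _ lE; rewrite big_nil -pC1 pC_mono.
    by apply: mono_inj_eq => w; rewrite lE cm1.
  case/andP=> vs us lE.
  have [l1 l1E] : exists l1 : {cmonom V}, forall w, l1 w = (k v * (v == w))%N.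
    elim: (k v) => [|n [l' l'E]].
      by exists 1%M => w; rewrite cm1.
    by exists (ucm v * l')%M => w; rewrite cmM ucmE l'E mulSn.
  have [l2 l2E] : exists l2 : {cmonom V}, forall w, l2 w = (if w \in s then k w else 0)%N.
    exists [cmonom k w | w in [fset w | w in s]]%M => w.
    by rewrite /= cmE fsfunE !inE /=; case: ifP.
  rewrite big_cons (IHs _ us l2E) (dXn v (k v) _ l1E) mono_mul mulr1.
  apply: mono_inj_eq => w.
  rewrite cmM l1E l2E lE inE; case: (eqVneq w v) => [->|nvw] /=.
    by rewrite muln1 (negPf vs) addn0.
  by rewrite muln0.
apply: main => // w; case: ifP => // /negbT.
by rewrite -cmE_eq0 => /eqP.
Qed.

Lemma monoE (c : K) (k : {cmonom V}) : mono c k = pC V c * mon_eval (pX K) k.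
Proof. by rewrite mon_eval_pX pC_mono mono_mul mulr1 mul1m. Qed.

Lemma mpol_ind (P : mpol V K -> Prop) :
  (forall c, P (pC V c)) -> (forall v, P (pX K v)) ->
  (forall f g, P f -> P g -> P (f + g)) ->
  (forall f g, P f -> P g -> P (f * g)) -> forall f, P f.
Proof.
move=> PC PX PD PM; apply: mono_ind => // c k; rewrite monoE.
have P1 : P 1 by rewrite -pC1; apply: PC.
apply: (PM _ _ (PC c)); rewrite /mon_eval; apply: big_ind => // v _.
by elim: (k v) => [|n IHn]; rewrite ?expr0 // exprS; apply: PM.
Qed.

End MpolInduction.

Section CoeffSum.
Context {V : choiceType} {K R : comNzRingType}.
Variables (phi : K -> R) (h : {cmonom V} -> R).
Hypothesis phiD : forall a b, phi (a + b) = phi a + phi b.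
(** Only additivity of [phi] is assumed, since the coefficient map is often a derivation and not a
    ring morphism. *)
Definition coef_sum (f : mpol V K) := \sum_(k <- msupp f) phi f@_k * h k.

Let phi0 : phi 0 = 0.
Proof. by apply: (@addrI _ (phi 0)); rewrite -phiD !addr0. Qed.

Lemma coef_sumw (E : {fset {cmonom V}}) (f : mpol V K) :
  (msupp f `<=` E)%fset -> coef_sum f = \sum_(k <- E) phi f@_k * h k.
Proof.
move=> le; apply: big_fset_incl => // k _ /mcoeff_outdom ->.
by rewrite phi0 mul0r.
Qed.

Lemma coef_sumD f g : coef_sum (f + g) = coef_sum f + coef_sum g.
Proof.
pose E := (msupp f `|` msupp g)%fset.
rewrite (@coef_sumw E (f + g)) ?msuppD_le //.
rewrite (@coef_sumw E f) ?fsubsetUl // (@coef_sumw E g) ?fsubsetUr //.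
rewrite -big_split /=; apply: eq_bigr => k _.
by rewrite mcoeffD phiD mulrDl.
Qed.

Lemma coef_sumU c k : coef_sum (mono c k) = phi c * h k.
Proof.
have le : (msupp (mono c k) `<=` [fset k])%fset by rewrite mono.unlock; exact: msuppU_le.
by rewrite (coef_sumw le) big_seq_fset1 mono.unlock mcoeffUU.
Qed.

End CoeffSum.

Section Derivations.
Context {A R : comNzRingType}.
Variables (h : {rmorphism A -> R}) (E : A -> R).
Hypothesis dE : der_along h E.

Lemma der0 : E 0 = 0.
Proof. by apply: (@addrI _ (E 0)); rewrite -dE.1 !addr0. Qed.

Lemma derN x : E (- x) = - E x.
Proof. by apply: (@addrI _ (E x)); rewrite -dE.1 !subrr der0. Qed.

Lemma derB x y : E (x - y) = E x - E y.
Proof. by rewrite dE.1 derN. Qed.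

Lemma der1 : E 1 = 0.
Proof.
apply: (@addrI _ (E 1)); rewrite addr0 -{3}(mulr1 1) dE.2.
by rewrite !rmorph1 mulr1 mul1r.
Qed.

Lemma der_sum (I : Type) (r : seq I) (P : pred I) F :
  E (\sum_(i <- r | P i) F i) = \sum_(i <- r | P i) E (F i).
Proof. exact: (big_morph E dE.1 der0). Qed.

Lemma derMn x n : E (x *+ n) = E x *+ n.
Proof. by elim: n => [|n IHn]; rewrite ?mulr0n ?der0 // !mulrS dE.1 IHn. Qed.

End Derivations.

Lemma der_eq {V : choiceType} {K R : comNzRingType} (h E F : mpol V K -> R) :
  der_along h E -> der_along h F -> (forall c, E (pC V c) = F (pC V c)) ->
  (forall v, E (pX K v) = F (pX K v)) -> forall f, E f = F f.
Proof.
move=> dE dF eC eX; apply: mpol_ind => // f g ef eg.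
  by rewrite dE.1 dF.1 ef eg.
by rewrite dE.2 dF.2 ef eg.
Qed.

Section Evaluation.
Context {V : choiceType} {K R : comNzRingType}.
Implicit Types (f g : mpol V K) (x : V -> R).

Lemma evE (phi : K -> R) x f : ev phi x f = coef_sum phi (mon_eval x) f.
Proof. by rewrite ev.unlock. Qed.

Lemma eq_ev (phi psi : K -> R) x y f : phi =1 psi -> x =1 y ->
  ev phi x f = ev psi y f.
Proof.
move=> e1 e2; rewrite !evE; apply: eq_bigr => k _; rewrite e1; congr (_ * _).
by apply: eq_bigr => v _; rewrite e2.
Qed.

Lemma ev_monor (phi : K -> R) x c k : (forall a b, phi (a + b) = phi a + phi b) ->
  ev phi x (mono c k) = phi c * mon_eval x k.
Proof. by move=> h; rewrite evE coef_sumU. Qed.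

Lemma evDr (phi : K -> R) x f g : (forall a b, phi (a + b) = phi a + phi b) ->
  ev phi x (f + g) = ev phi x f + ev phi x g.
Proof. by move=> h; rewrite !evE coef_sumD. Qed.

Section Morphism.
Variables (iota : {rmorphism K -> R}) (x : V -> R).

Let iotaD a b : iota (a + b) = iota a + iota b.
Proof. exact: rmorphD. Qed.

Lemma ev_is_zmod_morphism : zmod_morphism (ev iota x : mpol V K -> R).
Proof.
by move=> f g; apply: (@addIr _ (ev iota x g)); rewrite -evDr // !subrK.
Qed.
HB.instance Definition _ := GRing.isZmodMorphism.Build (mpol V K) R
  (ev iota x) ev_is_zmod_morphism.

Lemma ev_mono c k : ev iota x (mono c k) = iota c * mon_eval x k.
Proof. exact: ev_monor. Qed.

Lemma evC c : ev iota x (pC V c) = iota c.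
Proof. by rewrite pC_mono ev_mono mon_eval1 mulr1. Qed.

Lemma evX v : ev iota x (pX K v) = x v.
Proof. by rewrite pX_mono ev_mono mon_evalU rmorph1 mul1r. Qed.

Lemma ev_is_monoid_morphism : monoid_morphism (ev iota x : mpol V K -> R).
Proof.
split; first by rewrite -pC1 evC rmorph1.
apply: (mono_bilin (F := fun f g => ev iota x (f * g))
  (G := fun f g => ev iota x f * ev iota x g)) => [f g h|f g h|f g h|f g h|c k c' l].
- by rewrite mulrDl evDr.
- by rewrite mulrDr evDr.
- by rewrite evDr // mulrDl.
- by rewrite evDr // mulrDr.
by rewrite mono_mul !ev_mono rmorphM mon_evalM mulrACA.
Qed.
HB.instance Definition _ := GRing.isMonoidMorphism.Build (mpol V K) R
  (ev iota x) ev_is_monoid_morphism.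

End Morphism.
End Evaluation.

Section Pder.
Context {V : choiceType} {K : comNzRingType}.
Implicit Types (f g : mpol V K) (u v w : V).

Definition mon_deriv v (k : {cmonom V}) : mpol V K :=
  (\prod_(w <- finsupp k) pX K w ^+ (if w == v then (k w).-1 else k w)) *+ k v.

Lemma pderE v f : pder v f = coef_sum (@pC V K) (mon_deriv v) f.
Proof.
rewrite pder.unlock /pderiv /coef_sum; apply: eq_bigr => k _.
rewrite /mon_deriv mulrnAr -mulrnAl -rmorphMn /= pC.unlock malg_mulE.
congr (_ * _); rewrite -malg_prodE; apply: eq_bigr => w _.
by rewrite -malg_expE pX.unlock.
Qed.

Lemma mon_derivw v (k : {cmonom V}) (E : {fset V}) : (finsupp k `<=` E)%fset -> v \in E ->
  mon_deriv v k =
    (\prod_(w <- E | w != v) pX K w ^+ k w) * pX K v ^+ (k v).-1 *+ k v.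
Proof.
move=> le vE; rewrite /mon_deriv; case: (posnP (k v)) => [->|kv]; first by rewrite !mulr0n.
congr (_ *+ _); rewrite (big_fset_incl _ le) /=; last first.
  by move=> w _; rewrite -cmE_eq0 => /eqP->; rewrite if_same expr0.
rewrite (bigD1_seq v) ?fset_uniq //= eqxx mulrC; congr (_ * _).
by apply: eq_bigr => w /negPf ->.
Qed.

Lemma mon_derivM v (k l : {cmonom V}) :
  mon_deriv v (k * l)%M =
    mon_deriv v k * mon_eval (pX K) l + mon_eval (pX K) k * mon_deriv v l.
Proof.
pose E := (v |` (finsupp k `|` finsupp l))%fset.
have vE : v \in E by rewrite !inE eqxx.
have kE : (finsupp k `<=` E)%fset by apply/fsubsetP => w; rewrite !inE => ->; rewrite orbT.
have lE : (finsupp l `<=` E)%fset by apply/fsubsetP => w; rewrite !inE => ->; rewrite !orbT.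
have klE : (finsupp (k * l)%M `<=` E)%fset.
  by rewrite mdomD; apply/fsubsetP => w; rewrite !inE => ->; rewrite orbT.
rewrite !(mon_derivw _ vE) // !(@mon_evalw _ _ E) //.
rewrite ![in X in _ = X](bigD1_seq v) ?fset_uniq //= cmM.
have -> : \prod_(w <- E | w != v) pX K w ^+ (k * l)%M w =
   (\prod_(w <- E | w != v) pX K w ^+ k w) * (\prod_(w <- E | w != v) pX K w ^+ l w).
  by rewrite -big_split /=; apply: eq_bigr => w _; rewrite cmM exprD.
move: (\prod_(w <- E | w != v) pX K w ^+ k w) (\prod_(w <- E | w != v) pX K w ^+ l w) => a b.
move: (pX K v) => X; rewrite -mulrnAr.
have -> : X ^+ (k v + l v).-1 *+ (k v + l v) =
    X ^+ (k v).-1 * X ^+ l v *+ k v + X ^+ k v * X ^+ (l v).-1 *+ l v.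
  case: (k v) => [|p]; first by rewrite !add0n mulr0n add0r expr0 mul1r.
  case: (l v) => [|q]; first by rewrite !addn0 mulr0n addr0 expr0 mulr1.
  by rewrite -!exprD !addSn addnS /= -mulrnDr addSn addnS.
rewrite mulrDr; congr (_ + _).
  by rewrite !mulrnAr !mulrnAl mulrACA (mulrC (X ^+ l v)).
by rewrite !mulrnAr (mulrC (X ^+ k v) a) mulrACA.
Qed.

Lemma pder_der v : der_along id (pder v : mpol V K -> _).
Proof.
have pCD : forall a b : K, pC V (a + b) = pC V a + pC V b by move=> a b; rewrite rmorphD.
have pD f g : pder v (f + g) = pder v f + pder v g by rewrite !pderE coef_sumD.
split=> //; apply: (mono_bilin (F := fun f g => pder v (f * g))
  (G := fun f g => pder v f * g + f * pder v g)) => [f g h|f g h|f g h|f g h|c k c' l].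
- by rewrite mulrDl pD.
- by rewrite mulrDr pD.
- by rewrite pD !mulrDl addrACA.
- by rewrite pD !mulrDr addrACA.
rewrite mono_mul !pderE !coef_sumU // mon_derivM !monoE mulrDr rmorphM /=.
by congr (_ + _); rewrite mulrACA.
Qed.

Lemma pderC v (c : K) : pder v (pC V c) = 0.
Proof.
rewrite pderE pC_mono coef_sumU; last by move=> a b; rewrite rmorphD.
by rewrite /mon_deriv cm1 mulr0n mulr0.
Qed.

Lemma pderX v w : pder v (pX K w) = (v == w)%:R.
Proof.
rewrite pderE pX_mono coef_sumU; last by move=> a b; rewrite rmorphD.
rewrite /mon_deriv mdomU big_seq_fset1 cmUU ucmE eq_sym rmorph1 mul1r.
by case: eqP => _; rewrite ?mulr0n // expr0 mulr1n.
Qed.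

Lemma pvarsP f v : reflect (exists2 k, k \in msupp f & k v != 0%N) (v \in pvars f).
Proof.
apply: (iffP (bigfcupP _ _ _ _)) => [[k]|[k kf kv]].
  by rewrite andbT => kf vk; exists k => //; rewrite cmE_neq0.
by exists k; rewrite ?kf // -cmE_neq0.
Qed.

Lemma pvars_mono (c : K) (k : {cmonom V}) : (pvars (mono c k) `<=` finsupp k)%fset.
Proof.
apply/fsubsetP => w /pvarsP[l].
have le : (msupp (mono c k) `<=` [fset k])%fset by rewrite mono.unlock; exact: msuppU_le.
move=> lf; have := fsubsetP le _ lf.
rewrite in_fset1 => /eqP ->.
by rewrite cmE_neq0.
Qed.

Lemma pvars_pX v : (pvars (pX K v) `<=` [fset v])%fset.
Proof. by rewrite pX_mono -(mdomU v); exact: pvars_mono. Qed.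

Lemma pvars_pC (c : K) : pvars (pC V c) = fset0.
Proof. by apply/eqP; rewrite -fsubset0 pC_mono -(@mdom1 V); exact: pvars_mono. Qed.

Lemma pder_pvars f v : v \notin pvars f -> pder v f = 0.
Proof.
move=> vf; rewrite pderE /coef_sum big_seq big1 // => k kf.
suff /eqP kv : k v == 0%N by rewrite /mon_deriv kv mulr0n mulr0.
by apply: contraNT vf => kv; apply/pvarsP; exists k.
Qed.

End Pder.

Section TotalDerivation.
Context {V : choiceType} {K R : comNzRingType}.
Variables (iota : {rmorphism K -> R}) (phi : K -> R).
Implicit Types (f g : mpol V K) (x y : V -> R).

(** The value of [tau f] at [(x, y)], with [phi] as the derivation on coefficients. With values in
    the polynomial ring itself it is also the derivation [pdel], so one Leibniz computation serves
    both. *)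
Definition dev x y f : R :=
  ev phi x f + \sum_(v <- pvars f) ev iota x (pder v f) * y v.

Lemma devw (E : {fset V}) x y f : (pvars f `<=` E)%fset ->
  dev x y f = ev phi x f + \sum_(v <- E) ev iota x (pder v f) * y v.
Proof.
move=> le; congr (_ + _); apply: big_fset_incl => // v _ /pder_pvars ->.
by rewrite rmorph0 mul0r.
Qed.

Hypothesis dphi : der_along iota phi.

Lemma ev_der x : der_along (ev iota x : mpol V K -> R) (ev phi x).
Proof.
have D f g : ev phi x (f + g) = ev phi x f + ev phi x g.
  by apply: evDr; exact: dphi.1.
split=> //; apply: (mono_bilin (F := fun f g => ev phi x (f * g))
  (G := fun f g => ev phi x f * ev iota x g + ev iota x f * ev phi x g))
  => [f g h|f g h|f g h|f g h|c k c' l].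
- by rewrite mulrDl D.
- by rewrite mulrDr D.
- by rewrite D rmorphD !mulrDl addrACA.
- by rewrite D rmorphD !mulrDr addrACA.
have U c1 k1 : ev phi x (mono c1 k1) = phi c1 * mon_eval x k1.
  by apply: ev_monor; exact: dphi.1.
by rewrite mono_mul !U !ev_mono dphi.2 mon_evalM mulrDl mulrACA [X in _ + X = _]mulrACA.
Qed.

Lemma dev_der x y : der_along (ev iota x : mpol V K -> R) (dev x y).
Proof.
have [D1 D2] := ev_der x.
split=> f g; pose E := (pvars f `|` pvars g `|` pvars (f + g) `|` pvars (f * g))%fset.
  have fE : (pvars f `<=` E)%fset by (apply/fsubsetP => v; rewrite !inE => ->).
  have gE : (pvars g `<=` E)%fset by (apply/fsubsetP => v; rewrite !inE => ->; rewrite orbT).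
  have fgE : (pvars (f + g) `<=` E)%fset by (apply/fsubsetP => v; rewrite !inE => ->; rewrite !orbT).
  rewrite (devw _ _ fE) (devw _ _ gE) (devw _ _ fgE) D1 addrACA -big_split /=.
  by congr (_ + _); apply: eq_bigr => v _; rewrite (pder_der v).1 rmorphD mulrDl.
have fE : (pvars f `<=` E)%fset by (apply/fsubsetP => v; rewrite !inE => ->).
have gE : (pvars g `<=` E)%fset by (apply/fsubsetP => v; rewrite !inE => ->; rewrite orbT).
have fgE : (pvars (f * g) `<=` E)%fset by (apply/fsubsetP => v; rewrite !inE => ->; rewrite !orbT).
rewrite (devw _ _ fE) (devw _ _ gE) (devw _ _ fgE) D2 mulrDl mulrDr addrACA.
congr (_ + _); rewrite mulr_suml mulr_sumr -big_split /=; apply: eq_bigr => v _.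
by rewrite (pder_der v).2 rmorphD !rmorphM mulrDl mulrA; congr (_ + _); rewrite mulrAC.
Qed.

Lemma devC x y c : dev x y (pC V c) = phi c.
Proof.
rewrite /dev pC_mono ev_monor; last exact: dphi.1.
rewrite mon_eval1 mulr1 big1 ?addr0 // => v _.
by rewrite -pC_mono pderC rmorph0 mul0r.
Qed.

Lemma devX x y v : dev x y (pX K v) = y v.
Proof.
rewrite (devw _ _ (pvars_pX v)).
rewrite big_seq_fset1 pderX eqxx rmorph1 mul1r pX_mono ev_monor; last exact: dphi.1.
by rewrite (der1 dphi) mul0r add0r.
Qed.

End TotalDerivation.

Lemma ev_comp {V W : choiceType} {K R S : comNzRingType} (iota : {rmorphism R -> S})
    (z : W -> S) (phi : K -> mpol W R) (y : V -> mpol W R) (f : mpol V K) :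
  ev iota z (ev phi y f) =
  ev (fun c => ev iota z (phi c)) (fun v => ev iota z (y v)) f.
Proof.
rewrite (evE phi y f) [RHS]evE /coef_sum rmorph_sum.
apply: eq_bigr => k _.
rewrite rmorphM rmorph_prod; congr (_ * _); apply: eq_bigr => v _.
by rewrite rmorphXn.
Qed.

Lemma ev_id {V : choiceType} {K : comNzRingType} (f : mpol V K) : ev (@pC V K) (pX K) f = f.
Proof.
move: f; apply: mpol_ind => [c|v|f g|f g]; rewrite ?evC ?evX // => e1 e2.
  by rewrite rmorphD /= e1 e2.
by rewrite rmorphM /= e1 e2.
Qed.

Lemma peval_mpol {V W : choiceType} {K R : comNzRingType} (phi : K -> mpol W R)
    (y : V -> mpol W R) (f : mpol V K) :
  peval (R := {malg R[cmonom W]}) phi y f = ev phi y f.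
Proof.
rewrite evE /peval /coef_sum; apply: eq_bigr => k _.
have Ek : (\prod_(v <- finsupp k) (y v : {malg R[cmonom W]}) ^+ k v) = mon_eval y k :> mpol W R.
  by rewrite /mon_eval -malg_prodE; apply: eq_bigr => v _; rewrite -malg_expE.
exact: etrans (malg_mulE _ _) (congr1 (fun z : mpol W R => (phi f@_k : mpol W R) * z) Ek).
Qed.

HB.lock Definition pdel (K : comNzRingType) (n m : nat) (d : 'I_m -> K -> K) (j : 'I_m)
  (f : mpol (dvar n m) K) : mpol (dvar n m) K := pdelta d j f.

Definition vshift {n m : nat} (j : 'I_m) (v : dvar n m) : dvar n m := (v.1, dshift j v.2).

Section DiffPolynomials.
Context {K : comNzRingType} {n m : nat}.
Local Notation V := (dvar n m).
Implicit Types (d : 'I_m -> K -> K) (f g : mpol V K).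

Lemma pdelE d j f :
  pdel d j f = dev (@pC V K) (fun c => pC V (d j c)) (pX K) (fun v => pX K (vshift j v)) f.
Proof.
have E1 : pmapc (d j) f = ev (fun c => pC V (d j c)) (pX K) f :> mpol V K.
  transitivity (ev (fun c => (d j c)%:MP : mpol V K) (dX : V -> mpol V K) f).
    exact: peval_mpol.
  by apply: eq_ev => [c|v]; rewrite ?pC.unlock ?pX.unlock.
rewrite pdel.unlock /pdelta /dev E1; congr (_ + _).
apply: eq_bigr => v _; apply: etrans (malg_mulE _ _) _.
by rewrite ev_id pder.unlock pX.unlock.
Qed.

End DiffPolynomials.

(** * Dickson's lemma and rankings *)

Section Dickson.
Local Open Scope nat_scope.

(** Let [M p] be a position where [f] is least from [p] on; starting again just after each such
    position makes the values nondecreasing. *)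
Lemma nondecreasing_subseq (f : nat -> nat) :
  exists phi : nat -> nat, {homo phi : i j / i < j} /\ {homo f \o phi : i j / i <= j}.
Proof.
have minP p : exists q, p <= q /\ forall q', p <= q' -> f q <= f q'.
  have ex : exists c, `[< exists2 q, p <= q & f q = c >].
    by exists (f p); apply/asboolP; exists p.
  case: (ex_minnP ex) => c /asboolP[q pq fq] cmin.
  exists q; split=> // q' pq'; rewrite fq; apply: cmin.
  by apply/asboolP; exists q'.
have [M MP] := choice minP.
pose fix phi k := if k is k'.+1 then M (phi k').+1 else M 0.
have phiS k : phi k < phi k.+1 := (MP _).1.
have mono : {homo phi : i j / i < j} by apply: homo_ltn => // i j k; apply: ltn_trans.
have key k : f (phi k) <= f (phi k.+1).
  have [p [pe pk]] : exists p, phi k = M p /\ p <= phi k.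
    by case: k => [|k]; [exists 0 | exists (phi k).+1; split=> //; apply: phiS].
  rewrite {1}pe; apply: (MP p).2; apply: leq_trans pk _; exact: ltnW.
by exists phi; split=> //; apply: homo_leq => // i j k; apply: leq_trans.
Qed.

Lemma nondecreasing_subseqs (T : Type) (g : nat -> T -> nat) (N : nat) (s : nat -> T) :
  exists phi : nat -> nat, {homo phi : i j / i < j} /\
    forall l, l < N -> {homo (fun i => g l (s (phi i))) : i j / i <= j}.
Proof.
elim: N => [|N [phi [phi1 phi2]]]; first by exists id; split.
have [psi [psi1 psi2]] := nondecreasing_subseq (fun i => g N (s (phi i))).
exists (phi \o psi); split=> [i j /psi1/phi1 //|l].
rewrite ltnS leq_eqVlt => /orP[/eqP->|lN]; first exact: psi2.
move=> i j ij /=; apply: phi2 => //.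
by move: ij; rewrite leq_eqVlt => /orP[/eqP->//|/psi1/ltnW].
Qed.

Context {n m : nat}.
Implicit Types u v w : dvar n m.

Definition dle u v := (u.1 == v.1) && [forall j, u.2 j <= v.2 j].

Lemma dvar_good (s : nat -> dvar n m) (d : nat -> nat) :
  exists i j, [/\ i < j, dle (s i) (s j) & d i <= d j].
Proof.
(* The index [i] enters both as [i] and as [n - i]: nondecreasing in both means constant, which is
   what [dle] demands. *)
pose g l (t : dvar n m * nat) := match l with
  | 0 => nat_of_ord t.1.1 | 1 => n - t.1.1 | 2 => t.2
  | l'.+3 => oapp (fun j => t.1.2 j) 0 (insub l') end.
have [phi [phi1 phi2]] := nondecreasing_subseqs g m.+3 (fun i => (s i, d i)).
exists (phi 0), (phi 1); split; [exact: phi1 | apply/andP; split | exact: (phi2 2)].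
  apply/eqP/val_inj/eqP; rewrite eqn_leq (phi2 0 _ 0 1) //=.
  have := phi2 1 isT 0 1 isT; rewrite /= => h.
  by rewrite -(@leq_sub2lE n) // ltnW.
apply/forallP => j; have := phi2 (val j).+3 (ltn_ord j) 0 1 isT.
by rewrite /= !valK.
Qed.

Lemma dle_ind (P : dvar n m -> Prop) u : P u ->
  (forall j v, dle u v -> P v -> P (v.1, dshift j v.2)) ->
  forall v, dle u v -> P v.
Proof.
move=> Pu PS v; have [c] := ubnP (\sum_j v.2 j); elim: c v => // c IHc [i e] /= ec.
case/andP=> /= /eqP ui /forallP /= le.
have [/forallP eq|/forallPn[j]] := boolP [forall j, u.2 j == e j].
  suff -> : (i, e) = u by [].
  by rewrite -ui [RHS]surjective_pairing; congr (_, _); apply/ffunP => j; rewrite (eqP (eq j)).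
move=> nuj; have uj : u.2 j < e j by rewrite ltn_neqAle nuj le.
pose e' : {ffun 'I_m -> nat} := [ffun k => e k - (k == j)].
have e'E : dshift j e' = e.
  apply/ffunP => k; rewrite !ffunE subnK //.
  by case: (eqVneq k j) => // ->; apply: leq_trans uj.
have le' : dle u (i, e').
  apply/andP; split=> /=; first by rewrite ui.
  apply/forallP => k; rewrite ffunE; case: (eqVneq k j) => [->|_]; last by rewrite subn0.
  by rewrite subn1 -ltnS prednK //; apply: leq_trans uj.
rewrite -e'E; apply: (PS j (i, e')) => //; apply: IHc => //=.
rewrite -ltnS; apply: leq_trans ec; rewrite ltnS.
rewrite (bigD1 j) //= [X in _ < X](bigD1 j) //= !ffunE eqxx subn1.
rewrite -addSn prednK; last exact: leq_trans uj.
rewrite leq_add2l; apply: leq_sum => k kj.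
by rewrite ffunE leq_subr.
Qed.

(** If no finite list served, one could keep choosing elements of [X] that lie above no earlier one,
    against [dvar_good]. *)
Lemma dvar_basis (X : dvar n m -> Prop) :
  exists l : seq (dvar n m), (forall u, u \in l -> X u) /\
    forall v, X v -> exists2 u, u \in l & dle u v.
Proof.
apply: contrapT => /forallNP noL.
have step (l : seq (dvar n m)) : exists v, (forall u, u \in l -> X u) ->
    X v /\ forall u, u \in l -> ~~ dle u v.
  have [lX|/existsNP[u nXu]] := pselect (forall u, u \in l -> X u); last first.
    by exists u => h; case: nXu; exact: h.
  apply: contrapT => /forallNP nov; apply: (noL l); split=> // v Xv.
  apply: contrapT => nou; apply: (nov v) => _; split=> // u ul.
  by apply/negP => uv; apply: nou; exists u.
have [F FP] := choice step.
pose fix L k := if k is k'.+1 then rcons (L k') (F (L k')) else [::].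
have LX k : forall u, u \in L k -> X u.
  elim: k => [|k IHk] u //=; rewrite mem_rcons inE => /orP[/eqP->|/IHk//].
  by have [] := FP _ IHk.
have FL i j : i < j -> F (L i) \in L j.
  elim: j => // j IHj; rewrite ltnS leq_eqVlt /= mem_rcons inE => /orP[/eqP->|/IHj->].
    by rewrite eqxx.
  by rewrite orbT.
have [i [j [ij le _]]] := dvar_good (fun k => F (L k)) (fun=> 0).
by have [_ /(_ _ (FL _ _ ij))] := FP _ (LX j); rewrite le.
Qed.

End Dickson.

Section Ranking.
Context {n m : nat} (rk : rel (dvar n m)).
Hypothesis rkP : is_ranking rk.
Implicit Types u v w : dvar n m.

Lemma rk_irr u : rk u u = false. Proof. by case: rkP => ->. Qed.
Lemma rk_trans : transitive rk. Proof. by case: rkP. Qed.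
Lemma rk_total u v : u != v -> rk u v || rk v u. Proof. by case: rkP => _ _ h _ _ /h. Qed.
Lemma rk_shift j u : rk u (vshift j u). Proof. by case: rkP => [_ _ _ h _]; exact: (h j u). Qed.
Lemma rk_vshift j u v : rk u v -> rk (vshift j u) (vshift j v).
Proof. by case: rkP => _ _ _ _ h uv; exact: h. Qed.

Definition rkle u v := (u == v) || rk u v.

Lemma rkle_refl u : rkle u u. Proof. by rewrite /rkle eqxx. Qed.

Lemma rk_rkle_trans v u w : rk u v -> rkle v w -> rk u w.
Proof. by move=> uv /orP[/eqP<-//|]; apply: rk_trans. Qed.

Lemma rkle_rk_trans v u w : rkle u v -> rk v w -> rk u w.
Proof. by move=> /orP[/eqP->//|]; apply: rk_trans. Qed.

Lemma rkW u v : rk u v -> rkle u v. Proof. by rewrite /rkle => ->; rewrite orbT. Qed.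

Lemma rkleNgt u v : rkle u v = ~~ rk v u.
Proof.
apply/idP/idP => [uv|]; first by apply/negP => /(rkle_rk_trans uv); rewrite rk_irr.
rewrite /rkle; case: eqVneq => //= /rk_total/orP[->//|->//].
Qed.

Lemma dle_rkle u v : dle u v -> rkle u v.
Proof.
apply: (dle_ind (P := rkle u)) => [|j w _ uw]; first exact: rkle_refl.
exact/rkW/(rkle_rk_trans uw)/rk_shift.
Qed.

(** A ranking increases along [dle], so an infinite descending sequence would contradict the good
    pair that Dickson's lemma provides. *)
Lemma rk_wf : well_founded rk.
Proof.
move=> u; apply: contrapT => nacc.
have step (v : {v | ~ Acc rk v}) : exists w : {v | ~ Acc rk v}, rk (sval w) (sval v).
  case: v => v nv /=; apply: contrapT => /forallNP no.
  by apply: nv; constructor => w wv; apply: contrapT => nw; apply: (no (exist _ w nw)).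
have [F FP] := choice step.
pose s k := sval (iter k F (exist (fun v => ~ Acc rk v) u nacc)).
have sS k : rk (s k.+1) (s k) by apply: FP.
have dec i j : (i < j)%N -> rk (s j) (s i).
  elim: j => // j IHj; rewrite ltnS leq_eqVlt => /orP[/eqP->//|/IHj].
  exact: rk_trans.
have [i [j [ij le _]]] := dvar_good s (fun=> 0%N).
by have := rkle_rk_trans (dle_rkle le) (dec _ _ ij); rewrite rk_irr.
Qed.

Lemma rk_max (l : seq (dvar n m)) : l != [::] ->
  exists2 v, v \in l & forall w, w \in l -> rkle w v.
Proof.
elim: l => // a l IHl _; case: (eqVneq l [::]) => [->|/IHl[v vl vmax]].
  by exists a; rewrite ?mem_seq1 // => w; rewrite mem_seq1 => /eqP->; apply: rkle_refl.
case: (boolP (rkle a v)) => av.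
  exists v; first by rewrite inE vl orbT.
  by move=> w; rewrite inE => /orP[/eqP->//|]; apply: vmax.
exists a; first by rewrite inE eqxx.
move=> w; rewrite inE => /orP[/eqP->|/vmax wv]; first exact: rkle_refl.
by move: av; rewrite rkleNgt negbK => /(rkle_rk_trans wv)/rkW.
Qed.

End Ranking.

(** * Degrees, leaders and initials *)

Section Coefficients.
Context {V : choiceType} {K : comNzRingType}.
Implicit Types (f g : mpol V K) (u v : V).

Lemma mcoeff_mono (c : K) (k l : {cmonom V}) : (mono c k)@_l = c *+ (k == l).
Proof. by rewrite mono.unlock mcoeffU. Qed.

Lemma mcoeffDp f g k : (f + g)@_k = f@_k + g@_k.
Proof. exact: mcoeffD. Qed.

Lemma mono0 (k : {cmonom V}) : mono 0 k = 0 :> mpol V K.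
Proof. by apply: (@addIr _ (mono 0 k)); rewrite -monoD addr0 add0r. Qed.

Lemma monoMn (c : K) (k : {cmonom V}) n : mono (c *+ n) k = mono c k *+ n.
Proof. by elim: n => [|n IHn]; rewrite ?mulr0n ?mono0 // !mulrS monoD IHn. Qed.

Lemma mon_div u (k : {cmonom V}) : (0 < k u)%N -> exists l, k = (ucm u * l)%M.
Proof.
move=> ku; exists (divcm k (ucm u)); apply/eqP/cmP => w.
rewrite cmM ucmE divcmE ucmE; case: eqVneq => [<-|_]; last by rewrite subn0.
by rewrite subnKC.
Qed.

Lemma mon_derivE u (l : {cmonom V}) :
  mon_deriv u (ucm u * l)%M = mono (K := K) (l u).+1%:R l.
Proof.
rewrite /mon_deriv cmM ucmE eqxx add1n monoMn.
congr (_ *+ _); rewrite -mon_eval_pX.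
have le : (finsupp l `<=` finsupp (ucm u * l)%M)%fset by rewrite mdomD fsubsetUr.
rewrite (mon_evalw _ le); apply: eq_bigr => w _; congr (_ ^+ _).
by rewrite cmM ucmE; case: (eqVneq w u) => _.
Qed.

Lemma mcoeff_pder u f l : (pder u f)@_l = f@_(ucm u * l)%M *+ (l u).+1.
Proof.
move: f; apply: mono_ind => [c k|f g IHf IHg]; last first.
  by rewrite (pder_der u).1 !mcoeffDp IHf IHg mulrnDl.
have -> : pder u (mono c k) = pC V c * mon_deriv u k.
  by rewrite pderE coef_sumU // => a b; rewrite rmorphD.
rewrite mcoeff_mono; case: (posnP (k u)) => [k0|/mon_div[k' ->]].
  rewrite /mon_deriv k0 mulr0n mulr0 mcoeff0; case: eqP => [kE|_]; last by rewrite mulr0n mul0rn.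
  by move: k0; rewrite kE cmM ucmE eqxx.
rewrite mon_derivE pC_mono mono_mul mul1m mcoeff_mono.
have -> : (ucm u * k' == ucm u * l)%M = (k' == l).
  apply/cmP/cmP => kl w; last by rewrite !cmM kl.
  by have := kl w; rewrite !cmM => /addnI.
by case: eqP => [->|_]; rewrite ?mulr0n ?mul0rn // mulr1n mulr_natr.
Qed.

Lemma pdegP v (f : mpol V K) d :
  reflect (forall k, k \in msupp f -> (k v <= d)%N) (\max_(k <- msupp f) k v <= d)%N.
Proof.
apply: (iffP (bigmax_leqP_seq _ _ _ _)) => h k; first by move=> kf; exact: h.
by move=> kf _; exact: h.
Qed.

End Coefficients.

Section Degree.
Context {K : comNzRingType} {n m : nat}.
Local Notation V := (dvar n m).
Implicit Types (f g : mpol V K) (u v w : V).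

Lemma pdeg_leP v f d :
  reflect (forall k, k \in msupp f -> (k v <= d)%N) (pdeg v f <= d)%N.
Proof. exact: pdegP. Qed.

Lemma pdeg_msupp v f k : k \in msupp f -> (k v <= pdeg v f)%N.
Proof. by move: k; apply/pdeg_leP. Qed.

Lemma pdeg_pvars v f : (v \in pvars f) = (0 < pdeg v f)%N.
Proof.
apply/idP/idP => [/pvarsP[k kf kv]|].
  by apply: leq_trans (pdeg_msupp v kf); rewrite lt0n.
rewrite ltnNge; apply: contraR => vf; apply/pdeg_leP => k kf.
by rewrite leqn0; apply: contraR vf => kv; apply/pvarsP; exists k.
Qed.

Lemma pdeg_notin v f : v \notin pvars f -> pdeg v f = 0%N.
Proof. by rewrite pdeg_pvars -leqNgt leqn0 => /eqP. Qed.

Lemma pdegD v f g d : (pdeg v f <= d)%N -> (pdeg v g <= d)%N -> (pdeg v (f + g) <= d)%N.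
Proof.
move=> /pdeg_leP fd /pdeg_leP gd; apply/pdeg_leP => k.
move/(fsubsetP (msuppD_le _ _)); rewrite in_fsetU => /orP[/fd|/gd] //.
Qed.

Lemma pdegN v f : pdeg v (- f) = pdeg v f.
Proof. by rewrite /pdeg msuppN. Qed.

Lemma pdegB v f g d : (pdeg v f <= d)%N -> (pdeg v g <= d)%N -> (pdeg v (f - g) <= d)%N.
Proof. by move=> fd gd; apply: pdegD => //; rewrite pdegN. Qed.

Lemma pdeg0 v : pdeg v (0 : mpol V K) = 0%N.
Proof. by apply/eqP; rewrite -leqn0; apply/pdeg_leP => k; rewrite msupp0. Qed.

Lemma pdeg_mono v (c : K) (k : {cmonom V}) : (pdeg v (mono c k) <= k v)%N.
Proof.
apply/pdeg_leP => l; rewrite -mcoeff_neq0 mcoeff_mono.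
by case: (eqVneq k l) => [->//|_]; rewrite mulr0n eqxx.
Qed.

Lemma pdeg_sum v (I : eqType) (r : seq I) (P : pred I) (F : I -> mpol V K) d :
  (forall i, i \in r -> P i -> (pdeg v (F i) <= d)%N) ->
  (pdeg v (\sum_(i <- r | P i) F i) <= d)%N.
Proof.
move=> h; rewrite big_seq_cond; apply: (big_ind (fun f => (pdeg v f <= d)%N)).
- by rewrite pdeg0.
- by move=> f g; exact: pdegD.
by move=> i /andP[]; exact: h.
Qed.

Lemma pdegM v f g : (pdeg v (f * g) <= pdeg v f + pdeg v g)%N.
Proof.
apply/pdeg_leP => k; rewrite -malg_mulE => /msuppM_le[k1 [k2 [k1f k2g ->]]].
by rewrite cmM leq_add // pdeg_msupp.
Qed.

Lemma pdegC v (c : K) : pdeg v (pC V c) = 0%N.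
Proof. by apply/eqP; rewrite -leqn0 pC_mono; apply: leq_trans (pdeg_mono _ _ _) _; rewrite cm1. Qed.

Lemma pdegX v w : (pdeg v (pX K w) <= (v == w))%N.
Proof. by rewrite pX_mono; apply: leq_trans (pdeg_mono _ _ _) _; rewrite ucmE eq_sym. Qed.

Lemma pdegXn v w d : (pdeg v (pX K w ^+ d) <= d * (v == w))%N.
Proof.
elim: d => [|d IHd]; first by rewrite expr0 -pC1 pdegC.
by rewrite exprS mulSn; apply: leq_trans (pdegM _ _ _) _; rewrite leq_add // pdegX.
Qed.

Lemma pdeg_pder v u f : (pdeg v (pder u f) <= pdeg v f - (v == u))%N.
Proof.
apply/pdeg_leP => l; rewrite -mcoeff_neq0 mcoeff_pder => lf.
have kf : (ucm u * l)%M \in msupp f.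
  by rewrite -mcoeff_neq0; apply: contraNneq lf => ->; rewrite mul0rn.
have := pdeg_msupp v kf; rewrite cmM ucmE eq_sym => h.
by rewrite -(leq_add2l (v == u)) addnBA ?addKn //; apply: leq_trans h; rewrite leq_addr.
Qed.

Lemma pvars_pder u f w : w \in pvars (pder u f) -> w \in pvars f.
Proof.
rewrite !pdeg_pvars => h; apply: leq_trans h _.
by apply: leq_trans (pdeg_pder _ _ _) _; rewrite leq_subr.
Qed.

Lemma pvarsD f g w : w \in pvars (f + g) -> (w \in pvars f) || (w \in pvars g).
Proof.
rewrite !pdeg_pvars; apply: contraTT; rewrite negb_or -!leqNgt => /andP[fw gw].
exact: pdegD.
Qed.

Lemma pvarsM f g w : w \in pvars (f * g) -> (w \in pvars f) || (w \in pvars g).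
Proof.
rewrite !pdeg_pvars; apply: contraTT; rewrite negb_or -!leqNgt => /andP[fw gw].
by apply: leq_trans (pdegM _ _ _) _; move: fw gw; rewrite !leqn0 => /eqP-> /eqP->.
Qed.

Lemma pvars_sum (I : eqType) (r : seq I) (P : pred I) (F : I -> mpol V K) w :
  w \in pvars (\sum_(i <- r | P i) F i) -> exists2 i, i \in r /\ P i & w \in pvars (F i).
Proof.
rewrite pdeg_pvars => h; apply: contrapT => /forall2NP no; move: h.
rewrite ltnNge => /negP; apply; apply: pdeg_sum => i ir Pi.
by rewrite leqNgt -pdeg_pvars; case: (no i) => [|/negP//]; case.
Qed.

Lemma pvarsX v w : w \in pvars (pX K v) -> w = v.
Proof. by rewrite pdeg_pvars => h; have := leq_trans h (pdegX w v); case: eqVneq. Qed.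

Lemma pvars0 f : pvars f = fset0 -> f = pC V (f@_1%M).
Proof.
move=> f0.
have kE k : k \in msupp f -> k = 1%M.
  move=> kf; apply/eqP/cmP => w; rewrite cm1.
  case: (posnP (k w)) => // kw; suff : w \in pvars f by rewrite f0 in_fset0.
  by apply/pvarsP; exists k; rewrite -?lt0n.
apply/malgP => k; rewrite pC_mono mcoeff_mono.
case: (eqVneq 1%M k) => [<-//|k1]; rewrite mulr0n mcoeff_outdom //.
by apply: contra k1 => /kE ->.
Qed.

Definition init u f : mpol V K := initial_at u f.

Lemma initE u f : init u f =
  \sum_(k <- msupp f | k u == pdeg u f) pC V f@_k * \prod_(w <- finsupp k | w != u) pX K w ^+ k w.
Proof.
rewrite /init /initial_at; apply: eq_bigr => k _.
have Ek : \prod_(w <- finsupp k | w != u) dX w ^+ k w =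
    \prod_(w <- finsupp k | w != u) pX K w ^+ k w :> mpol V K.
  by rewrite -malg_prodE; apply: eq_bigr => w _; rewrite -malg_expE pX.unlock.
by rewrite Ek pC.unlock; exact: malg_mulE.
Qed.

Lemma pdeg_init v u f : (pdeg v (init u f) <= if v == u then 0 else pdeg v f)%N.
Proof.
rewrite initE; apply: pdeg_sum => k kf _.
apply: leq_trans (pdegM _ _ _) _; rewrite pdegC add0n.
have gen (s : seq V) : uniq s ->
    (pdeg v (\prod_(w <- s | w != u) pX K w ^+ k w) <= if (v != u) && (v \in s) then k v else 0)%N.
  elim: s => [|a s IHs] /= => [_|/andP[as_ us]]; first by rewrite big_nil andbF -pC1 pdegC.
  rewrite big_cons; case: ifP => au; last first.
    apply: leq_trans (IHs us) _; rewrite inE.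
    by case: (eqVneq v u) => //= vu; case: (v \in s); rewrite ?orbT.
  apply: leq_trans (pdegM _ _ _) _.
  apply: leq_trans (leq_add (pdegXn _ _ _) (IHs us)) _; rewrite inE.
  case: (eqVneq v a) as_ => [->|va] as_; last by rewrite muln0.
  by rewrite muln1 (negPf as_) andbF addn0 au.
apply: leq_trans (gen _ (fset_uniq _)) _.
case: (eqVneq v u) => //= _; case: ifP => // _; exact: pdeg_msupp.
Qed.

Lemma init_decomp u f : exists g,
  [/\ f = init u f * pX K u ^+ pdeg u f + g,
      forall w, (pdeg w g <= pdeg w f)%N & (0 < pdeg u f)%N -> (pdeg u g < pdeg u f)%N].
Proof.
exists (\sum_(k <- msupp f | k u != pdeg u f) mono f@_k k); split.
- rewrite [LHS]mpolE (bigID (fun k : {cmonom V} => k u == pdeg u f)) /=; congr (_ + _).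
  rewrite initE mulr_suml; apply: eq_bigr => k /eqP <-.
  rewrite monoE -mulrA; congr (_ * _).
  have uE : u \in (u |` finsupp k)%fset by rewrite !inE eqxx.
  have kE : (finsupp k `<=` u |` finsupp k)%fset by rewrite fsubsetU1.
  rewrite (mon_evalw _ kE) (bigD1_seq u) ?fset_uniq //= mulrC; congr (_ * _).
  rewrite big_mkcond [RHS]big_mkcond /=; apply/esym; apply: big_fset_incl => // w _.
  by rewrite -cmE_eq0 => /eqP->; rewrite expr0 if_same.
- by move=> w; apply: pdeg_sum => k kf _; apply: leq_trans (pdeg_mono _ _ _) _; exact: pdeg_msupp.
move=> d0; have dE := prednK d0; rewrite -[X in (_ < X)%N]dE ltnS; apply: pdeg_sum => k kf ku.
apply: leq_trans (pdeg_mono _ _ _) _; rewrite -ltnS dE ltn_neqAle ku.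
exact: pdeg_msupp.
Qed.

Lemma init_neq0 u f : u \in pvars f -> init u f != 0.
Proof.
rewrite pdeg_pvars => d0; apply/eqP => i0.
have [g [fE _ /(_ d0)]] := init_decomp u f.
suff <- : f = g by rewrite ltnn.
by rewrite [LHS]fE i0 mul0r add0r.
Qed.

End Degree.

Lemma char0_mulrn_eq0 (K : fieldType) (c : K) k : [pchar K] =i pred0 ->
  (c *+ k.+1 == 0) = (c == 0).
Proof. by move=> /pcharf0P ch; rewrite -mulr_natr mulf_eq0 ch orbF. Qed.

Lemma pder_neq0 (V : choiceType) (K : fieldType) u (f : mpol V K) :
  [pchar K] =i pred0 -> u \in pvars f -> pder u f != 0.
Proof.
move=> ch /pvarsP[k kf]; rewrite -lt0n => /mon_div[l kE].
apply/eqP => f0; have := mcoeff_pder u f l; rewrite f0 mcoeff0 -kE => /esym/eqP.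
by rewrite char0_mulrn_eq0 //; apply/negP; rewrite mcoeff_neq0.
Qed.

Section Leaders.
Context {K : comNzRingType} {n m : nat} (rk : rel (dvar n m)).
Hypothesis rkP : is_ranking rk.
Local Notation V := (dvar n m).
Implicit Types (f g : mpol V K) (u v w : V).

Lemma leadP f u : reflect (u \in pvars f /\ forall w, w \in pvars f -> rkle rk w u)
  (lead rk f == Some u).
Proof.
pose p u := all (fun v => (v == u) || rk v u) (enum_fset (pvars f)).
have -> : lead rk f = ohead [seq u <- enum_fset (pvars f) | p u] by [].
have pP v : reflect (forall w, w \in pvars f -> rkle rk w v) (p v).
  by apply: (iffP allP).
apply: (iffP eqP) => [|[uf umax]].
  case E: [seq u <- _ | _] => [|a s] //= [<-].
  have : a \in [seq u <- enum_fset (pvars f) | p u] by rewrite E inE eqxx.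
  by rewrite mem_filter => /andP[/pP pa af].
have : u \in [seq u <- enum_fset (pvars f) | p u] by rewrite mem_filter uf andbT; apply/pP.
case E: [seq u <- _ | _] => [|a s] //= _.
have : a \in [seq u <- enum_fset (pvars f) | p u] by rewrite E inE eqxx.
rewrite mem_filter => /andP[/pP /(_ _ uf) ua /umax au].
congr Some; case/orP: ua => [/eqP//|ua].
by have := rkle_rk_trans rkP au ua; rewrite (rk_irr rkP).
Qed.

Lemma lead_None f : lead rk f = None -> pvars f = fset0.
Proof.
move=> lf; case: (fset_0Vmem (pvars f)) => // -[a af].
have [|v vf vmax] := @rk_max _ _ _ rkP (enum_fset (pvars f)).
  by apply/eqP => E; move: af; rewrite -[_ \in _]/(a \in enum_fset (pvars f)) E.
by have /eqP : lead rk f == Some v by [apply/leadP]; rewrite lf.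
Qed.

Lemma lead_ex f : pvars f != fset0 -> exists u, lead rk f = Some u.
Proof. by case E: (lead rk f) => [u|]; [exists u | rewrite (lead_None E) eqxx]. Qed.

Definition below v f := forall w, w \in pvars f -> rk w v.

Lemma belowD v f g : below v f -> below v g -> below v (f + g).
Proof. by move=> fv gv w /pvarsD/orP[/fv|/gv]. Qed.
Lemma belowM v f g : below v f -> below v g -> below v (f * g).
Proof. by move=> fv gv w /pvarsM/orP[/fv|/gv]. Qed.
Lemma belowX v w : rk w v -> below v (pX K w).
Proof. by move=> wv _ /pvarsX ->. Qed.
Lemma below_sum v (I : eqType) (r : seq I) (P : pred I) (F : I -> mpol V K) :
  (forall i, i \in r -> P i -> below v (F i)) -> below v (\sum_(i <- r | P i) F i).
Proof. by move=> h w /pvars_sum[i [ir Pi]]; apply: h. Qed.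
Lemma below_pder v u f : below v f -> below v (pder u f).
Proof. by move=> fv w /pvars_pder/fv. Qed.
Lemma below_pdeg v f : below v f -> pdeg v f = 0%N.
Proof. by move=> fv; apply: pdeg_notin; apply/negP => /fv; rewrite (rk_irr rkP). Qed.
Lemma below_trans v u f : rkle rk u v -> below u f -> below v f.
Proof. by move=> uv fu w /fu wu; apply: (rk_rkle_trans rkP wu uv). Qed.

End Leaders.

Section Pdel.
Context {K : comNzRingType} {n m : nat} (rk : rel (dvar n m)) (d : 'I_m -> K -> K).
Hypothesis rkP : is_ranking rk.
Hypothesis dD : forall j, is_derivation (d j).
Local Notation V := (dvar n m).
Implicit Types (f g : mpol V K) (u v w : V).

Lemma is_der_along j : der_along (idfun : K -> K) (d j).
Proof. by have [] := dD j. Qed.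

Lemma pC_der j : der_along (@pC V K) (fun c => pC V (d j c)).
Proof.
have [dA dM] := dD j; split=> a b; first by rewrite dA rmorphD.
by rewrite dM rmorphD !rmorphM.
Qed.

Lemma pdel_der j : der_along (idfun : mpol V K -> _) (pdel d j).
Proof.
have [h1 h2] := dev_der (pC_der j) (pX K) (fun v => pX K (vshift j v)).
by split=> f g; rewrite !pdelE ?h1 // h2 !ev_id.
Qed.

Lemma pdelC j c : pdel d j (pC V c) = pC V (d j c).
Proof. by rewrite pdelE devC //; exact: pC_der. Qed.

Lemma pdelX j v : pdel d j (pX K v) = pX K (vshift j v).
Proof. by rewrite pdelE devX //; exact: pC_der. Qed.

Lemma pvars_evC j f w : w \in pvars (ev (fun c => pC V (d j c)) (pX K) f) -> w \in pvars f.
Proof.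
rewrite evE => /pvars_sum[k [kf _]] /pvarsM/orP[|]; first by rewrite pvars_pC.
rewrite mon_eval_pX => /(fsubsetP (pvars_mono _ _)); rewrite -cmE_neq0 => kw.
by apply/pvarsP; exists k.
Qed.

Lemma pdel_below j v f : below rk v f -> below rk (vshift j v) (pdel d j f).
Proof.
move=> fv; have fv' : below rk (vshift j v) f.
  by apply: (below_trans rkP _ fv); apply: rkW; apply: rk_shift.
rewrite pdelE; apply: belowD => [w /pvars_evC/fv'//|].
apply: below_sum => w wf _; rewrite ev_id; apply: belowM; first exact: below_pder.
by apply: belowX; apply: rk_vshift => //; apply: fv.
Qed.

Definition affine_in v s f := exists t, [/\ f = s * pX K v + t, below rk v s & below rk v t].

Lemma pdel_affine j v s f : affine_in v s f -> affine_in (vshift j v) s (pdel d j f).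
Proof.
case=> t [-> sv tv]; exists (pdel d j s * pX K v + pdel d j t).
have vv : rk v (vshift j v) by apply: rk_shift.
rewrite (pdel_der j).1 (pdel_der j).2 pdelX; split.
- by rewrite addrA [_ + s * _]addrC.
- exact: (below_trans rkP (rkW vv) sv).
- apply: belowD; last exact: pdel_below.
  by apply: belowM; [exact: pdel_below | exact: belowX].
Qed.

Lemma pdel_lead j f u : lead rk f = Some u -> affine_in (vshift j u) (pder u f) (pdel d j f).
Proof.
move=> /eqP/(leadP rkP)[uf umax]; have vv : rk u (vshift j u) by apply: rk_shift.
have fb : below rk (vshift j u) f by move=> w /umax wu; apply: (rkle_rk_trans rkP wu vv).
pose rest := \sum_(v <- pvars f | v != u) pder v f * pX K (vshift j v).
exists (ev (fun c => pC V (d j c)) (pX K) f + rest); split.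
- rewrite pdelE /dev (bigD1_seq u) ?fset_uniq //= ev_id addrCA; congr (_ + (_ + _)).
  by apply: eq_bigr => v _; rewrite ev_id.
- exact: below_pder.
- apply: belowD => [w /pvars_evC/fb//|]; apply: below_sum => v vf vu.
  apply: belowM; first exact: below_pder.
  apply/belowX/rk_vshift => //; case/orP: (umax v vf) vu => [/eqP->|//].
  by rewrite eqxx.
Qed.

(** One derivation makes [f] affine in the shifted leader with the separant as coefficient; further
    derivations shift the leader and keep the coefficient. Quantifying over [Z] lets the same [q] be
    used in the ideal being reduced and in the one reduced into. *)
Lemma derivative_affine f u v : lead rk f = Some u -> dle u v -> v != u ->
  exists2 q, affine_in v (pder u f) q &
    forall Z : mpol V K -> Prop, (forall j g, Z g -> Z (pdel d j g)) -> Z f -> Z q.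
Proof.
move=> fu uv; pose P v := v != u -> exists2 q, affine_in v (pder u f) q &
  forall Z : mpol V K -> Prop, (forall j g, Z g -> Z (pdel d j g)) -> Z f -> Z q.
suff: P v by []; move: v uv; refine (@dle_ind n m P u _ _) => [|j v uv IHv _].
  by case/eqP.
case: (eqVneq v u) => [->|/IHv[q qv qZ]].
  exists (pdel d j f); first exact: pdel_lead.
  by move=> Z ZS Zf; apply: ZS.
exists (pdel d j q); first exact: pdel_affine.
by move=> Z ZS Zf; apply: (ZS); apply: qZ.
Qed.

End Pdel.

(** * Reduction and characteristic sets *)

Section Ideals.
Context {K : comNzRingType} {n m : nat} (d : 'I_m -> K -> K).
Local Notation V := (dvar n m).
Implicit Types (I : mpol V K -> Prop).

Definition dideal I := [/\ I 0, (forall f g, I f -> I g -> I (f + g)),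
  (forall f g, I g -> I (f * g)) & (forall j f, I f -> I (pdel d j f))].

Definition prime_dideal I := [/\ dideal I, ~ I 1 & forall f g, I (f * g) -> I f \/ I g].

Lemma is_prime_didealE I : is_prime_dideal d I <-> prime_dideal I.
Proof.
rewrite /is_prime_dideal /prime_dideal /dideal; split.
  case=> I0 ID IM Id [I1 IP]; split; first split=> //.
  - by move=> f g Ig; rewrite -malg_mulE; apply: IM.
  - by move=> j f If; rewrite pdel.unlock; apply: Id.
  - by rewrite -malg_oneE.
  - by move=> f g; rewrite -malg_mulE; apply: IP.
case=> [[I0 ID IM Id] I1 IP]; split=> //.
- by move=> f g Ig; rewrite malg_mulE; apply: IM.
- by move=> j f If; have := Id j f If; rewrite pdel.unlock.
- by split; [rewrite malg_oneE | move=> f g; rewrite malg_mulE; apply: IP].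
Qed.

Lemma didealN I f : dideal I -> I f -> I (- f).
Proof. by case=> _ _ IM _ If; rewrite -mulN1r; apply: IM. Qed.

Lemma didealB I f g : dideal I -> I f -> I g -> I (f - g).
Proof. by move=> dI If Ig; case: (dI) => _ ID _ _; apply: ID => //; apply: didealN. Qed.

End Ideals.

Section Reduction.
Context {K : comNzRingType} {n m : nat} (rk : rel (dvar n m)) (d : 'I_m -> K -> K).
Hypothesis rkP : is_ranking rk.
Hypothesis dD : forall j, is_derivation (d j).
Local Notation V := (dvar n m).
Implicit Types (f g q s t : mpol V K) (u v w : V).

Lemma proper_derivP v u : reflect (dle u v /\ v != u) (proper_deriv v u).
Proof.
apply: (iffP and3P) => [[/eqP e le ne]|[/andP[/eqP e le] ne]]; split.
- by apply/andP; rewrite e.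
- by apply: contraNneq ne => ->.
- by rewrite e.
- by [].
- by apply: contraNneq ne => ne; rewrite [v]surjective_pairing ne -e -surjective_pairing.
Qed.

Lemma initialE f u : lead rk f = Some u -> initial rk f = init u f.
Proof. by rewrite /initial => ->. Qed.

Lemma separantE f u : lead rk f = Some u -> separant rk f = pder u f.
Proof. by rewrite /separant pder.unlock => ->. Qed.

Variables (Lam : seq (mpol V K)) (P Z : mpol V K -> Prop).
Hypothesis LamL : forall f, f \in Lam -> lead rk f != None.
Hypothesis idP : dideal d P.
Hypothesis LamP : forall f, f \in Lam -> P f.
Hypothesis red0 : forall g, P g -> (forall f, f \in Lam -> reduced rk g f) -> g = 0.
Hypothesis idZ : dideal d Z.
Hypothesis LamZ : forall f, f \in Lam -> Z f.
Hypothesis satI : forall f g, f \in Lam -> Z ((initial rk f : mpol V K) * g) -> Z g.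
Hypothesis satS : forall f g, f \in Lam -> Z ((separant rk f : mpol V K) * g) -> Z g.

Definition reducible_at g w := w \in pvars g /\ exists f u, [/\ f \in Lam, lead rk f = Some u &
  proper_deriv w u \/ w = u /\ (pdeg u f <= pdeg u g)%N].

Lemma irreducible0 g : P g -> (forall w, ~ reducible_at g w) -> g = 0.
Proof.
move=> Pg irr; apply: red0 => // f fL; rewrite /reduced.
case fu: (lead rk f) (LamL fL) => [u|//] _; apply/andP; split.
  apply/allP => w wg; apply/negP => wu; apply: (irr w); split=> //.
  by exists f, u; split=> //; left.
rewrite ltnNge; apply/negP => le; apply: (irr u); split; last by exists f, u; split=> //; right.
rewrite pdeg_pvars; apply: leq_trans le; rewrite -pdeg_pvars.
by have /eqP/(leadP rkP)[] := fu.
Qed.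

(** Both kinds of reduction in one shape: a proper derivative of an element of [Lam] has [e = 1] and
    the separant for [s], an element itself has its degree for [e] and the initial for [s]. In
    either case [s] cancels modulo [Z]. *)
Lemma reducer g v : reducible_at g v -> exists q s t e,
  [/\ P q, Z q, q = s * pX K v ^+ e + t & (0 < e <= pdeg v g)%N] /\
  [/\ below rk v s, (forall w, w \in pvars t -> rkle rk w v), (pdeg v t < e)%N &
      forall h, Z (s * h) -> Z h].
Proof.
case: (idP) (idZ) => _ _ _ Pd [_ _ _ Zd].
case=> vg [f [u [fL fu]]] [/proper_derivP[uv vu]|[-> le]].
  have [q [t [qE bs bt]] qZ] := derivative_affine rkP dD fu uv vu.
  exists q, (pder u f), t, 1%N; split; split=> //.
  - by apply: qZ => //; exact: LamP.
  - by apply: qZ => //; exact: LamZ.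
  - by rewrite /= -pdeg_pvars.
  - by move=> w /bt /rkW.
  - by rewrite (below_pdeg rkP bt).
  - by move=> h; rewrite -(separantE fu); exact: satS.
have [uf umax] : u \in pvars f /\ forall w, w \in pvars f -> rkle rk w u.
  by have /eqP/(leadP rkP) := fu.
have d0 : (0 < pdeg u f)%N by rewrite -pdeg_pvars.
have [t [fE tle /(_ d0) td]] := init_decomp u f.
exists f, (init u f), t, (pdeg u f); split; split=> //.
- exact: LamP.
- exact: LamZ.
- by rewrite d0.
- move=> w; rewrite pdeg_pvars => wi; have := leq_trans wi (pdeg_init w u f).
  case: eqVneq => // wu; rewrite -pdeg_pvars => /umax /orP[/eqP wu'|//].
  by rewrite wu' eqxx in wu.
- by move=> w; rewrite pdeg_pvars => wt; apply: umax; rewrite pdeg_pvars; apply: leq_trans wt _.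
- by move=> h; rewrite -(initialE fu); exact: satI.
Qed.

Lemma reduction_step g v : P g -> reducible_at g v -> exists g',
  [/\ P g', (Z g' -> Z g), (pdeg v g' < pdeg v g)%N &
      forall w, rk v w -> (pdeg w g' <= pdeg w g)%N].
Proof.
move=> Pg /reducer[q [s [t [e [[Pq Zq qE /andP[e0 ed]] [sv tv te sat]]]]]].
have d0 : (0 < pdeg v g)%N by apply: leq_trans ed.
have [g1 [gE g1le /(_ d0) g1d]] := init_decomp v g.
set i := init v g in gE; set D := pdeg v g in gE d0 ed g1d *.
(* Pseudo-division: the leading terms in [v] of the two products cancel, and degrees in the
   variables above [v] do not grow because [s] and [t] involve none of them. *)
exists (s * g - i * pX K v ^+ (D - e) * q).
have E : s * g - i * pX K v ^+ (D - e) * q = s * g1 - i * pX K v ^+ (D - e) * t.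
  rewrite gE qE !mulrDr opprD addrACA [X in X + _](_ : _ = 0) ?add0r //.
  have -> : pX K v ^+ D = pX K v ^+ (D - e) * pX K v ^+ e by rewrite -exprD subnK.
  by rewrite [i * (_ * _)]mulrA mulrCA subrr.
have [_ _ PM _] := idP; have [_ ZD ZM _] := idZ.
split.
- by apply: (didealB idP); apply: PM.
- move=> Zg'; apply: sat; rewrite -[s * g](subrK (i * pX K v ^+ (D - e) * q)).
  by apply: ZD => //; apply: ZM.
- rewrite E -(prednK d0) ltnS; apply: pdegB.
    apply: leq_trans (pdegM _ _ _) _; rewrite (below_pdeg rkP sv) add0n -ltnS prednK //.
  apply: leq_trans (pdegM _ _ _) _; rewrite -ltnS prednK //.
  apply: leq_ltn_trans (_ : ((D - e) + pdeg v t < D)%N); last first.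
    by rewrite -[X in (_ < X)%N](subnK ed) ltn_add2l.
  rewrite leq_add2r; apply: leq_trans (pdegM _ _ _) _.
  have := pdeg_init v v g; rewrite eqxx leqn0 => /eqP ->; rewrite add0n.
  by apply: leq_trans (pdegXn _ _ _) _; rewrite eqxx muln1.
move=> w vw; rewrite E; apply: pdegB.
  apply: leq_trans (pdegM _ _ _) _; rewrite [pdeg w s]pdeg_notin ?add0n //.
  by apply/negP => /sv wv; have := rk_trans rkP vw wv; rewrite (rk_irr rkP).
apply: leq_trans (pdegM _ _ _) _; rewrite [pdeg w t]pdeg_notin ?addn0; last first.
  by apply/negP => /tv; rewrite (rkleNgt rkP) vw.
have wv : w == v = false by apply/negP => /eqP e'; move: vw; rewrite e' (rk_irr rkP).
apply: leq_trans (pdegM _ _ _) _; apply: leq_trans (leq_add (pdeg_init _ _ _) (pdegXn _ _ _)) _.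
by rewrite wv muln0 addn0.
Qed.

Lemma reducible_max g : (forall w, ~ reducible_at g w) \/
  exists2 v, reducible_at g v & forall w, reducible_at g w -> rkle rk w v.
Proof.
have [irr|/existsNP[w0 /contrapT w0r]] := pselect (forall w, ~ reducible_at g w); first by left.
right; pose l := [seq w <- enum_fset (pvars g) | `[< reducible_at g w >]].
have lP w : reflect (reducible_at g w) (w \in l).
  rewrite mem_filter; apply: (iffP andP) => [[/asboolP//]|hw].
  by split; [exact/asboolP | case: hw].
have [|w wl wmax] := @rk_max _ _ _ rkP l.
  by apply/eqP => l0; move/lP: w0r; rewrite l0.
by exists w => [|w' /lP/wmax]; first exact/lP.
Qed.

(** Induction on [v] along the ranking, then on the degree in [v]. Variables above [v] may occur in
    [g], but only irreducibly, and they stay irreducible since a step at [v] does not raise their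
    degrees. *)
Lemma reduction_bounded v D g : P g ->
  (forall w, reducible_at g w -> rk w v \/ w = v /\ (pdeg v g <= D)%N) -> Z g.
Proof.
move: D g; elim/(well_founded_ind (rk_wf rkP)): v => v IHv.
have step g : P g -> (forall w, reducible_at g w -> rk w v) -> Z g.
  move=> Pg red; have [irr|[w wg wmax]] := reducible_max g.
    by rewrite (irreducible0 Pg irr); case: idZ.
  apply: (IHv w _ (pdeg w g)) => //; first exact: red.
  by move=> w' /wmax/orP[/eqP ->|]; [right | left].
elim=> [|D IHD] g Pg red.
  apply: step => // w gw; case: (red w gw) => // -[wv]; rewrite leqn0 => /eqP g0.
  by case: gw; rewrite wv pdeg_pvars g0.
have [gv|ngv] := pselect (reducible_at g v); last first.
  apply: step => // w gw; case: (red w gw) => // -[wv _].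
  by rewrite wv in gw.
have gD : (pdeg v g <= D.+1)%N by case: (red v gv) => [|[]//]; rewrite (rk_irr rkP).
have [h [Ph ZZ deg degw]] := reduction_step Pg gv.
apply: ZZ; apply: IHD => // w [wh [f [u [fL fu fw]]]].
case: (boolP (rk v w)) => [vw|]; last first.
  rewrite -(rkleNgt rkP) => /orP[/eqP wv|]; last by left.
  by right; split=> //; rewrite -ltnS; apply: leq_trans gD.
have wg : reducible_at g w.
  split; first by rewrite pdeg_pvars; apply: leq_trans (degw w vw); rewrite -pdeg_pvars.
  exists f, u; split=> //; case: fw => [|[wu le]]; first by left.
  by right; split=> //; apply: leq_trans le _; rewrite -wu; exact: degw.
case: (red w wg) => [wv|[wv _]]; last by move: vw; rewrite wv (rk_irr rkP).
by have := rk_trans rkP vw wv; rewrite (rk_irr rkP).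
Qed.

(** Ritt reduction without remainders: instead of exhibiting a product of initials and separants
    that carries [g] into the ideal of [Lam], it follows membership in any differential ideal [Z]
    that contains [Lam] and in which those factors cancel. *)
Lemma reduction g : P g -> Z g.
Proof.
move=> Pg; have [irr|[v gv vmax]] := reducible_max g.
  by rewrite (irreducible0 Pg irr); case: idZ.
apply: (@reduction_bounded v (pdeg v g)) => // w /vmax/orP[/eqP ->|]; first by right.
by left.
Qed.

End Reduction.

Lemma sorted_split (T : Type) (le : rel T) (p : pred T) (s : seq T) : transitive le ->
  (forall x y, le x y -> p y -> p x) -> sorted le s ->
  exists s1 s2, [/\ s = s1 ++ s2, all p s1 & all (predC p) s2].
Proof.
move=> tr down; elim: s => [|x s IHs] /= sx; first by exists [::], [::].
have [s1 [s2 [sE p1 p2]]] := IHs (path_sorted sx).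
case px: (p x); first by exists (x :: s1), s2; rewrite /= px sE.
exists [::], (x :: s); split=> //=; rewrite px /=.
apply: sub_all (order_path_min tr sx) => y xy /=.
by apply/negP => /(down _ _ xy); rewrite px.
Qed.

Section CharSetTheory.
Context {K : fieldType} {n m : nat} (rk : rel (dvar n m)) (d : 'I_m -> K -> K).
Hypothesis rkP : is_ranking rk.
Hypothesis dD : forall j, is_derivation (d j).
Local Notation V := (dvar n m).
Implicit Types (f g h : mpol V K) (u v w : V) (A B Lam : seq (mpol V K)).

Lemma rank_leE f g : rank_le rk f g = match lead rk f, lead rk g with
  | None, _ => true | Some _, None => false
  | Some u, Some v => rk u v || ((u == v) && (pdeg u f <= pdeg v g)%N) end.
Proof.
rewrite /rank_le /rank_lt /rank_eq; case: (lead rk f) => [u|]; case: (lead rk g) => [v|] //.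
by case: (rk u v) => //=; case: (u == v) => //=; rewrite orbC -leq_eqVlt.
Qed.

Lemma rank_ltNge f g : rank_lt rk f g = ~~ rank_le rk g f.
Proof.
rewrite rank_leE /rank_lt; case: (lead rk f) => [u|]; case: (lead rk g) => [v|] //.
case: (eqVneq u v) => [->|uv] /=; first by rewrite (rk_irr rkP) /= ltnNge.
by rewrite !orbF -(rkleNgt rkP) /rkle (negPf uv).
Qed.

Lemma rank_le_refl f : rank_le rk f f.
Proof. by rewrite rank_leE; case: (lead rk f) => // u; rewrite eqxx leqnn orbT. Qed.

Lemma rank_le_trans : transitive (rank_le rk : rel (mpol V K)).
Proof.
move=> g f h; rewrite !rank_leE; case: (lead rk f) => [u|] //; case: (lead rk g) => [v|] //.
case: (lead rk h) => [w|] // /orP[uv|/andP[/eqP-> fg]] /orP[vw|/andP[/eqP<- gh]].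
- by rewrite (rk_trans rkP uv vw).
- by rewrite uv.
- by rewrite vw.
- by rewrite eqxx (leq_trans fg gh) orbT.
Qed.

Lemma rank_ltW f g : rank_lt rk f g -> rank_le rk f g.
Proof. by rewrite /rank_le => ->. Qed.

Lemma rank_le_total : total (rank_le rk : rel (mpol V K)).
Proof.
by move=> f g; apply/orP; case: (boolP (rank_le rk g f)); [right | rewrite -rank_ltNge => /rank_ltW; left].
Qed.

Lemma rank_le_lt f g : rank_le rk f g -> ~~ rank_eq rk f g -> rank_lt rk f g.
Proof. by rewrite /rank_le => /orP[//|->]. Qed.

Lemma rank_eq_refl f : rank_eq rk f f.
Proof. by rewrite /rank_eq; case: (lead rk f) => // u; rewrite !eqxx. Qed.

Lemma reducedP f g u : lead rk g = Some u ->
  reflect ((forall w, w \in pvars f -> ~~ proper_deriv w u) /\ (pdeg u f < pdeg u g)%N)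
    (reduced rk f g).
Proof.
rewrite /reduced => ->.
by apply: (iffP andP) => -[] => [/allP|h] ?; split=> //; apply/allP.
Qed.

Lemma reduced_irr f : reduced rk f f = false.
Proof. by rewrite /reduced; case: (lead rk f) => // u; rewrite ltnn andbF. Qed.

Lemma rank_eq_reduced f g h : rank_eq rk g h -> reduced rk f g = reduced rk f h.
Proof.
rewrite /rank_eq /reduced; case: (lead rk g) => [u|]; case: (lead rk h) => [v|] //.
by case/andP=> /eqP -> /eqP ->.
Qed.

Lemma reduced_rank_neq f g : reduced rk f g -> ~~ rank_eq rk f g.
Proof.
rewrite /rank_eq; case fu: (lead rk f) => [u|]; case gv: (lead rk g) => [v|] //; last first.
  by rewrite /reduced gv.
case/(reducedP f gv) => _ lt; apply/negP => /andP[/eqP uv /eqP e].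
by move: lt; rewrite -e uv ltnn.
Qed.

Lemma rank_eq_sym f g : rank_eq rk f g = rank_eq rk g f.
Proof.
rewrite /rank_eq; case: (lead rk f) => [u|]; case: (lead rk g) => [v|] //.
by rewrite eq_sym; congr (_ && _); rewrite eq_sym.
Qed.

Lemma proper_deriv_rk v u : proper_deriv v u -> rk u v.
Proof.
case/proper_derivP => uv vu; case/orP: (dle_rkle rkP uv) => // /eqP e.
by rewrite e eqxx in vu.
Qed.

Lemma rank_lt_reduced f g : lead rk f != None -> rank_lt rk f g -> reduced rk f g.
Proof.
rewrite /rank_lt; case fu: (lead rk f) => [u|] // _; case gv: (lead rk g) => [v|] // lt.
have /eqP/(leadP rkP)[uf umax] := fu.
apply/(reducedP f gv); split=> [w /umax wu|].
  apply/negP => /proper_deriv_rk vw; have vu := rk_rkle_trans rkP vw wu.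
  case/orP: lt => [uv|/andP[/eqP uv _]]; last by rewrite uv (rk_irr rkP) in vu.
  by have := rk_trans rkP uv vu; rewrite (rk_irr rkP).
case/orP: lt => [uv|/andP[/eqP -> //]].
rewrite [pdeg v f]pdeg_notin -?pdeg_pvars; first by have /eqP/(leadP rkP)[] := gv.
by apply/negP => /umax; rewrite (rkleNgt rkP) uv.
Qed.

Lemma reduced_le f g h : (forall w, (pdeg w f <= pdeg w g)%N) -> reduced rk g h -> reduced rk f h.
Proof.
move=> le; case hu: (lead rk h) => [u|]; last by rewrite /reduced hu.
case/(reducedP g hu) => h1 h2; apply/(reducedP f hu); split.
  by move=> w; rewrite pdeg_pvars => wf; apply: h1; rewrite pdeg_pvars; apply: leq_trans wf _.
exact: leq_ltn_trans h2.
Qed.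

Lemma autoreducedP A : autoreduced rk A <-> [/\ forall f, f \in A -> lead rk f != None, uniq A &
  forall f g, f \in A -> g \in A -> f != g -> reduced rk f g].
Proof.
split=> [[lA rA]|[lA uA rA]]; last first.
  split=> // i j iA jA ij; apply: rA; rewrite ?mem_nth //.
  by rewrite nth_uniq.
split=> //.
  apply/(uniqPn 0) => -[i [j [ij jA e]]].
  have := rA i j (ltn_trans ij jA) jA (negbT (ltn_eqF ij)).
  by rewrite e -[nth _ _ _]/(nth (0 : mpol V K) A j) reduced_irr.
move=> f g fA gA fg.
have fi : (index f A < size A)%N by rewrite index_mem.
have gi : (index g A < size A)%N by rewrite index_mem.
have fE : nth 0 A (index f A) = f by apply: nth_index.
have gE : nth 0 A (index g A) = g by apply: nth_index.
have /(rA _ _ fi gi) : index f A != index g A by apply: contra fg => /eqP e; rewrite -fE e gE.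
by rewrite fE gE.
Qed.
Lemma aset_ltP A B : sorted (rank_le rk) A -> sorted (rank_le rk) B ->
  aset_lt rk A B <->
  (exists k, [/\ (k < minn (size A) (size B))%N,
     forall i, (i < k)%N -> rank_eq rk (nth 0 A i : mpol V K) (nth 0 B i) &
     rank_lt rk (nth 0 A k : mpol V K) (nth 0 B k)]) \/
  ((size B < size A)%N /\ forall i, (i < size B)%N -> rank_eq rk (nth 0 A i : mpol V K) (nth 0 B i)).
Proof.
move=> sA sB; rewrite /aset_lt.
rewrite (sorted_sort rank_le_trans sA) (sorted_sort rank_le_trans sB).
by split=> -[[k [h1]]|]; [case=> h2 h3; left; exists k | right | move=> h2 h3; left; exists k | right].
Qed.

Lemma autoreduced_perm A B : perm_eq A B -> autoreduced rk A -> autoreduced rk B.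
Proof.
move=> AB /autoreducedP[lA uA rA]; apply/autoreducedP; split.
- by move=> f; rewrite -(perm_mem AB); apply: lA.
- by rewrite -(perm_uniq AB).
- by move=> f g; rewrite -!(perm_mem AB); apply: rA.
Qed.

Section PrimeIdeal.
Variable P : mpol V K -> Prop.
Hypothesis idP : dideal d P.
Hypothesis P1 : ~ P 1.

Lemma dideal_lead g : P g -> g != 0 -> exists u, lead rk g = Some u.
Proof.
move=> Pg g0; apply: lead_ex => //; apply/eqP => /pvars0 gE; apply: P1.
have c0 : g@_1%M != 0 by apply: contraNneq g0 => c0; rewrite gE c0 rmorph0.
have [_ _ PM _] := idP; have := PM (pC V (g@_1%M)^-1) g Pg.
by rewrite {2}gE -rmorphM /= mulVf // rmorph1.
Qed.

(** A nonzero [g] has a leader because [P] is proper. The elements of [Lam] of rank below [g],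
    followed by [g], would then form an autoreduced subset of [P] lower than [Lam]. *)
Lemma charset_reduced0 Lam g : is_charset rk P Lam -> P g ->
  (forall f, f \in Lam -> reduced rk g f) -> g = 0.
Proof.
case=> aL LP Lmin Pg gred; apply/eqP; apply: contraT => g0; exfalso.
have [u gu] := dideal_lead Pg g0.
pose a := sort (rank_le rk) Lam.
have sa : sorted (rank_le rk) a by apply: sort_sorted; exact: rank_le_total.
have pa : perm_eq Lam a by rewrite perm_sym perm_sort.
have down x y : rank_le rk x y -> rank_lt rk y g -> rank_lt rk x g.
  by move=> xy; rewrite !rank_ltNge; apply: contra => gx; apply: rank_le_trans xy.
have [a1 [a2 [aE /allP l1 /allP l2]]] := sorted_split rank_le_trans down sa.
have [lL uL rL] := (autoreducedP Lam).1 aL.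
have memL f : f \in a1 ++ a2 -> f \in Lam by rewrite -aE (perm_mem pa).
have a1L f : f \in a1 -> f \in Lam by move=> fa; apply: memL; rewrite mem_cat fa.
have ua : uniq (a1 ++ a2) by rewrite -aE -(perm_uniq pa).
have srB : sorted (rank_le rk) (rcons a1 g).
  rewrite sorted_pairwise; last exact: rank_le_trans.
  rewrite pairwise_rcons -sorted_pairwise; last exact: rank_le_trans.
  apply/andP; split; first by apply/allP => f /l1/rank_ltW.
  by move: sa; rewrite aE => /cat_sorted2[].
have arB : autoreduced rk (rcons a1 g).
  apply/autoreducedP; split.
  - by move=> f; rewrite mem_rcons inE => /orP[/eqP->|/a1L/lL//]; rewrite gu.
  - rewrite rcons_uniq; move: ua; rewrite cat_uniq => /and3P[-> _ _]; rewrite andbT.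
    by apply/negP => /l1; rewrite rank_ltNge rank_le_refl.
  move=> f h; rewrite !mem_rcons !inE => /orP[/eqP->|fa] /orP[/eqP->|ha] fh.
  - by rewrite eqxx in fh.
  - by apply/gred/a1L.
  - by apply: rank_lt_reduced; [apply/lL/a1L | apply: l1].
  - by apply: rL => //; apply: a1L.
have BP f : f \in rcons a1 g -> P f.
  by rewrite mem_rcons inE => /orP[/eqP->//|/a1L/LP].
have aa : aset_lt rk (rcons a1 g) a -> aset_lt rk (rcons a1 g) Lam.
  by rewrite /aset_lt (sorted_sort rank_le_trans sa).
apply: (Lmin (rcons a1 g) arB BP); apply: aa; apply/(aset_ltP srB sa).
have eqi i : (i < size a1)%N -> rank_eq rk (nth 0 (rcons a1 g) i) (nth 0 a i).
  by move=> ia; rewrite nth_rcons ia aE nth_cat ia; apply: rank_eq_refl.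
(* If no element of [Lam] is left above, the new set is lower because it is longer; otherwise it is
   lower at position [size a1]. *)
case: a2 aE l2 memL ua => [|y a2] aE l2 memL ua.
  right; rewrite aE cats0 size_rcons; split=> // i ia.
  by move: (eqi i ia); rewrite aE cats0.
left; exists (size a1); split=> //.
  by rewrite size_rcons aE size_cat /= leq_min ltnSn addnS ltnS leq_addr.
rewrite nth_rcons ltnn eqxx aE nth_cat ltnn subnn /=.
have yL : y \in Lam by apply: memL; rewrite mem_cat inE eqxx orbT.
apply: rank_le_lt; last by apply: reduced_rank_neq; apply: gred.
by have := l2 y (mem_head _ _); rewrite /= rank_ltNge negbK.
Qed.

End PrimeIdeal.

Lemma rank_min (X : mpol V K -> Prop) : (exists f, X f) ->
  (forall f, X f -> lead rk f != None) ->
  exists2 f, X f & forall g, X g -> rank_le rk f g.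
Proof.
move=> [f0 X0] XL.
suff main v D f : X f -> lead rk f = Some v -> (pdeg v f <= D)%N ->
    exists2 f, X f & forall g, X g -> rank_le rk f g.
  by case fu: (lead rk f0) (XL _ X0) => [u|//] _; apply: (main u (pdeg u f0) f0).
elim/(well_founded_ind (rk_wf rkP)): v D f => v IHv; elim=> [|D IHD] f Xf fv fD;
  (have [fmin|/existsNP[g /not_implyP[Xg /negP gf]]] := pselect (forall g, X g -> rank_le rk f g);
   first by (exists f)); move: gf; rewrite -rank_ltNge /rank_lt fv;
   case gu: (lead rk g) (XL _ Xg) => [u|//] _ /orP[uv|/andP[/eqP uv lt]].
- exact: (IHv u uv (pdeg u g) g).
- by move: (leq_trans lt fD).
- exact: (IHv u uv (pdeg u g) g).
- apply: (IHD g) => //; first by rewrite gu uv.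
  by rewrite -uv -ltnS; apply: leq_trans lt fD.
Qed.

(** Greedy construction: append an element of [P] of least rank among those reduced with respect to
    the list so far. Dickson's lemma stops the process, and the least choices make the result
    minimal. *)
Lemma charset_exists (P : mpol V K -> Prop) : exists Lam, is_charset rk P Lam.
Proof.
pose C (L : seq (mpol V K)) f :=
  [/\ P f, lead rk f != None & forall h, h \in L -> reduced rk f h].
have step (L : seq (mpol V K)) : exists f, (exists g, C L g) ->
    C L f /\ forall g, C L g -> rank_le rk f g.
  have [ex|nex] := pselect (exists g, C L g); last by exists 0.
  have [|f Cf fmin] := rank_min ex; first by move=> f [].
  by exists f.
have [F FP] := choice step.
pose fix L k := if k is k'.+1 then rcons (L k') (F (L k')) else [::].
have sizeL k : size (L k) = k by elim: k => //= k IHk; rewrite size_rcons IHk.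
have nthL k i : (i < k)%N -> nth 0 (L k) i = F (L i).
  elim: k => // k IHk; rewrite ltnS leq_eqVlt /= nth_rcons sizeL => /orP[/eqP->|ik].
    by rewrite ltnn eqxx.
  by rewrite ik IHk.
have memL k f : f \in L k -> exists2 i, (i < k)%N & f = F (L i).
  by move=> /(nthP 0)[i]; rewrite sizeL => ik <-; exists i; rewrite ?nthL.
have Lmem k i : (i < k)%N -> F (L i) \in L k.
  by move=> ik; rewrite -(nthL k i ik) mem_nth ?sizeL.
have stop : exists k, ~ (exists g, C (L k) g).
  apply: contrapT => /forallNP nstop.
  have CF k : C (L k) (F (L k)) by have [] := FP _ (contrapT (nstop k)).
  have leads k : exists u, lead rk (F (L k)) = Some u.
    by have [_] := CF k; case: lead => // u; exists u.
  have [s sP] := choice leads.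
  (* A later leader that is a derivative of an earlier one, with no smaller degree, contradicts
     reducedness of the later element. *)
  have [i [j [ij le deg]]] := dvar_good s (fun k => pdeg (s k) (F (L k))).
  have [_ _ /(_ _ (Lmem _ _ ij)) /(reducedP _ (sP i))[h1 h2]] := CF j.
  have /eqP/(leadP rkP)[sj _] := sP j.
  have [e|ne] := eqVneq (s j) (s i).
    by rewrite e in deg; move: h2; rewrite ltnNge deg.
  by move: (h1 _ sj); case/negP; apply/proper_derivP.
have {stop} [k kP kmin] : exists2 k, ~ (exists g, C (L k) g) &
    forall i, (i < k)%N -> exists g, C (L i) g.
  have ex : exists k, `[< ~ (exists g, C (L k) g) >] by case: stop => k kP; exists k; exact/asboolP.
  case: (ex_minnP ex) => k /asboolP kP kmin; exists k => // i ik.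
  apply: contrapT => nex; have := kmin i (asboolT nex).
  by rewrite leqNgt ik.
have CF i : (i < k)%N -> C (L i) (F (L i)) by move=> ik; have [] := FP _ (kmin i ik).
have Fmin i g : (i < k)%N -> C (L i) g -> rank_le rk (F (L i)) g.
  by move=> ik; have [_] := FP _ (kmin i ik); apply.
have le_ij i j : (i < j < k)%N -> rank_lt rk (F (L i)) (F (L j)).
  case/andP=> ij jk; have [Pj lj rj] := CF j jk.
  have rji := rj _ (Lmem _ _ ij).
  apply: rank_le_lt; last by rewrite rank_eq_sym; apply: reduced_rank_neq.
  apply: Fmin; first exact: ltn_trans jk.
  by split=> // h /memL[i' i'i ->]; apply: rj; apply: Lmem; apply: ltn_trans ij.
have sL : sorted (rank_le rk) (L k).
  apply/(sortedP 0) => i; rewrite sizeL => ik.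
  by rewrite !nthL ?(ltnW ik) //; apply: rank_ltW; apply: le_ij; rewrite ltnSn.
exists (L k); split.
- split=> [f /memL[i ik ->]|i j]; first by have [] := CF i ik.
  rewrite sizeL => ik jk; rewrite neq_ltn => /orP[ij|ji].
    have [_ li _] := CF i ik.
    suff : reduced rk (nth 0 (L k) i) (nth 0 (L k) j) by [].
    by rewrite !nthL //; apply: rank_lt_reduced => //; apply: le_ij; rewrite ij.
  have [_ _ ri] := CF i ik.
  suff : reduced rk (nth 0 (L k) i) (nth 0 (L k) j) by [].
  by rewrite !nthL //; apply: ri; apply: Lmem.
- by move=> f /memL[i ik ->]; have [] := CF i ik.
move=> B aB BP lt.
pose b := sort (rank_le rk) B.
have sb : sorted (rank_le rk) b by apply: sort_sorted; exact: rank_le_total.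
have pb : perm_eq B b by rewrite perm_sym perm_sort.
have {aB} ab := autoreduced_perm pb aB.
have bP f : f \in b -> P f by rewrite -(perm_mem pb); apply: BP.
have {lt} : aset_lt rk b (L k) by move: lt; rewrite /aset_lt (sorted_sort rank_le_trans sb).
have [lb ub rb] := (autoreducedP b).1 ab.
(* As long as [b] agrees in rank with [L k], its next element is a candidate for the greedy choice;
   so it can neither be lower nor extend the list past [k]. *)
have Cb i : (i < size b)%N -> (i <= k)%N ->
    (forall j, (j < i)%N -> rank_eq rk (nth 0 b j : mpol V K) (nth 0 (L k) j)) -> C (L i) (nth 0 b i).
  move=> ib ik eqb; split; [exact/bP/mem_nth|exact/lb/mem_nth|].
  move=> h /memL[j ji ->]; rewrite -(nthL k j (leq_trans ji ik)) -(rank_eq_reduced _ (eqb j ji)).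
  apply: rb; rewrite ?mem_nth // ?(ltn_trans ji ib) //.
  by rewrite nth_uniq ?(ltn_trans ji ib) // eq_sym (ltn_eqF ji).
move/(aset_ltP sb sL) => [[i []]|[]]; rewrite sizeL.
  rewrite leq_min => /andP[ib ik] eqb; rewrite nthL // rank_ltNge => /negP; apply.
  by apply: Fmin => //; apply: Cb => //; apply: ltnW.
move=> kb eqb; apply: kP; exists (nth 0 b k).
exact: Cb.
Qed.

Section PrimeCharSet.
Variable P : mpol V K -> Prop.
Hypothesis prP : prime_dideal d P.
Hypothesis ch : [pchar K] =i pred0.
Variable Lam : seq (mpol V K).
Hypothesis csL : is_charset rk P Lam.

Lemma charset_lead f : f \in Lam -> exists u, lead rk f = Some u.
Proof.
have [aL _ _] := csL; have [lL _] := aL => /lL.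
by case: (lead rk f) => // u; exists u.
Qed.

(** Meant for the initial and the separant of [f]: their degrees are bounded by those of [f], which
    is itself reduced with respect to the other elements. *)
Lemma reduced_self g f : f \in Lam -> (forall w, (pdeg w g <= pdeg w f)%N) ->
  (forall u, lead rk f = Some u -> (pdeg u g < pdeg u f)%N) ->
  forall h, h \in Lam -> reduced rk g h.
Proof.
move=> fL gle glt h hL; have [aL _ _] := csL.
have [_ _ rL] := (autoreducedP Lam).1 aL.
have [<-|fh] := eqVneq f h; last by apply: (reduced_le gle); apply: rL.
have [u fu] := charset_lead fL; apply/(reducedP g fu); split; last exact: glt.
have /eqP/(leadP rkP)[_ umax] := fu.
move=> w wg; have /umax wu : w \in pvars f.
  by rewrite pdeg_pvars; apply: leq_trans (gle w); rewrite -pdeg_pvars.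
by apply/negP => /proper_deriv_rk uw; move: wu; rewrite (rkleNgt rkP) uw.
Qed.

Lemma charset_initial f : f \in Lam -> ~ P (initial rk f).
Proof.
move=> fL; have [idP P1 _] := prP; have [u fu] := charset_lead fL.
have /eqP/(leadP rkP)[uf _] := fu.
rewrite (initialE fu) => /(charset_reduced0 idP P1 csL) i0.
have := init_neq0 uf; rewrite i0 ?eqxx //.
apply: (reduced_self fL) => [w|v].
  by apply: leq_trans (pdeg_init _ _ _) _; case: eqP.
rewrite fu => -[<-]; apply: leq_ltn_trans (pdeg_init _ _ _) _.
by rewrite eqxx -pdeg_pvars.
Qed.

Lemma charset_separant f : f \in Lam -> ~ P (separant rk f).
Proof.
move=> fL; have [idP P1 _] := prP; have [u fu] := charset_lead fL.
have /eqP/(leadP rkP)[uf _] := fu.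
rewrite (separantE fu) => /(charset_reduced0 idP P1 csL) i0.
have := pder_neq0 ch uf; rewrite i0 ?eqxx //.
apply: (reduced_self fL) => [w|v].
  by apply: leq_trans (pdeg_pder _ _ _) _; rewrite leq_subr.
rewrite fu => -[<-]; apply: leq_ltn_trans (pdeg_pder _ _ _) _.
by rewrite eqxx subn1 ltn_predL -pdeg_pvars.
Qed.

Lemma H_ofE (L : seq (mpol V K)) : H_of rk L =
  \prod_(f <- L) ((initial rk f : mpol V K) * (separant rk f : mpol V K)) :> mpol V K.
Proof.
rewrite /H_of -malg_prodE; apply: eq_bigr => f _; exact: malg_mulE.
Qed.

Lemma charset_H : ~ P (H_of rk Lam).
Proof.
have [idP P1 pr] := prP; rewrite H_ofE.
have sub f : f \in Lam -> f \in Lam by [].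
elim: {-2}(Lam) sub => [|f L IHL] sub; first by rewrite big_nil.
rewrite big_cons => /pr[/pr[]|].
- by apply: charset_initial; apply: sub; rewrite mem_head.
- by apply: charset_separant; apply: sub; rewrite mem_head.
by apply: IHL => g gL; apply: sub; rewrite inE gL orbT.
Qed.

Lemma charset_reduction (Z : mpol V K -> Prop) : dideal d Z -> (forall f, f \in Lam -> Z f) ->
  (forall f g, f \in Lam -> Z ((initial rk f : mpol V K) * g) -> Z g) ->
  (forall f g, f \in Lam -> Z ((separant rk f : mpol V K) * g) -> Z g) ->
  forall g, P g -> Z g.
Proof.
move=> idZ LZ sI sS g Pg; have [idP P1 _] := prP; have [[lL _] LP _] := csL.
apply: (@reduction _ _ _ rk d rkP dD Lam P) => //.
by move=> h Ph; apply: (charset_reduced0 idP P1 csL).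
Qed.

End PrimeCharSet.
End CharSetTheory.

(** * Differential points of prime ideals *)

Lemma fraction_numden (R : idomainType) (z : {fraction R}) :
  exists a b : R, b != 0 /\ z * FracField.tofrac b = FracField.tofrac a.
Proof.
elim/quotW: z => r; exists \n_r, \d_r; split; first exact: denom_ratioP.
rewrite !piE; apply/eqmodP; rewrite /= FracField.equivfE /FracField.mulf.
by rewrite !numden_Ratio ?(oner_eq0, mulf_neq0, denom_ratioP) // !mulr1 mulrC.
Qed.

Lemma prime_ideal_field (A : comNzRingType) (N : A -> Prop) :
  N 0 -> (forall x y, N x -> N y -> N (x + y)) -> (forall x y, N y -> N (x * y)) -> ~ N 1 ->
  (forall x y, N (x * y) -> N x \/ N y) ->
  exists (F : fieldType) (pi : {rmorphism A -> F}), (forall x, pi x = 0 <-> N x) /\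
    forall z, exists a b, pi b != 0 /\ z = pi a / pi b.
Proof.
move=> N0 ND NM N1 NP.
pose I : pred A := fun x => `[< N x >].
have IP x : reflect (N x) (x \in I) by apply: asboolP.
have I_ideal : idealr_closed I.
  split=> [||a x y /IP Nx /IP Ny]; [exact/IP | by apply/IP | apply/IP/ND => //; exact: NM].
pose IaM := GRing.isZmodClosed.Build _ I (idealr_closedB I_ideal).
pose IpM := isProperIdeal.Build _ I (idealr_closed_nontrivial I_ideal).
pose Iid : idealr A := HB.pack I IaM IpM.
pose Q : comNzRingType := {ideal_quot Iid}.
pose p : {rmorphism A -> Q} := \pi_Q%qT.
have pP x : p x = 0 <-> N x.
  rewrite -[0](rmorph0 p); split=> [/eqP|Nx].
    by rewrite -Quotient.idealrBE subr0 => /IP.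
  by apply/eqP; rewrite -Quotient.idealrBE subr0; apply/IP.
have Qdom (x y : Q) : x * y = 0 -> (x == 0) || (y == 0).
  rewrite -[x]reprK -[y]reprK -!/(p _) -rmorphM => /pP/NP[] /pP ->; by rewrite eqxx ?orbT.
(* The structure of integral domain carries a boolean set of units and an inverse function; both are
   chosen classically before the fraction field is formed. *)
pose un : pred Q := fun x => `[< exists y, y * x = 1 >].
have invE (x : Q) : exists y, if x \in un then y * x = 1 else y = x.
  by case xu: (x \in un); [move/asboolP: xu => [y]; exists y | exists x].
have [inv invP] := choice invE.
have mulVx : {in un, left_inverse 1 inv *%R} by move=> x xu; have := invP x; rewrite xu.
have unP (x y : Q) : y * x = 1 -> x \in un by move=> yx; apply/asboolP; exists y.
have invout : {in [predC un], inv =1 id}.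
  by move=> x xu; have := invP x; rewrite ifN.
pose Um := GRing.ComNzRing_hasMulInverse.Build Q mulVx unP invout.
pose QU : comUnitRingType := HB.pack Q Um.
pose Dm := GRing.ComUnitRing_isIntegral.Build QU Qdom.
pose QD : idomainType := HB.pack QU Dm.
pose F : fieldType := {fraction QD}.
pose q : {rmorphism A -> F} := (@FracField.tofrac QD : {rmorphism QD -> F}) \o (p : {rmorphism A -> QD}).
exists F, q; split=> [x|z].
  rewrite -pP; split=> [/eqP|e]; first by rewrite tofrac_eq0 => /eqP.
  by rewrite /q /= e rmorph0.
have qE (x : Q) : q (repr x) = @FracField.tofrac QD x.
  by rewrite /q /=; congr (FracField.tofrac _); rewrite /p /= reprK.
have [a [b [b0 e]]] := @fraction_numden QD z.
exists (repr (a : Q)), (repr (b : Q)); rewrite !qE tofrac_eq0; split=> //.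
by rewrite -e mulfK // tofrac_eq0.
Qed.

Section FieldDerivation.
Context {A : comNzRingType} {F : fieldType} (pi : {rmorphism A -> F}).
Hypothesis piS : forall z, exists a b, pi b != 0 /\ z = pi a / pi b.

Lemma der_along_id_ext (E1 E2 : F -> F) :
  der_along (idfun : F -> F) E1 -> der_along (idfun : F -> F) E2 ->
  (forall a, E1 (pi a) = E2 (pi a)) -> forall z, E1 z = E2 z.
Proof.
move=> d1 d2 e z; have [a [b [b0 zE]]] := piS z.
have zb : z * pi b = pi a by rewrite zE divfK.
have := e a; rewrite -zb d1.2 d2.2 e => /addIr /(mulIf b0); exact.
Qed.

(** The quotient rule defines [E]; stability of the kernel under [delta] makes it independent of the
    representation as a fraction. *)
Lemma fraction_der (delta : A -> A) : der_along (idfun : A -> A) delta ->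
  (forall a, pi a = 0 -> pi (delta a) = 0) ->
  exists2 E, der_along (idfun : F -> F) E & forall a, E (pi a) = pi (delta a).
Proof.
move=> dd stab.
pose G z e := exists a b, [/\ pi b != 0, z = pi a / pi b &
  e = (pi (delta a) * pi b - pi a * pi (delta b)) / pi b ^+ 2].
have GE z : exists e, G z e.
  have [a [b [b0 zE]]] := piS z.
  by exists ((pi (delta a) * pi b - pi a * pi (delta b)) / pi b ^+ 2), a, b.
have [E EP] := choice GE.
have dB x y : delta (x - y) = delta x - delta y by exact: derB dd _ _.
have EE a b : pi b != 0 -> E (pi a / pi b) * pi b ^+ 2 = pi (delta a) * pi b - pi a * pi (delta b).
  move=> b0; have [a' [b' [b'0 e ->]]] := EP (pi a / pi b).
  have ab : pi a * pi b' = pi a' * pi b by apply/eqP; rewrite -eqr_div // e.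
  (* The derivative of this element of the kernel is the linear relation between the two instances
     of the quotient rule. *)
  have /stab : pi (a * b' - a' * b) = 0 by rewrite rmorphB !rmorphM ab subrr.
  rewrite dB !dd.2 !(rmorphB, rmorphD, rmorphM) /= => /eqP; rewrite subr_eq0 => /eqP h.
  apply: (mulIf (expf_neq0 2 b'0)); rewrite mulrAC divfK ?expf_neq0 //.
  move: (pi a) (pi b) (pi a') (pi b') (pi (delta a)) (pi (delta b)) (pi (delta a'))
    (pi (delta b')) ab h => x y x' y' dx dy dx' dy' xy h.
  have -> : (dx' * y' - x' * dy') * y ^+ 2 =
      y * y' * (dx' * y + x' * dy) - x' * y * (y' * dy + y * dy') by ring.
  by rewrite -h -xy; ring.
have Epi a : E (pi a) = pi (delta a).
  have := EE a 1; rewrite rmorph1 divr1 oner_eq0 expr1n !mulr1 (der1 (h := idfun) dd) rmorph0.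
  by rewrite mulr0 subr0; apply.
exists E => //; split=> x y; have [a [b [b0 ->]]] := piS x; have [a' [b' [b'0 ->]]] := piS y;
  have bb0 : pi (b * b') != 0 by rewrite rmorphM mulf_neq0.
- have -> : pi a / pi b + pi a' / pi b' = pi (a * b' + a' * b) / pi (b * b').
    by rewrite rmorphD !rmorphM addf_div.
  apply: (mulIf (expf_neq0 2 bb0)); rewrite EE // rmorphM.
  have -> : (E (pi a / pi b) + E (pi a' / pi b')) * (pi b * pi b') ^+ 2 =
     E (pi a / pi b) * pi b ^+ 2 * pi b' ^+ 2 + E (pi a' / pi b') * pi b' ^+ 2 * pi b ^+ 2 by ring.
  rewrite !EE // !dd.1 !dd.2 !(rmorphD, rmorphM) /=.
  ring.
- have -> : pi a / pi b * (pi a' / pi b') = pi (a * a') / pi (b * b').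
    by rewrite !rmorphM mulf_div.
  apply: (mulIf (expf_neq0 2 bb0)); rewrite EE // rmorphM /=.
  have -> : (E (pi a / pi b) * (pi a' / pi b') + pi a / pi b * E (pi a' / pi b')) * (pi b * pi b') ^+ 2 =
     E (pi a / pi b) * pi b ^+ 2 * (pi a' * pi b') + E (pi a' / pi b') * pi b' ^+ 2 * (pi a * pi b).
    by field; rewrite b0 b'0.
  rewrite !EE // !dd.2 !(rmorphD, rmorphM) /=.
  ring.
Qed.

End FieldDerivation.

Section DerivationCommutation.
Context {K : comNzRingType}.

(** The cross terms cancel as in the commutator of two derivations. Hence commutation need only be
    checked on constants and variables. *)
Lemma der_comm {A R : comNzRingType} (h : {rmorphism A -> R}) (a : A -> A) (b : R -> R) (E : A -> R) :
  der_along (idfun : A -> A) a -> der_along (idfun : R -> R) b -> der_along h E ->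
  (forall x, h (a x) = b (h x)) -> der_along h (fun x => b (E x) - E (a x)).
Proof.
move=> da db dE ab; split=> x y; first by rewrite dE.1 da.1 db.1 dE.1 opprD addrACA.
rewrite dE.2 da.2 db.1 !db.2 dE.1 !dE.2 /= !ab.
ring.
Qed.

Lemma der_comm_gen {W : choiceType} {R : comNzRingType} (h : {rmorphism mpol W K -> R})
    (a : mpol W K -> mpol W K) (b : R -> R) (E : mpol W K -> R) :
  der_along (idfun : mpol W K -> mpol W K) a -> der_along (idfun : R -> R) b -> der_along h E ->
  (forall x, h (a x) = b (h x)) ->
  (forall c, b (E (pC W c)) = E (a (pC W c))) -> (forall v, b (E (pX K v)) = E (a (pX K v))) ->
  forall f, b (E f) = E (a f).
Proof.
move=> da db dE ab eC eX f; apply/eqP; rewrite -subr_eq0; apply/eqP; move: f.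
have z : der_along h (fun=> 0 : R) by split=> x y; rewrite ?addr0 // mul0r mulr0 addr0.
by apply: (der_eq (der_comm da db dE ab) z) => [c|v]; rewrite ?eC ?eX subrr.
Qed.

Lemma morph_der_gen {W : choiceType} {R : comNzRingType} (h : {rmorphism mpol W K -> R})
    (a : mpol W K -> mpol W K) (b : R -> R) :
  der_along (idfun : mpol W K -> mpol W K) a -> der_along (idfun : R -> R) b ->
  (forall c, h (a (pC W c)) = b (h (pC W c))) -> (forall v, h (a (pX K v)) = b (h (pX K v))) ->
  forall f, h (a f) = b (h f).
Proof.
move=> da db eC eX; apply: (@der_eq W K R h) => //; split=> x y.
- by rewrite da.1 rmorphD.
- by rewrite da.2 rmorphD !rmorphM.
- by rewrite rmorphD db.1.
- by rewrite rmorphM db.2.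
Qed.

End DerivationCommutation.

Section ThetaApp.
Context {L : Type} {m : nat} (d : 'I_m -> L -> L).
Hypothesis dC : commuting_family d.

Lemma theta_app0 x : theta_app d [ffun=> 0%N] x = x.
Proof. by rewrite /theta_app; elim: (enum 'I_m) => //= j s ->; rewrite ffunE. Qed.

Lemma theta_app_shift j e x : theta_app d (dshift j e) x = d j (theta_app d e x).
Proof.
have itC i k y : d j (iter k (d i) y) = iter k (d i) (d j y).
  by elim: k => //= k <-; rewrite dC.
have main s : uniq s -> foldr (fun i y => iter (dshift j e i) (d i) y) x s =
    if j \in s then d j (foldr (fun i y => iter (e i) (d i) y) x s)
    else foldr (fun i y => iter (e i) (d i) y) x s.
  elim: s => //= i s IHs /andP[is_ us]; rewrite IHs // ffunE inE.
  case: (eqVneq i j) is_ => [->|ij] js.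
    by rewrite (negPf js) addn1.
  by rewrite addn0 /=; case: ifP => // _; rewrite itC.
by rewrite /theta_app main ?enum_uniq // mem_enum.
Qed.

End ThetaApp.

Lemma dle0 {n m : nat} (v : dvar n m) : dle (v.1, [ffun=> 0%N]) v.
Proof. by apply/andP; split=> //=; apply/forallP => j; rewrite ffunE. Qed.

Section DifferentialPoints.
Context {L : Type} {n m : nat} (d : 'I_m -> L -> L).

(** Singles out the jets of tuples among arbitrary assignments of values to the differential
    variables, which are merely algebraic points. *)
Definition dpoint (x : dvar n m -> L) := forall j v, x (vshift j v) = d j (x v).
Definition tpt (a : 'I_n -> L) (v : dvar n m) := theta_app d v.2 (a v.1).

Hypothesis dC : commuting_family d.

Lemma tpt_dpoint a : dpoint (tpt a).
Proof. by move=> j v; rewrite /tpt /= theta_app_shift. Qed.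

Lemma dpoint_eq x y : dpoint x -> dpoint y ->
  (forall i, x (i, [ffun=> 0%N]) = y (i, [ffun=> 0%N])) -> x =1 y.
Proof.
move=> dx dy xy v; pose P v := x v = y v; suff: P v by [].
apply: (@dle_ind n m P (v.1, [ffun=> 0%N])); [exact: xy | | exact: dle0].
by move=> j w _ e; rewrite /P dx dy e.
Qed.

Lemma dpoint_tpt x : dpoint x -> x =1 tpt (fun i => x (i, [ffun=> 0%N])).
Proof.
move=> dx; apply: dpoint_eq => //; first exact: tpt_dpoint.
by move=> i; rewrite /tpt /= theta_app0.
Qed.

End DifferentialPoints.

Lemma devalE {K L : comNzRingType} {n m : nat} (iota : K -> L) (dL : 'I_m -> L -> L)
  (a : 'I_n -> L) (f : dpoly K n m) : deval iota dL a f = ev iota (tpt dL a) f.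
Proof. by rewrite ev.unlock. Qed.

Lemma ev_pdel {K L : comNzRingType} {n m : nat} (d : 'I_m -> K -> K) (dL : 'I_m -> L -> L)
  (iota : {rmorphism K -> L}) (x : dvar n m -> L) :
  (forall j, is_derivation (d j)) -> (forall j, is_derivation (dL j)) ->
  (forall j c, iota (d j c) = dL j (iota c)) -> dpoint dL x ->
  forall j f, ev iota x (pdel d j f) = dL j (ev iota x f).
Proof.
move=> dD dLD io dx j; apply: morph_der_gen => [||c|v].
- exact: pdel_der.
- exact: is_der_along.
- by rewrite /= pdelC // !evC io.
- by rewrite /= pdelX // !evX dx.
Qed.

(** * The largest differential ideal inside a prime ideal *)

Definition prime_ideal {A : comNzRingType} (N : A -> Prop) :=
  [/\ N 0, forall x y, N x -> N y -> N (x + y), forall x y, N y -> N (x * y),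
      ~ N 1 & forall x y, N (x * y) -> N x \/ N y].

Lemma pascal_sum (M : nmodType) (u : nat -> nat -> M) k :
  \sum_(i < k.+1) u i.+1 (k - i)%N *+ 'C(k, i) + \sum_(i < k.+1) u i (k.+1 - i)%N *+ 'C(k, i) =
  \sum_(i < k.+2) u i (k.+1 - i)%N *+ 'C(k.+1, i).
Proof.
rewrite [RHS]big_ord_recl /= bin0 subn0.
under [in RHS]eq_bigr => i _ do rewrite /bump /= add1n subSS binS mulrnDr.
rewrite [in RHS]big_split /= addrA [LHS]addrC; congr (_ + _).
rewrite [LHS]big_ord_recl /= bin0 subn0; congr (_ + _).
rewrite [RHS]big_ord_recr /= bin_small // mulr0n addr0.
by apply: eq_bigr => i _; rewrite /bump /= add1n subSS.
Qed.

Section Leibniz.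
Context {A : comNzRingType} (delta : A -> A).
Hypothesis dd : der_along (idfun : A -> A) delta.

Lemma leibniz k x y : iter k delta (x * y) =
  \sum_(i < k.+1) (iter i delta x * iter (k - i) delta y) *+ 'C(k, i).
Proof.
elim: k => [|k IHk]; first by rewrite big_ord1 /= bin0 mulr1n.
rewrite iterS IHk (der_sum dd).
under eq_bigr => i _.
  rewrite (derMn dd) dd.2 /= -!iterS -subSn; last by rewrite -ltnS.
  rewrite mulrnDl; over.
rewrite big_split /=.
exact: (@pascal_sum _ (fun i j => iter i delta x * iter j delta y)).
Qed.

Variable N : A -> Prop.
Hypothesis Npr : prime_ideal N.
Hypothesis Nch : forall k x, N (x *+ k.+1) -> N x.

(** For [x] and [y] outside, let [k] and [l] be the first orders at which a derivative of [x],
    respectively [y], leaves [N]. In the Leibniz expansion of order [k + l] all terms but the one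
    with coefficient ['C(k + l, k)] lie in [N], and [Nch] cancels that coefficient. *)
Lemma prime_step : prime_ideal (fun x => forall k, N (iter k delta x)).
Proof.
have [N0 ND NM N1 NP] := Npr.
have itD k x y : iter k delta (x + y) = iter k delta x + iter k delta y.
  by elim: k => //= k ->; rewrite dd.1.
have Nsum (I : Type) (r : seq I) (P : pred I) (F : I -> A) :
    (forall i, P i -> N (F i)) -> N (\sum_(i <- r | P i) F i).
  by move=> h; apply: (big_ind N).
have NMn x k : N x -> N (x *+ k).
  by move=> Nx; elim: k => [|k IHk]; rewrite ?mulr0n // mulrS; apply: ND.
split.
- by elim=> [|k IHk] //; rewrite iterSr (der0 dd).
- by move=> x y Nx Ny k; rewrite itD; apply: ND.
- by move=> x y Ny k; rewrite leibniz; apply: Nsum => i _; apply/NMn/NM.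
- by move=> /(_ 0%N).
move=> x y Nxy; apply: contrapT => /not_orP[/existsNP Nx /existsNP Ny].
have first z : (exists k, ~ N (iter k delta z)) ->
    exists2 k, ~ N (iter k delta z) & forall i, (i < k)%N -> N (iter i delta z).
  move=> [k0 k0P]; have ex : exists k, `[< ~ N (iter k delta z) >] by exists k0; apply/asboolP.
  case: (ex_minnP ex) => k /asboolP kP kmin; exists k => // i ik; apply: contrapT => nN.
  by have := kmin i (asboolT nN); rewrite leqNgt ik.
have [k kP kmin] := first _ Nx; have [l lP lmin] := first _ Ny.
have kk : (k < (k + l).+1)%N by rewrite ltnS leq_addr.
have := Nxy (k + l)%N; rewrite leibniz (bigD1 (Ordinal kk)) //=.
set S := \sum_(i < _ | _) _ => Nt.
have NS : N S.
  apply: Nsum => i ik; apply: NMn.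
  have : i != k :> nat by apply: contra ik => /eqP e; apply/eqP/val_inj.
  rewrite neq_ltn => /orP[ik'|ki]; first by rewrite mulrC; apply: NM; apply: kmin.
  apply: NM; apply: lmin; rewrite -(ltn_add2l i) subnKC; last by rewrite -ltnS.
  by rewrite ltn_add2r.
have {}Nt : N ((iter k delta x * iter (k + l - k) delta y) *+ 'C(k + l, k)).
  by rewrite -[X in N X](addrK S); apply: ND => //; rewrite -mulN1r; apply: NM.
move: Nt; rewrite addKn -(prednK (_ : 0 < 'C(k + l, k))%N) ?bin_gt0 ?leq_addr //.
by move/Nch/NP => [].
Qed.

End Leibniz.

(** The derivations are treated one at a time; commutation keeps the stability already gained, and
    the torsion condition is carried through the induction because [prime_step] asks for it. *)
Lemma largest_stable_ideal {A : comNzRingType} {m : nat} (delta : 'I_m -> A -> A) (N : A -> Prop) :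
  (forall j, der_along (idfun : A -> A) (delta j)) -> commuting_family delta ->
  prime_ideal N -> (forall k x, N (x *+ k.+1) -> N x) ->
  exists M : A -> Prop, [/\ prime_ideal M, (forall x, M x -> N x),
    (forall j x, M x -> M (delta j x)) &
    forall X : A -> Prop, (forall j x, X x -> X (delta j x)) -> (forall x, X x -> N x) ->
      forall x, X x -> M x].
Proof.
move=> dd dC Npr Nch.
suff [M [Mpr MN _ Mst MX]] : exists M : A -> Prop, [/\ prime_ideal M, (forall x, M x -> N x),
    (forall k x, M (x *+ k.+1) -> M x), (forall j x, j \in enum 'I_m -> M x -> M (delta j x)) &
    forall X : A -> Prop, (forall j x, X x -> X (delta j x)) -> (forall x, X x -> N x) ->
      forall x, X x -> M x].
  by exists M; split=> // j x; apply: Mst; rewrite mem_enum.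
elim: (enum 'I_m) => [|j s [M [Mpr MN Mch Mst MX]]].
  by exists N; split=> // X XS XN.
exists (fun x => forall k, M (iter k (delta j) x)); split.
- exact: prime_step.
- by move=> x /(_ 0%N) /MN.
- have itMn k x l : iter l (delta j) (x *+ k.+1) = iter l (delta j) x *+ k.+1.
    by elim: l => //= l ->; rewrite (derMn (dd j)).
  by move=> k x h l; apply: (Mch k); rewrite -itMn.
- move=> i x; rewrite inE => /orP[/eqP->|si] h k; first by rewrite -iterSr.
  rewrite (_ : iter k _ _ = delta i (iter k (delta j) x)); first exact: Mst.
  by elim: k => //= k ->; rewrite dC.
by move=> X XS XN x Xx k; apply: (MX X) => //; elim: k => //= k; apply: XS.
Qed.

Section Realization.
Context {K : fieldType} {n m : nat} (d : 'I_m -> K -> K).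
Hypothesis ch : [pchar K] =i pred0.
Hypothesis dD : forall j, is_derivation (d j).
Hypothesis dC : commuting_family d.
Local Notation V := (dvar n m).
Implicit Types (f g : mpol V K).

Lemma vshiftC i j (v : V) : vshift i (vshift j v) = vshift j (vshift i v).
Proof. by congr (_, _); apply/ffunP => k; rewrite !ffunE addnAC. Qed.

Lemma pdel_comm i j f : pdel d i (pdel d j f) = pdel d j (pdel d i f).
Proof.
move: f; apply: (@der_comm_gen K V (mpol V K) idfun (pdel d i) (pdel d i) (pdel d j)) => //.
- exact: pdel_der.
- exact: pdel_der.
- exact: pdel_der.
- by move=> c; rewrite !pdelC // dC.
- by move=> v; rewrite !pdelX // vshiftC.
Qed.

Lemma realize (N : mpol V K -> Prop) : prime_dideal d N ->
  exists (L : fieldType) (iota : {rmorphism K -> L}) (dL : 'I_m -> L -> L) (a : 'I_n -> L),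
    [/\ forall j, is_derivation (dL j), commuting_family dL,
        forall j c, iota (d j c) = dL j (iota c) &
        forall f, ev iota (tpt dL a) f = 0 <-> N f].
Proof.
move=> [[N0 ND NM Nd] N1 NP].
have [L [pi [piN piS]]] := prime_ideal_field N0 ND NM N1 NP.
pose iota : {rmorphism K -> L} := pi \o @pC V K.
have ext j : exists E : L -> L, der_along (idfun : L -> L) E /\ forall f, E (pi f) = pi (pdel d j f).
  have [|E dE Epi] := fraction_der piS (pdel_der dD j); last by exists E.
  by move=> f /piN/Nd h; apply/piN; apply: h.
have [dL dLP] := choice ext.
pose x v := pi (pX K v).
have dx : dpoint dL x by move=> j v; rewrite /x (dLP j).2 pdelX.
have evx f : ev iota x f = pi f.
  move: f; apply: mpol_ind => [c|v|f g e1 e2|f g e1 e2].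
  - by rewrite evC.
  - by rewrite evX.
  - by rewrite !rmorphD /= e1 e2.
  - by rewrite !rmorphM /= e1 e2.
have dLC : commuting_family dL.
  move=> i j z; apply/eqP; rewrite -subr_eq0; apply/eqP; move: z.
  have z : der_along (idfun : L -> L) (fun=> 0 : L) by split=> *; rewrite ?addr0 // mul0r mulr0 addr0.
  have h := @der_comm L L idfun (dL i) (dL i) (dL j) (dLP i).1 (dLP i).1 (dLP j).1 (fun=> erefl).
  apply: (der_along_id_ext piS h z) => f.
  by rewrite (dLP j).2 (dLP i).2 (dLP i).2 (dLP j).2 pdel_comm subrr.
exists L, iota, dL, (fun i => x (i, [ffun=> 0%N])); split=> //.
- by move=> j; have [h1 h2] := (dLP j).1.
- by move=> j c; rewrite /iota /= (dLP j).2 pdelC.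
by move=> f; rewrite -(eq_ev f (frefl iota) (dpoint_tpt dLC dx)) evx.
Qed.

(* In characteristic zero the largest differential ideal contained in the prime kernel of
   the algebraic point is again prime; the differential point is generic for it. *)
Lemma differential_point (L : fieldType) (iota : {rmorphism K -> L}) (psi : V -> L) :
  exists (M : fieldType) (jota : {rmorphism K -> M}) (dM : 'I_m -> M -> M) (a : 'I_n -> M),
    [/\ [/\ forall j, is_derivation (dM j), commuting_family dM &
        forall j c, jota (d j c) = dM j (jota c)],
        (forall f, ev jota (tpt dM a) f = 0 -> ev iota psi f = 0) &
        forall X : mpol V K -> Prop, (forall j f, X f -> X (pdel d j f)) ->
          (forall f, X f -> ev iota psi f = 0) -> forall f, X f -> ev jota (tpt dM a) f = 0].
Proof.
have pk : prime_ideal (fun f => ev iota psi f = 0).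
  split; first exact: rmorph0.
  - by move=> f g f0 g0; rewrite rmorphD /= f0 g0 addr0.
  - by move=> f g g0; rewrite rmorphM /= g0 mulr0.
  - by rewrite rmorph1 => /eqP; rewrite oner_eq0.
  by move=> f g /eqP; rewrite rmorphM mulf_eq0 => /orP[] /eqP; [left | right].
have chL : [pchar L] =i pred0 by move=> p; rewrite (fmorph_pchar iota) ch.
have ck k f : ev iota psi (f *+ k.+1) = 0 -> ev iota psi f = 0.
  by rewrite raddfMn => /eqP; rewrite char0_mulrn_eq0 // => /eqP.
have [N [[N0 ND NM N1 NP] Nk Nst NX]] := largest_stable_ideal (pdel_der dD) pdel_comm pk ck.
have Npr : prime_dideal d N by [].
have [M [jota [dM [a [h1 h2 h3 h4]]]]] := realize Npr.
exists M, jota, dM, a; split=> // [f /h4/Nk //|X XS Xk f Xf].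
by apply/h4; apply: (NX X).
Qed.

End Realization.

(** * Extending derivations *)

Section DerivationExtension.
Variable L : fieldType.
Hypothesis ch : [pchar L] =i pred0.
Implicit Types (G : set (L * L)) (p q : {poly L}).

(** The graph of a derivation on a subring of [L], as a set of pairs so that inclusion orders the
    partial derivations. Closure under differences turns the condition at [0] into
    single-valuedness. *)
Definition der_graph G :=
  [/\ G (0, 0), G (1, 0), (forall x y a b, G (x, a) -> G (y, b) -> G (x - y, a - b)),
      (forall x y a b, G (x, a) -> G (y, b) -> G (x * y, a * y + x * b)) &
      forall a, G (0, a) -> a = 0].

Section OneStep.
Variable G : set (L * L).
Hypothesis gG : der_graph G.

Let G0 : G (0, 0). Proof. by case: gG. Qed.
Let G1 : G (1, 0). Proof. by case: gG. Qed.
Let GB x y a b : G (x, a) -> G (y, b) -> G (x - y, a - b).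
Proof. by case: gG => _ _ h _ _; apply: h. Qed.
Let GM x y a b : G (x, a) -> G (y, b) -> G (x * y, a * y + x * b).
Proof. by case: gG => _ _ _ h _; apply: h. Qed.
Let GD x y a b : G (x, a) -> G (y, b) -> G (x + y, a + b).
Proof.
move=> xa yb; have := GB xa (GB G0 yb); by rewrite !sub0r !opprK.
Qed.

Definition poly_graph p q := forall i, G (p`_i, q`_i).

Lemma poly_graphB p q p' q' : poly_graph p q -> poly_graph p' q' -> poly_graph (p - p') (q - q').
Proof. by move=> h h' i; rewrite !coefB; apply: GB. Qed.

Lemma poly_graphM p q p' q' : poly_graph p q -> poly_graph p' q' ->
  poly_graph (p * p') (q * p' + p * q').
Proof.
move=> h h' i; rewrite coefD !coefM -big_split /=.
apply: (big_ind2 (fun x a => G (x, a))) => // [x a y b|j _]; [exact: GD | exact: GM].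
Qed.

Lemma poly_graphC x a : G (x, a) -> poly_graph x%:P a%:P.
Proof. by move=> h i; rewrite !coefC; case: (i == 0%N). Qed.

Lemma poly_graphXn k : poly_graph 'X^k 0.
Proof. by move=> i; rewrite coefXn coef0; case: (i == k). Qed.

Lemma poly_graph_deriv p q : poly_graph p q -> poly_graph p^`() q^`().
Proof.
move=> h i; rewrite !coef_deriv; have := h i.+1; move: (p`_i.+1) (q`_i.+1) => x a xa.
by elim: (i.+1) => [|k IHk]; rewrite ?mulr0n // !mulrSr; apply: GD.
Qed.

(** The value that a derivation sending [x] to [e] must take at [p.[x]], when [q] is [p] with
    differentiated coefficients. *)
Definition dual_eval x e p q : L := q.[x] + p^`().[x] * e.

Lemma dual_evalB x e p q p' q' :
  dual_eval x e (p - p') (q - q') = dual_eval x e p q - dual_eval x e p' q'.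
Proof. by rewrite /dual_eval derivB !hornerE; ring. Qed.

Lemma dual_evalM x e p q p' q' : dual_eval x e (p * p') (q * p' + p * q') =
  dual_eval x e p q * p'.[x] + p.[x] * dual_eval x e p' q'.
Proof. by rewrite /dual_eval derivM !hornerE; ring. Qed.

(** If no nonzero [p] over the domain of [G] vanishes at [x], there is no constraint and [e = 0] is
    taken. Otherwise a vanishing [m] of least degree forces the value of [e]; its derivative is
    nonzero in characteristic zero, and does not vanish at [x] by minimality. *)
Lemma extend_value x : exists e, forall p q, poly_graph p q -> p.[x] = 0 -> dual_eval x e p q = 0.
Proof.
have g0 q : poly_graph 0 q -> q = 0.
  move=> h; apply/polyP => i; rewrite coef0.
  by have [_ _ _ _ fn] := gG; apply: fn; have := h i; rewrite coef0.
have [tr|/existsNP[p0]] := pselect (forall p q, poly_graph p q -> p.[x] = 0 -> p = 0).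
  exists 0 => p q pq px; have p0 := tr _ _ pq px; rewrite p0 in pq *.
  by rewrite (g0 _ pq) /dual_eval deriv0 !horner0 mul0r addr0.
move=> /existsNP[q0 /not_implyP[pq0 /not_implyP[px0 /eqP pn0]]].
have ex : exists k, `[< exists p q, [/\ poly_graph p q, p.[x] = 0, p != 0 & size p = k] >].
  by exists (size p0); apply/asboolP; exists p0, q0.
case: (ex_minnP ex) => k /asboolP[m [r [mr mx m0 mk]]] kmin.
have m1 : (1 < size m)%N.
  rewrite ltnNge; apply/negP => /size1_polyC mC; move: mx m0; rewrite mC hornerC => ->.
  by rewrite eqxx.
have m'0 : m^`()%R != 0.
  apply/eqP => /(congr1 (fun p : {poly L} => p`_(size m).-2)); rewrite coef_deriv coef0 => /eqP.
  rewrite char0_mulrn_eq0 // -[(size m).-2.+1]/(_.-1.+1) prednK; last by rewrite -ltnS prednK // ltnW.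
  by rewrite lead_coef_eq0 (negPf m0).
have m'x : m^`().[x] != 0.
  apply/eqP => m'x; suff : (k <= size m^`()%R)%N by rewrite -mk leqNgt lt_size_deriv.
  by apply: kmin; apply/asboolP; exists m^`(), r^`(); split=> //; exact: poly_graph_deriv.
pose e := - r.[x] / m^`().[x].
have em : dual_eval x e m r = 0 by rewrite /dual_eval /e mulrC divfK // addrN.
exists e => p q; have [c] := ubnP (size p); elim: c p q => // c IHc p q pc pq px.
have [p0'|pn0'] := eqVneq p 0.
  by rewrite p0' in pq *; rewrite (g0 _ pq) /dual_eval deriv0 !horner0 mul0r addr0.
have kp : (size m <= size p)%N by rewrite mk; apply: kmin; apply/asboolP; exists p, q.
(* Pseudo-division by [m]: the domain of [G] is only a ring, so [p] is multiplied by the leading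
   coefficient of [m] before the leading terms are cancelled. *)
pose t := (size p - size m)%N.
have ga := poly_graphC (mr (size m).-1); have gb := poly_graphC (pq (size p).-1).
rewrite -!lead_coefE in ga gb.
have gbX := poly_graphM gb (poly_graphXn t).
have g1 := poly_graphM ga pq; have g2 := poly_graphM gbX mr.
have h := IHc _ _ _ (poly_graphB g1 g2).
rewrite dual_evalB !dual_evalM px mx em !mulr0 !add0r subr0 hornerC in h.
have /eqP : lead_coef m * dual_eval x e p q = 0.
  apply: h; last by rewrite !hornerE /= px mx !mulr0 subr0.
  have pc' : ((size p).-1 < c)%N by rewrite -ltnS prednK ?size_poly_gt0.
  apply: leq_ltn_trans pc'; apply/leq_sizeP => j pj.
  have pj' : (t <= j)%N.
    apply: leq_trans pj; rewrite /t -subn1 leq_sub2l //; exact: ltnW.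
  rewrite coefB -mulrA !coefCM coefXnM ltnNge pj' /=.
  move: pj; rewrite leq_eqVlt => /orP[/eqP <-|].
    have -> : ((size p).-1 - t = (size m).-1)%N.
      by rewrite /t -subn1 subnAC subKn // subn1.
    by rewrite -!lead_coefE mulrC subrr.
  rewrite prednK ?size_poly_gt0 // => pj; rewrite !nth_default ?mulr0 ?subrr //.
  by rewrite /t -(leq_add2r (size p - size m)) subnK // subnKC.
by rewrite mulf_eq0 lead_coef_eq0 (negPf m0) => /eqP.
Qed.

Lemma der_graph_extend x : exists G', [/\ G `<=` G', der_graph G' & exists a, G' (x, a)]%classic.
Proof.
have [e eP] := extend_value x.
exists (fun z => exists p q, poly_graph p q /\ z = (p.[x], dual_eval x e p q)); split.
- move=> [y a] Gya; exists y%:P, a%:P; split; first exact: poly_graphC.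
  by rewrite /dual_eval derivC !hornerE.
- split.
  + by exists 0, 0; split; [move=> i; rewrite coef0 | rewrite /dual_eval deriv0 !hornerE].
  + by exists 1%:P, 0; split; [exact: (poly_graphC G1) | rewrite /dual_eval derivC !hornerE].
  + move=> _ _ _ _ [p [q [pq [-> ->]]]] [p' [q' [pq' [-> ->]]]].
    exists (p - p'), (q - q'); split; first exact: poly_graphB.
    by rewrite dual_evalB !hornerE.
  + move=> _ _ _ _ [p [q [pq [-> ->]]]] [p' [q' [pq' [-> ->]]]].
    exists (p * p'), (q * p' + p * q'); split; first exact: poly_graphM.
    by rewrite dual_evalM !hornerE.
  + by move=> a [p [q [pq [p0 ->]]]]; apply: eP.
exists e, 'X, 0; split; first exact: (poly_graphXn 1).
by rewrite /dual_eval derivX !hornerE.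
Qed.

End OneStep.

Lemma derivation_extension (G : set (L * L)) : der_graph G ->
  exists2 E, der_along (idfun : L -> L) E & forall x a, G (x, a) -> E x = a.
Proof.
(* Adjoining [G] to each candidate lets the empty chain satisfy the hypothesis of Zorn's lemma. *)
move=> gG; pose P (X : set (L * L)) := der_graph (X `|` G)%classic.
have [|M [PM Mmax]] := @Zorn_bigcup _ P.
  move=> F FP tot; set U := (\bigcup_(X in F) X)%classic.
  have two z w : (U `|` G)%classic z -> (U `|` G)%classic w ->
      exists Y, [/\ der_graph Y, (Y `<=` U `|` G)%classic, Y z & Y w].
    have up X : F X -> (X `|` G `<=` U `|` G)%classic.
      by move=> FX y [Xy|Gy]; [left; exists X | right].
    case=> [[X FX Xz]|Gz] [[Y FY Yw]|Gw].
    - case: (tot _ _ FX FY) => [XY|YX].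
        by exists (Y `|` G)%classic; split; [exact: FP | exact: up | left; exact: XY | left].
      by exists (X `|` G)%classic; split; [exact: FP | exact: up | left | left; exact: YX].
    - by exists (X `|` G)%classic; split; [exact: FP | exact: up | left | right].
    - by exists (Y `|` G)%classic; split; [exact: FP | exact: up | right | left].
    - by exists G; split=> //; move=> y Gy; right.
  have [g0 g1 _ _ _] := gG; split.
  - by right.
  - by right.
  - by move=> x y a b xa yb; have [Y [[_ _ h _ _] YU Yx Yy]] := two _ _ xa yb; apply/YU/h.
  - by move=> x y a b xa yb; have [Y [[_ _ _ h _] YU Yx Yy]] := two _ _ xa yb; apply/YU/h.
  by move=> a a0; have [Y [[_ _ _ _ h] _ Ya _]] := two _ _ a0 a0; apply: h.
have tot x : exists a, (M `|` G)%classic (x, a).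
  have [G' [MG' gG' [a G'a]]] := der_graph_extend PM x.
  have [G'M|nG'M] := pselect (G' `<=` M)%classic; first by exists a; left; apply: G'M.
  exfalso; apply: (Mmax G').
    by split=> [y My|]; first by apply: MG'; left.
  rewrite /P (_ : (G' `|` G)%classic = G') //.
  by apply/seteqP; split=> y; [case=> // Gy; apply: MG'; right | left].
have [E EP] := choice tot.
have [_ _ hB hM hf] := PM.
have uniqE x a : (M `|` G)%classic (x, a) -> E x = a.
  move=> xa; apply/eqP; rewrite -subr_eq0; apply/eqP; apply: hf.
  by rewrite -(subrr x); apply: hB.
exists E; last by move=> x a Gxa; apply: uniqE; right.
have h0 : (M `|` G)%classic (0, 0) by case: PM.
split=> x y; apply: uniqE; last exact: hM.
have := hB _ _ _ _ (EP x) (hB _ _ _ _ h0 (EP y)).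
by rewrite !sub0r !opprK.
Qed.

End DerivationExtension.

(** * Zeros of characteristic sets *)

Section CharSetPoints.
Context {K L : fieldType} {n m : nat} (d : 'I_m -> K -> K) (dL : 'I_m -> L -> L).
Context (iota : {rmorphism K -> L}) (rk : rel (dvar n m)).
Hypothesis rkP : is_ranking rk.
Hypothesis dD : forall j, is_derivation (d j).
Hypothesis dLD : forall j, is_derivation (dL j).
Hypothesis io : forall j c, iota (d j c) = dL j (iota c).
Local Notation V := (dvar n m).
Variables (P : mpol V K -> Prop) (Lam : seq (mpol V K)) (x : V -> L).
Hypothesis prP : prime_dideal d P.
Hypothesis csL : is_charset rk P Lam.
Hypothesis dx : dpoint dL x.
Hypothesis Lx : forall f, f \in Lam -> ev iota x f = 0.
Hypothesis Hx : ev iota x (H_of rk Lam) != 0.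

Lemma ev_H_neq0 f : f \in Lam ->
  ev iota x (initial rk f) != 0 /\ ev iota x (separant rk f) != 0.
Proof.
move=> fL; move: Hx; rewrite H_ofE.
rewrite (rmorph_prod (ev iota x)).
rewrite (big_rem f) //=.
rewrite mulf_eq0 negb_or => /andP[+ _].
rewrite (rmorphM (ev iota x)) mulf_eq0 negb_or.
by move/andP.
Qed.

Lemma charset_vanish f : P f -> ev iota x f = 0.
Proof.
move: f; apply: (@charset_reduction _ _ _ rk d rkP dD P prP Lam csL) => //.
- split; first exact: rmorph0.
  + by move=> f g f0 g0; rewrite rmorphD /= f0 g0 addr0.
  + by move=> f g g0; rewrite rmorphM /= g0 mulr0.
  + by move=> j f f0; rewrite (ev_pdel dD dLD io dx) f0 (der0 (is_der_along dLD j)).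
- move=> f g /ev_H_neq0[i0 _] /eqP; rewrite rmorphM mulf_eq0 (negPf i0) /=.
  by move/eqP.
move=> f g /ev_H_neq0[_ s0] /eqP; rewrite rmorphM mulf_eq0 (negPf s0) /=.
by move/eqP.
Qed.

Variables (D : K -> K) (y : V -> L).
Hypothesis DD : is_derivation D.
Hypothesis DC : forall j c, d j (D c) = D (d j c).
Hypothesis dy : dpoint dL y.

Lemma iotaD_der : der_along iota (fun c => iota (D c)).
Proof. by have [h1 h2] := DD; split=> a b; rewrite ?h1 ?rmorphD // h2 rmorphD !rmorphM. Qed.

Let DE := dev_der iotaD_der x y.

Lemma dev_pdel j f : dL j (dev iota (fun c => iota (D c)) x y f) =
  dev iota (fun c => iota (D c)) x y (pdel d j f).
Proof.
move: f; apply: (@der_comm_gen K V L (ev iota x) (pdel d j)) => //.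
- exact: pdel_der.
- exact: is_der_along.
- by move=> f; rewrite /= (ev_pdel dD dLD io dx).
- by move=> c; rewrite pdelC // !(devC iotaD_der) -DC io.
- by move=> v; rewrite pdelX // !(devX iotaD_der) dy.
Qed.

(** The kernel of a derivation is not an ideal, but its common kernel with the evaluation is. That
    ideal is differential because [dev] commutes with the derivations, so reduction modulo [Lam]
    applies to it. *)
Lemma charset_dev : (forall f, f \in Lam -> dev iota (fun c => iota (D c)) x y f = 0) ->
  forall f, P f -> dev iota (fun c => iota (D c)) x y f = 0.
Proof.
move=> Ly f Pf; have := DE; have := dev_pdel; set E := dev _ _ _ _ in Ly * => Epdel dE.
suff [] : ev iota x f = 0 /\ E f = 0 by [].
move: f Pf; apply: (@charset_reduction _ _ _ rk d rkP dD P prP Lam csL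
  (fun f => ev iota x f = 0 /\ E f = 0)) => //.
- split; first by rewrite rmorph0 (der0 dE).
  + by move=> f g [f0 ef] [g0 eg]; rewrite rmorphD /= dE.1 f0 g0 ef eg !addr0.
  + by move=> f g [g0 eg]; rewrite rmorphM /= dE.2 g0 eg !mulr0 addr0.
  + move=> j f [f0 ef]; rewrite (ev_pdel dD dLD io dx) f0 (der0 (is_der_along dLD j)).
    by rewrite -Epdel ef (der0 (is_der_along dLD j)).
- by move=> f fL; rewrite Lx // Ly.
- move=> f g /ev_H_neq0[i0 _] [/eqP]; rewrite rmorphM mulf_eq0 (negPf i0) /= => /eqP g0.
  rewrite dE.2 g0 mulr0 add0r => /eqP; rewrite mulf_eq0 (negPf i0) /= => /eqP.
  by split.
move=> f g /ev_H_neq0[_ s0] [/eqP]; rewrite rmorphM mulf_eq0 (negPf s0) /= => /eqP g0.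
rewrite dE.2 g0 mulr0 add0r => /eqP; rewrite mulf_eq0 (negPf s0) /= => /eqP.
by split.
Qed.

End CharSetPoints.

(** * Ultrafilters and finite bases of zero sets *)

Section Ultraproduct.
Context {K : fieldType} {n m : nat} (d : 'I_m -> K -> K).
Hypothesis ch : [pchar K] =i pred0.
Hypothesis dD : forall j, is_derivation (d j).
Hypothesis dC : commuting_family d.
Local Notation V := (dvar n m).

(** This ideal does the work of an ultrapower of [K]; where the limit point itself is wanted,
    [realize] produces one from the ideal. *)
Lemma ultra_prime_dideal (T : Type) (U : set_system T) (x : T -> 'I_n -> K) : UltraFilter U ->
  prime_dideal d (fun f : mpol V K => U [set t | ev idfun (tpt d (x t)) f = 0]%classic).
Proof.
move=> UU; have UF : Filter U by apply: filter_filter.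
split; first split.
- by apply: filterS filterT => t _ /=; rewrite rmorph0.
- by move=> f g; apply: filterS2 => t /= f0 g0; rewrite rmorphD /= f0 g0 addr0.
- by move=> f g; apply: filterS => t /= g0; rewrite rmorphM /= g0 mulr0.
- move=> j f; apply: filterS => t /= f0.
  have := @ev_pdel K K n m d d idfun _ dD dD (fun _ _ => erefl) (tpt_dpoint dC (x t)) j f.
  by move=> ->; rewrite f0 (der0 (is_der_along dD j)).
- move=> /filter_ex[t /=]; rewrite rmorph1 => /eqP; by rewrite oner_eq0.
move=> f g fg; have [|nf] := in_ultra_setVsetC [set t | ev idfun (tpt d (x t)) f = 0]%classic UU.
  by left.
right; apply: filterS2 fg nf => t /= /eqP; rewrite rmorphM mulf_eq0 => /orP[/eqP//|/eqP//].
Qed.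

(* Ritt-Raudenbush for point sets: if no finite subset of [S] defined the zero set
   of [S], an ultrafilter of counterexamples would have a prime vanishing ideal that
   contains [S], and a characteristic set of it already forces [S] to vanish. *)
Lemma finite_basis (rk : rel V) (S : mpol V K -> Prop) : is_ranking rk ->
  exists F : seq (mpol V K), (forall f, f \in F -> S f) /\
    forall a : 'I_n -> K, (forall f, f \in F -> ev idfun (tpt d a) f = 0) ->
      forall f, S f -> ev idfun (tpt d a) f = 0.
Proof.
move=> rkP; apply: contrapT => /forallNP noF.
pose B (F : seq (mpol V K)) : set ('I_n -> K) := [set a |
  (forall f, f \in F -> ev idfun (tpt d a) f = 0) /\
  exists2 f, S f & ev idfun (tpt d a) f != 0]%classic.
pose Dom : set (seq (mpol V K)) := fun F => forall f, f \in F -> S f.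
have FF : ProperFilter (filter_from Dom B).
  apply: filter_from_proper.
    apply: filter_from_filter; first by exists [::].
    move=> F G DF DG; exists (F ++ G).
      by move=> f; rewrite mem_cat => /orP[/DF|/DG].
    by move=> a [aFG ex]; split; split=> // f fF; apply: aFG; rewrite mem_cat fF ?orbT.
  move=> F DF; have /not_andP[//|/existsNP[a /not_implyP[aF /existsNP[f /not_implyP[Sf /eqP fa]]]]] := noF F.
  by exists a; split=> //; exists f.
have [U [UU FU]] := ultraFilterLemma FF.
have UF : Filter U by apply: filter_filter.
have prP := ultra_prime_dideal (fun a : 'I_n -> K => a) UU.
have [Lam csL] := charset_exists rkP (fun f : mpol V K => U [set a | ev idfun (tpt d a) f = 0]%classic).
have HP := charset_H rkP prP ch csL.
have UH : U (~` [set a | ev idfun (tpt d a) (H_of rk Lam) = 0])%classic.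
  by have [/HP|] := in_ultra_setVsetC [set a | ev idfun (tpt d a) (H_of rk Lam) = 0]%classic UU.
have UL : U [set a | forall f, f \in Lam -> ev idfun (tpt d a) f = 0]%classic.
  have [_ LP _] := csL; elim: (Lam) LP => [|f s IHs] sP.
    by apply: filterS filterT => a _ f.
  have Uf := sP f (mem_head _ _).
  have Us : U [set a | forall f, f \in s -> ev idfun (tpt d a) f = 0]%classic.
    by apply: IHs => g gs; apply: sP; rewrite inE gs orbT.
  by apply: filterS2 Uf Us => a fa sa g; rewrite inE => /orP[/eqP->|/sa].
have UB : U (B [::]) by apply: FU; exists [::].
have [a [[Ha La] [_ [f Sf fa]]]] := filter_ex (filterI (filterI UH UL) UB).
suff f0 : ev idfun (tpt d a) f = 0 by rewrite f0 eqxx in fa.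
apply: (charset_vanish (iota := idfun) rkP dD dD (fun _ _ => erefl) prP csL (tpt_dpoint dC a) La).
  exact/eqP.
have Df : Dom [:: f] by move=> g; rewrite inE => /eqP ->.
have := FU _ (in_filter_from B Df).
by apply: filterS => b [/(_ f (mem_head _ _))].
Qed.

End Ultraproduct.

(** * Specializing a derivation from a generic point *)

Section PderPdel.
Context {K : comNzRingType} {n m : nat} (d : 'I_m -> K -> K).
Hypothesis dD : forall j, is_derivation (d j).
Local Notation V := (dvar n m).
Implicit Types (f g : mpol V K) (v w : V).

Lemma vshift_inj j : injective (@vshift n m j).
Proof.
move=> [i e] [i' e'] [-> ee]; congr (_, _); apply/ffunP => k.
by move/ffunP/(_ k): ee; rewrite !ffunE => /addIn.
Qed.

Lemma zero_der {A R : comNzRingType} (h : A -> R) : der_along h (fun=> 0 : R).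
Proof. by split=> x y; rewrite ?addr0 // mul0r mulr0 addr0. Qed.

Let bracket j w := der_comm (h := idfun) (pdel_der dD j) (pdel_der dD j) (pder_der w)
  (fun x => erefl).

(** The commutator of a partial derivative and [pdel] is again a derivation, so it suffices to
    compare on constants and variables. *)
Lemma pder_pdel j v f :
  pder (vshift j v) (pdel d j f) = pdel d j (pder (vshift j v) f) + pder v f.
Proof.
have := der_eq (bracket j (vshift j v)) (_ : der_along idfun (fun f => - pder v f)) _ _ f.
move=> e; apply/eqP; rewrite addrC -subr_eq -[pder v f]opprK -{}e ?opprB // => {f}.
- by split=> f g; rewrite ?(pder_der v).1 ?opprD // (pder_der v).2 opprD mulNr mulrN.
- by move=> c; rewrite pdelC // !pderC (der0 (pdel_der dD j)) subr0 oppr0.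
- move=> w; rewrite pdelX // !pderX (inj_eq (@vshift_inj j)).
  by case: (_ == w) => /=; rewrite ?(der1 (pdel_der dD j)) ?(der0 (pdel_der dD j)) sub0r.
Qed.

Lemma pder_pdel_neq j w f : (forall v, w != vshift j v) ->
  pder w (pdel d j f) = pdel d j (pder w f).
Proof.
move=> wv; have := der_eq (bracket j w) (zero_der _) _ _ f.
move=> e; apply/eqP; rewrite eq_sym -subr_eq0 {}e // => {f}.
- by move=> c; rewrite pdelC // !pderC (der0 (pdel_der dD j)) subr0.
- move=> v; rewrite pdelX // !pderX (negPf (wv v)).
  by case: (_ == v) => /=; rewrite ?(der1 (pdel_der dD j)) ?(der0 (pdel_der dD j)) subr0.
Qed.

End PderPdel.

(** The body may be written for total functions: it sees [a0] at every element that is not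
    smaller. *)
Lemma wf_recursion (T : choiceType) (R : rel T) (A : Type) (a0 : A) (B : T -> (T -> A) -> A) :
  well_founded R -> exists psi : T -> A, forall v, psi v = B v (fun w => if R w v then psi w else a0).
Proof.
move=> wf; pose F v (rec : forall w, R w v -> A) :=
  B v (fun w => if pselect (R w v) is left h then rec w h else a0).
exists (Fix wf (fun=> A) F) => v; rewrite Fix_eq /F.
  by congr (B v _); apply/funext => w; case: pselect => [h|/negP/negPf ->]; rewrite ?h.
move=> w f g fg; congr (B w _); apply/funext => u.
by case: pselect => // h; rewrite fg.
Qed.

Section Specialization.
Context {K : fieldType} {n m : nat} (d : 'I_m -> K -> K) (D : K -> K) (rk : rel (dvar n m)).
Hypothesis rkP : is_ranking rk.
Hypothesis dD : forall j, is_derivation (d j).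
Hypothesis DD : is_derivation D.
Local Notation V := (dvar n m).
Implicit Types (f g : mpol V K) (v w : V).
Variables (P : mpol V K -> Prop) (F : pred V) (t : V -> mpol V K).
Hypothesis prP : prime_dideal d P.
Hypothesis FS : forall j v, F (vshift j v) = F v.

(** For [g] in [P], vanishing of its prolongation is an equation in the values of the derivation,
    affine with coefficients [pder w g]. This is the leading free unknown of that equation modulo
    [P]. *)
Definition lead_at g v := [/\ F v, ~ P (pder v g) &
  forall w, F w -> rk v w -> P (pder w g)].

(** The correction term in [pder_pdel] is a derivative of [pder (vshift j v) g], which lies in [P]
    because [vshift j v] ranks above the leader. So a derivative has, modulo [P], the leading
    coefficient of the original equation. *)
Lemma lead_at_pdel j g v : lead_at g v ->
  lead_at (pdel d j g) (vshift j v) /\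
  P (pder (vshift j v) (pdel d j g) - pder v g).
Proof.
have [[P0 PD PM Pd] P1 Pp] := prP; have idP : dideal d P by split.
case=> Fv nP vmax; have vv : rk v (vshift j v) by apply: rk_shift.
have key : P (pder (vshift j v) (pdel d j g) - pder v g).
  by rewrite pder_pdel // addrK; apply/Pd/vmax; rewrite ?FS.
split=> //; split; first by rewrite FS.
  move=> h; apply: nP; rewrite -[pder v g](subKr (pder (vshift j v) (pdel d j g))).
  by apply: (didealB idP).
move=> w Fw vw; have [[u wu]|nw] := pselect (exists u, w = vshift j u).
  rewrite wu FS in Fw vw *; rewrite pder_pdel //.
  have vu : rk v u.
    move: vw; apply: contraTT; rewrite -!(rkleNgt rkP) => /orP[/eqP->|uv].
      exact: rkle_refl.
    exact/rkW/(rk_vshift rkP).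
  apply: PD; last exact: vmax.
  apply/Pd/vmax; rewrite ?FS //; apply: (rk_trans rkP) vu _; exact: rk_shift.
rewrite pder_pdel_neq //.
  by apply/Pd/vmax => //; apply: (rk_trans rkP) vv vw.
by move=> u; apply/eqP => wu; apply: nw; exists u.
Qed.

Variables (L : fieldType) (iota : {rmorphism K -> L}) (x y : V -> L).
Hypothesis Px : forall f, ev iota x f = 0 <-> P f.
Hypothesis yt : forall v, ~~ F v -> y v = ev iota x (t v).
Hypothesis dev0 : forall g, P g -> dev iota (fun c => iota (D c)) x y g = 0.

Definition fixed_part g : mpol V K :=
  ev (fun c => pC V (D c)) (pX K) g + \sum_(v <- pvars g | ~~ F v) pder v g * t v.

Lemma dev_fixed_part (R : comNzRingType) (jota : {rmorphism K -> R}) (x' y' : V -> R) g :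
  (forall v, F v -> ev jota x' (pder v g) = 0) -> (forall v, ~~ F v -> y' v = ev jota x' (t v)) ->
  dev jota (fun c => jota (D c)) x' y' g = ev jota x' (fixed_part g).
Proof.
move=> xF yF; rewrite /dev /fixed_part rmorphD /= ev_comp; congr (_ + _).
  by apply: eq_ev => [c|v]; rewrite ?evC ?evX.
rewrite rmorph_sum [RHS]big_mkcond; apply: eq_bigr => v _.
by case: (boolP (F v)) => [/xF ->|/yF ->] /=; rewrite ?mul0r // rmorphM.
Qed.

(** The solvability condition: an equation without free unknowns modulo [P] is a condition on [x]
    alone. It holds at the generic point, where the derivation [y] exists, so it belongs to [P] and
    passes to every zero of [P]. *)
Lemma fixed_part0 g : P g -> (forall v, F v -> P (pder v g)) -> P (fixed_part g).
Proof.
move=> Pg PF; apply/Px; rewrite -(dev_fixed_part (y' := y)) ?dev0 //.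
by move=> v /PF/Px.
Qed.

(* The values on the free variables are determined by finitely many equations of [P]:
   one for each minimal leader, all others being derivatives of these. *)
Lemma specialize_derivation : exists h, ~ P h /\ forall z : V -> K,
  (forall f, P f -> ev idfun z f = 0) -> ev idfun z h != 0 ->
  exists psi : V -> K, (forall v, ~~ F v -> psi v = ev idfun z (t v)) /\
    forall g, P g -> dev idfun D z psi g = 0.
Proof.
have [[P0 PD PM Pd] P1 Pp] := prP; have idP : dideal d P by split.
pose isLead v := exists2 g, P g & lead_at g v.
have [l [lL lmin]] := dvar_basis isLead.
have step0 v : exists g, v \in l -> P g /\ lead_at g v.
  case: (boolP (v \in l)) => [/lL[g Pg gv]|_]; first by exists g.
  by exists 0.
have [G0 G0P] := choice step0.
(* At a zero of [P] where [h] is nonzero, the leading coefficients at the minimal leaders are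
   nonzero, and so are those of their derivatives, which reach every leader. *)
pose h := \prod_(u <- l) pder u (G0 u).
exists h; split.
  have sub u : u \in l -> u \in l by [].
  rewrite /h; elim: {-2}l sub => [|u s IHs] sub; first by rewrite big_nil.
  rewrite big_cons => /Pp[|]; last by apply: IHs => w ws; apply: sub; rewrite inE ws orbT.
  by have [_ []] := G0P u (sub u (mem_head _ _)).
move=> z Pz hz.
have h0 u : u \in l -> ev idfun z (pder u (G0 u)) != 0.
  move=> ul; move: hz; rewrite /h (rmorph_prod (ev idfun z)) (big_rem u) //=.
  by rewrite mulf_eq0 negb_or => /andP[].
have step v : exists g, isLead v -> [/\ P g, lead_at g v & ev idfun z (pder v g) != 0].
  have [lv|nlv] := pselect (isLead v); last by exists 0.
  have [u ul uv] := lmin v lv.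
  suff [g [Pg gv Pg']] : exists g, [/\ P g, lead_at g v & P (pder v g - pder u (G0 u))].
    exists g => _; split=> //; apply: contraNneq (h0 u ul) => g0.
    by have := Pz _ Pg'; rewrite rmorphB /= g0 sub0r => /eqP; rewrite oppr_eq0.
  pose Q v := exists g, [/\ P g, lead_at g v & P (pder v g - pder u (G0 u))].
  suff: Q v by []; move: v uv {lv}; refine (@dle_ind n m Q u _ _).
    by have [Pu uu] := G0P u ul; exists (G0 u); rewrite subrr.
  move=> j v _ [g [Pg gv gg]]; have [gv' gg'] := lead_at_pdel j gv.
  exists (pdel d j g); split=> //; first exact: Pd.
  by have := PD _ _ gg' gg; rewrite addrA subrK.
have [G GP] := choice step.
(* At a leader the equation of [G v] is solved for the unknown [v]; a free variable that is no
   leader is unconstrained and gets [0]. *)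
pose body v (f : V -> K) : K :=
  if pselect (isLead v) then
    - (ev D z (G v) + \sum_(w <- pvars (G v) | w != v) ev idfun z (pder w (G v)) *
         (if F w then f w else ev idfun z (t w))) / ev idfun z (pder v (G v))
  else if F v then 0 else ev idfun z (t v).
have [psi psiE] := wf_recursion 0 body (rk_wf rkP).
have psiF v : ~~ F v -> psi v = ev idfun z (t v).
  move=> Fv; rewrite psiE /body; case: pselect => [lv|nlv] /=.
    by have [g _ [Fv' _ _]] := lv; rewrite Fv' in Fv.
  by rewrite (negPf Fv).
exists psi; split=> //.
pose E := dev idfun D z psi.
have dE : der_along (ev idfun z) E by apply: dev_der; case: DD.
have EG v : isLead v -> E (G v) = 0.
  move=> lv; have [PG [Fv nP vmax] v0] := GP v lv.
  have vG : v \in pvars (G v) by apply: contraT => /pder_pvars e; rewrite e in nP.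
  rewrite /E /dev (bigD1_seq v) ?fset_uniq //= [psi v]psiE /body.
  case: pselect => //= lv'; rewrite [X in _ + (X + _)]mulrC divfK //.
  rewrite addrCA; set S1 := \sum_(i <- _ | _) _; set S2 := \sum_(i <- _ | _) _.
  suff -> : S1 = S2 by rewrite addNr.
  apply: eq_bigr => w wv; case: (boolP (F w)) => [Fw|/psiF -> //].
  (* The recursion only provides values below [v]; for higher free variables the coefficient lies in
     [P] and vanishes at [z]. *)
  case: (boolP (rk w v)) => // wv'; suff /Pz -> : P (pder w (G v)) by rewrite !mul0r.
  by apply: vmax => //; have /orP[|] := rk_total rkP wv; rewrite ?(negPf wv').
have E0 g : P g -> (forall w, F w -> P (pder w g)) -> E g = 0.
  move=> Pg PF.
  have := @dev_fixed_part K idfun z psi g (fun v Fv => Pz _ (PF v Fv)) psiF.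
  by rewrite (Pz _ (fixed_part0 Pg PF)).
have top g : P g -> (forall w, F w -> P (pder w g)) \/ exists v, lead_at g v.
  move=> Pg; have [|/existsNP[w0 /not_implyP[Fw0 nP0]]] := pselect (forall w, F w -> P (pder w g)).
    by left.
  right; pose s := [seq w <- enum_fset (pvars g) | F w && `[< ~ P (pder w g) >]].
  have sP w : F w -> ~ P (pder w g) -> w \in s.
    move=> Fw nP; rewrite mem_filter Fw asboolT //=.
    by apply: contraT => /pder_pvars e; rewrite e in nP.
  have [|v] := @rk_max _ _ _ rkP s.
    by apply/eqP => s0; have := sP _ Fw0 nP0; rewrite s0.
  rewrite mem_filter => /andP[/andP[Fv /asboolP nPv] _] vmax.
  exists v; split=> // w Fw vw; apply: contrapT => nPw.
  by have := vmax w (sP _ Fw nPw); rewrite (rkleNgt rkP) vw.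
(* Any equation with leader [v] follows from that of [G v]: cross-multiplying cancels the leader,
   and the difference has a lower leader or none. *)
have main v g : P g -> lead_at g v -> E g = 0.
  move: g; elim/(well_founded_ind (rk_wf rkP)): v => v IHv g Pg gv.
  have [PG GvL v0] := GP v (ex_intro2 _ _ g Pg gv).
  set a := pder v (G v) in v0; set b := pder v g.
  pose g' := a * g - b * G v.
  have Pg' : P g' by apply: (didealB idP); apply: PM.
  have Eg' : E g' = ev idfun z a * E g.
    rewrite (derB dE) !dE.2 (Pz _ Pg) (Pz _ PG) EG; last by exists g.
    by rewrite !mulr0 !add0r subr0.
  have dg' w : P (a * pder w g - b * pder w (G v)) -> P (pder w g').
    move=> h'; rewrite (derB (h := idfun) (pder_der w)) !(pder_der w).2.
    rewrite opprD addrACA; apply: PD => //.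
    by apply: (didealB idP); apply: PM.
  suff : E g' = 0.
    by rewrite Eg' => /eqP; rewrite mulf_eq0 (negPf v0) => /eqP.
  have [/(E0 _ Pg')//|[w g'w]] := top g' Pg'.
  apply: (IHv w) => //; have [Fw nPw _] := g'w.
  have [Fv _ gmax] := gv; have [_ _ Gmax] := GvL.
  apply: contraT => /negP nwv; exfalso; apply: nPw; apply: dg'.
  have [->|wv] := eqVneq w v; first by rewrite -/a -/b mulrC subrr.
  have vw : rk v w by have /orP[|] := rk_total rkP wv => // /nwv.
  by apply: (didealB idP); apply: PM; [apply: gmax | apply: Gmax].
by move=> g Pg; have [/(E0 _ Pg)//|[v gv]] := top g Pg; apply: (main v).
Qed.

End Specialization.

(** * Prolongations and the extra derivation *)

Lemma eq_ev_in {V : choiceType} {K R : comNzRingType} (phi : K -> R) (x y : V -> R)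
  (f : mpol V K) : {in pvars f, x =1 y} -> ev phi x f = ev phi y f.
Proof.
move=> xy; rewrite !evE; apply: eq_big_seq => k kf; congr (_ * _).
apply: eq_big_seq => v vk; rewrite xy //; apply/pvarsP; exists k => //.
by rewrite cmE_neq0.
Qed.

Section Prolongation.
Context {K : comNzRingType} {n m : nat}.
Local Notation W := (dvar (n + n) m).
Implicit Types f : mpol (dvar n m) K.

Lemma xpartE f :
  xpart f = ev (@pC W K) (fun v => pX K (lshift n v.1, v.2)) f :> mpol W K.
Proof.
transitivity (ev (fun c => c%:MP : mpol W K) (fun v => dX (lshift n v.1, v.2) : mpol W K) f).
  exact: peval_mpol.
by apply: eq_ev => [c|v]; rewrite ?pC.unlock ?pX.unlock.
Qed.

Lemma tauE (D : K -> K) f : tau D f =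
  ev (fun c => pC W (D c)) (fun v => pX K (lshift n v.1, v.2)) f +
  \sum_(v <- pvars f) (xpart (pder v f) : mpol W K) * pX K (rshift n v.1, v.2) :> mpol W K.
Proof.
have E1 : peval (R := {malg K[cmonom W]}) (fun c => (D c)%:MP)
    (fun v : dvar n m => dX (lshift n v.1, v.2)) f =
  ev (fun c => pC W (D c)) (fun v => pX K (lshift n v.1, v.2)) f :> mpol W K.
  transitivity (ev (fun c => (D c)%:MP : mpol W K) (fun v => dX (lshift n v.1, v.2) : mpol W K) f).
    exact: peval_mpol.
  by apply: eq_ev => [c|v]; rewrite ?pC.unlock ?pX.unlock.
rewrite /tau E1; congr (_ + _); apply: eq_bigr => v _; apply: etrans (malg_mulE _ _) _.
by rewrite pder.unlock pX.unlock.
Qed.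

Context {R : comNzRingType} (iota : {rmorphism K -> R}) (dR : 'I_m -> R -> R).

Lemma ev_xpart (c : 'I_(n + n) -> R) f :
  ev iota (tpt dR c) (xpart f) = ev iota (tpt dR (fun i => c (lshift n i))) f.
Proof. by rewrite xpartE ev_comp; apply: eq_ev => [a|v]; rewrite ?evC ?evX. Qed.

Lemma ev_tau (D : K -> K) (c : 'I_(n + n) -> R) f :
  ev iota (tpt dR c) (tau D f) = dev iota (fun a => iota (D a))
    (tpt dR (fun i => c (lshift n i))) (tpt dR (fun i => c (rshift n i))) f.
Proof.
rewrite tauE rmorphD /= ev_comp /dev; congr (_ + _).
  by apply: eq_ev => [a|v]; rewrite ?evC ?evX.
rewrite (raddf_sum (ev iota (tpt dR c))); apply: eq_bigr => v _.
by rewrite /= (rmorphM (ev iota (tpt dR c))) /= ev_xpart evX.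
Qed.

End Prolongation.

Section Exponents.
Context {m : nat}.
Implicit Types (e : {ffun 'I_m -> nat}) (k : nat).

Definition vext e k : {ffun 'I_m.+1 -> nat} := [ffun i => oapp e k (unlift ord_max i)].

Lemma vext_shift j e k : vext (dshift j e) k = dshift (lift ord_max j) (vext e k).
Proof.
apply/ffunP => i; rewrite !ffunE; case: unliftP => [i' ->|->] /=.
  by rewrite ffunE (inj_eq lift_inj).
by rewrite (negPf (neq_lift _ _)) addn0.
Qed.

Lemma vextS e k : vext e k.+1 = dshift ord_max (vext e k).
Proof.
apply/ffunP => i; rewrite !ffunE; case: unliftP => [i' ->|->] /=.
  by rewrite eq_sym (negPf (neq_lift _ _)) addn0.
by rewrite eqxx addn1.
Qed.

Lemma vext0 : vext [ffun=> 0%N] 0 = [ffun=> 0%N].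
Proof. by apply/ffunP => i; rewrite !ffunE; case: unliftP => [i' _|_] //=; rewrite ffunE. Qed.

Lemma vext_restrict (e : {ffun 'I_m.+1 -> nat}) :
  vext [ffun j => e (lift ord_max j)] (e ord_max) = e.
Proof. by apply/ffunP => i; rewrite !ffunE; case: unliftP => [i' ->|->] //=; rewrite ffunE. Qed.

Context {L : Type} (dl : 'I_m.+1 -> L -> L).
Hypothesis dlC : commuting_family dl.

Lemma restrict_comm : commuting_family (fun j => dl (lift ord_max j)).
Proof. by move=> i j x; rewrite dlC. Qed.

Lemma theta_vext e k x : theta_app dl (vext e k) x =
  theta_app (fun j => dl (lift ord_max j)) e (iter k (dl ord_max) x).
Proof.
pose X (v : dvar 1 m) := theta_app dl (vext v.2 k) x.
have dX : dpoint (fun j => dl (lift ord_max j)) X.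
  by move=> j v; rewrite /X /= vext_shift theta_app_shift.
have := dpoint_tpt restrict_comm dX (ord0, e); rewrite /X /tpt /= => ->; congr theta_app.
elim: k {X dX} => [|k IHk]; first by rewrite vext0 theta_app0.
by rewrite vextS theta_app_shift // IHk.
Qed.

Lemma theta_restrict_comm e x : dl ord_max (theta_app (fun j => dl (lift ord_max j)) e x) =
  theta_app (fun j => dl (lift ord_max j)) e (dl ord_max x).
Proof.
by rewrite -[x]/(iter 0 (dl ord_max) x) -theta_vext -theta_app_shift // -vextS theta_vext.
Qed.

End Exponents.

Lemma ext_der_lift (K : Type) (m : nat) (d : 'I_m -> K -> K) D j :
  ext_der d D (lift ord_max j) = d j.
Proof. by rewrite /ext_der liftK. Qed.

Lemma ext_der_max (K : Type) (m : nat) (d : 'I_m -> K -> K) D : ext_der d D ord_max = D.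
Proof. by rewrite /ext_der unlift_none. Qed.

Section Substitution.
Context {K : comNzRingType} {n N m : nat} (sigma : 'I_N -> 'I_n) (kappa : 'I_N -> nat).

Definition substv (v : dvar N m) : dvar n m.+1 := (sigma v.1, vext v.2 (kappa v.1)).

(* [q(x)] with the [i]-th variable replaced by [D^(kappa i) x_(sigma i)] *)
Definition subst_D (q : mpol (dvar N m) K) : mpol (dvar n m.+1) K :=
  ev (@pC _ K) (fun v => pX K (substv v)) q.

Lemma ev_subst_D (L : comNzRingType) (iota : {rmorphism K -> L}) (dl : 'I_m.+1 -> L -> L)
    (b : 'I_n -> L) q : commuting_family dl ->
  ev iota (tpt dl b) (subst_D q) = ev iota (tpt (fun j => dl (lift ord_max j))
     (fun i => iter (kappa i) (dl ord_max) (b (sigma i)))) q.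
Proof.
move=> dlC; rewrite /subst_D ev_comp; apply: eq_ev => [c|v]; rewrite ?evC ?evX //.
by rewrite /tpt /= theta_vext.
Qed.

End Substitution.

Section LiftDerivation.
Context {K : fieldType} {n N m : nat} (d : 'I_m -> K -> K) (D : K -> K).
Hypothesis ch : [pchar K] =i pred0.
Hypothesis dD : forall j, is_derivation (d j).
Hypothesis DD : is_derivation D.
Hypothesis dC : commuting_family d.
Hypothesis DC : forall j c, d j (D c) = D (d j c).

Lemma ext_derP j : is_derivation (ext_der d D j).
Proof. by case: (unliftP ord_max j) => [i ->|->]; rewrite ?ext_der_lift ?ext_der_max. Qed.

Lemma ext_der_comm : commuting_family (ext_der d D).
Proof.
move=> i j c; case: (unliftP ord_max i) => [i' ->|->]; case: (unliftP ord_max j) => [j' ->|->];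
  by rewrite ?ext_der_lift ?ext_der_max // ?DC // dC.
Qed.

Context {L : fieldType} (iota : {rmorphism K -> L}) (dL : 'I_m -> L -> L) (D' : L -> L).
Hypothesis dLD : forall j, is_derivation (dL j).
Hypothesis dLC : commuting_family dL.
Hypothesis io : forall j c, iota (d j c) = dL j (iota c).
Hypothesis DD' : is_derivation D'.
Hypothesis ioD : forall c, iota (D c) = D' (iota c).
Variables (sigma : 'I_N -> 'I_n) (kappa : 'I_N -> nat) (a : 'I_n -> L) (alpha : 'I_N -> L).
Hypothesis alphaE : forall i e,
  theta_app dL e (alpha i) = iter (kappa i) D' (theta_app dL e (a (sigma i))).

(* [D'] need not commute with the derivations of [L]: it only serves to build an
   algebraic point, which is then replaced by a differential one. *)
Lemma lift_derivation : exists (M : fieldType) (jota : {rmorphism K -> M})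
    (dM : 'I_m.+1 -> M -> M) (b : 'I_n -> M),
  [/\ forall j, is_derivation (dM j), commuting_family dM,
      forall j c, jota (ext_der d D j c) = dM j (jota c) &
      forall q : mpol (dvar N m) K, ev jota (tpt dM b) (subst_D sigma kappa q) = 0 <->
        ev iota (tpt dL alpha) q = 0].
Proof.
(* [D'] is applied after the other derivations, so that [psi] turns [D] into [D'] exactly; no such
   rule is available for the others. *)
pose psi (v : dvar n m.+1) := iter (v.2 ord_max) D'
  (theta_app dL [ffun j => v.2 (lift ord_max j)] (a v.1)).
have psiD f : ev iota psi (pdel (ext_der d D) ord_max f) = D' (ev iota psi f).
  move: f; apply: morph_der_gen => [||c|v].
  - by apply: pdel_der => j; exact: ext_derP.
  - by have [] := DD'.
  - by rewrite /= pdelC ?evC ?ext_der_max ?ioD //; exact: ext_derP.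
  - rewrite /= pdelX ?evX; last exact: ext_derP.
    rewrite /psi /= ffunE eqxx addn1 /=; congr (D' (iter _ _ (theta_app _ _ _))).
    by apply/ffunP => j; rewrite !ffunE eq_sym (negPf (neq_lift _ _)) addn0.
have psiS q : ev iota psi (subst_D sigma kappa q) = ev iota (tpt dL alpha) q.
  rewrite /subst_D ev_comp; apply: eq_ev => [c|[i e]]; rewrite ?evC ?evX //.
  rewrite /psi /tpt /= alphaE ffunE unlift_none /=; congr (iter _ _ (theta_app _ _ _)).
  by apply/ffunP => j; rewrite !ffunE liftK.
have [M [jota [dM [b [[dMD dMC jo] bk bX]]]]] :=
  differential_point ch ext_derP ext_der_comm iota psi.
exists M, jota, dM, b; split=> // q; split=> [/bk|q0]; first by rewrite psiS.
(* The [D]-derivatives of the relations of [alpha]. They vanish at [psi], and they are stable under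
   all derivations because these commute on polynomials even where [D'] does not on [L]. *)
pose X (f : mpol (dvar n m.+1) K) := exists k q, [/\ ev iota (tpt dL alpha) q = 0 &
  f = iter k (pdel (ext_der d D) ord_max) (subst_D sigma kappa q)].
apply: (bX X); last by exists 0%N, q.
- move=> j _ [k [p [p0 ->]]]; case: (unliftP ord_max j) => [i ->|->]; last by exists k.+1, p.
  exists k, (pdel d i p); split.
    rewrite (ev_pdel dD dLD io (tpt_dpoint dLC alpha)) p0.
    exact: der0 (is_der_along dLD i).
  have -> : subst_D sigma kappa (pdel d i p) =
      pdel (ext_der d D) (lift ord_max i) (subst_D sigma kappa p).
    move: p {p0}; apply: morph_der_gen => [||c|v].
    + exact: pdel_der.
    + by apply: pdel_der => j'; exact: ext_derP.
    + by rewrite /= pdelC // !evC pdelC ?ext_der_lift //; exact: ext_derP.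
    + rewrite /= pdelX // !evX pdelX; last exact: ext_derP.
      by rewrite /substv /= vext_shift.
  elim: k => //= k <-; apply: pdel_comm; [exact: ext_derP | exact: ext_der_comm].
- move=> _ [k [p [p0 ->]]]; elim: k => [|k IHk] /=; first by rewrite psiS.
  by rewrite psiD IHk; have [h1 h2] := DD'; apply: (@addrI _ (D' 0)); rewrite -h1 !addr0.
Qed.

End LiftDerivation.

Section LiftPoint.
Context {K : fieldType} {n m : nat} (d : 'I_m -> K -> K) (D : K -> K).
Hypothesis dcf : DCF d.
Hypothesis DD : is_derivation D.
Hypothesis DC : forall j c, d j (D c) = D (d j c).
Local Notation V := (dvar n m).
Variables (P : mpol V K -> Prop) (F : pred V) (s psi : V -> K) (a : 'I_n -> K).
Hypothesis idP : dideal d P.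
Hypothesis FS : forall j v, F (vshift j v) = F v.
Hypothesis sS : forall j v, ~~ F v -> s (vshift j v) = d j (s v).
Hypothesis psis : forall v, ~~ F v -> psi v = s v.
Hypothesis psi0 : forall g, P g -> dev idfun D (tpt d a) psi g = 0.

(** [psi] solves the equations only algebraically. Substituting [a] for [x] turns the prolongations
    of [P] into differential equations in [y] over [K]; together with the prescribed values [s] they
    are stable under derivation, so a differential solution exists in an extension, and then in
    [K]. *)
Lemma lift_point (Lam : seq (mpol V K)) : (forall f, f \in Lam -> P f) ->
  exists b : 'I_n -> K, (forall f, f \in Lam -> dev idfun D (tpt d a) (tpt d b) f = 0) /\
    forall i, ~~ F (i, [ffun=> 0%N]) -> b i = s (i, [ffun=> 0%N]).
Proof.
move=> LP; have [[ch dD dC] ec] := dcf.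
pose z := tpt d a.
pose taua (g : mpol V K) : mpol V K := dev (@pC V K) (fun c => pC V (D c)) (fun v => pC V (z v)) (pX K) g.
have pCD : der_along (@pC V K) (fun c => pC V (D c)).
  by have [h1 h2] := DD; split=> u v; rewrite ?h1 ?h2 ?rmorphD // !rmorphM.
have taud j g : pdel d j (taua g) = taua (pdel d j g).
  move: g; apply: (@der_comm_gen K V (mpol V K) (ev (@pC V K) (fun v => pC V (z v))) (pdel d j)).
  - exact: pdel_der.
  - exact: pdel_der.
  - exact: dev_der.
  - apply: morph_der_gen => [||c|v]; [exact: pdel_der | exact: pdel_der | |].
      by rewrite /= pdelC // !evC pdelC.
    by rewrite /= pdelX // !evX pdelC // /z (tpt_dpoint dC).
  - by move=> c; rewrite /taua [pdel d j (pC V c)]pdelC // !(devC pCD) pdelC // DC.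
  - by move=> v; rewrite /taua [pdel d j (pX K v)]pdelX // !(devX pCD) pdelX.
have evtau (S : comNzRingType) (jota : {rmorphism K -> S}) (y : V -> S) g :
    ev jota y (taua g) = dev jota (fun c => jota (D c)) (fun v => jota (z v)) y g.
  rewrite /taua /dev rmorphD /= ev_comp; congr (_ + _).
    by apply: eq_ev => [c|v]; rewrite ?evC.
  rewrite (raddf_sum (ev jota y)); apply: eq_bigr => v _.
  rewrite /= (rmorphM (ev jota y)) /= evX ev_comp; congr (_ * _).
  by apply: eq_ev => [c|w]; rewrite ?evC.
pose X (f : mpol V K) := (exists2 g, P g & f = taua g) \/
  exists2 v, ~~ F v & f = pX K v - pC V (s v).
have [M [jota [dM [b [[dMD dMC jo] _ bX]]]]] := differential_point ch dD dC idfun psi.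
have {}bX f : X f -> ev jota (tpt dM b) f = 0.
  move: f; apply: bX.
  - move=> j f [[g Pg ->]|[v Fv ->]].
      by left; exists (pdel d j g); rewrite ?taud //; case: idP => _ _ _; apply.
    right; exists (vshift j v); first by rewrite FS.
    by rewrite (derB (pdel_der dD j)) pdelX // pdelC // sS.
  move=> f [[g Pg ->]|[v Fv ->]].
    by rewrite evtau; apply: psi0.
  by rewrite rmorphB /= evX evC psis // subrr.
pose fixed := [seq i <- enum 'I_n | ~~ F (i, [ffun=> 0%N])].
pose fs := [seq taua f | f <- Lam] ++
  [seq pX K (i, [ffun=> 0%N]) - pC V (s (i, [ffun=> 0%N])) | i <- fixed].
have fsX f : f \in fs -> X f.
  rewrite mem_cat => /orP[/mapP[g gL ->]|/mapP[i]]; first by left; exists g => //; apply: LP.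
  by rewrite mem_filter => /andP[Fi _] ->; right; exists (i, [ffun=> 0%N]).
have [|c [cfs _]] := ec n fs [::].
  exists M, jota, dM, b; split=> // f ffs.
  by rewrite devalE; apply/bX/fsX.
exists c; split.
  move=> f fL; have := cfs (taua f); rewrite devalE mem_cat map_f // => /(_ isT).
  by rewrite (evtau _ idfun).
move=> i Fi; have ifs : pX K (i, [ffun=> 0%N]) - pC V (s (i, [ffun=> 0%N])) \in fs.
  rewrite mem_cat; apply/orP; right; apply/mapP; exists i => //.
  by rewrite mem_filter Fi mem_enum.
have := cfs _ ifs; rewrite devalE.
rewrite (rmorphB (ev idfun (tpt d c))) /= evX evC /tpt /= theta_app0 => /eqP.
by rewrite subr_eq0 => /eqP.
Qed.

End LiftPoint.

Lemma vanishing_prime_dideal {K : comNzRingType} {L : fieldType} {n m : nat}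
  (d : 'I_m -> K -> K) (dL : 'I_m -> L -> L) (iota : {rmorphism K -> L}) (x : dvar n m -> L) :
  (forall j, is_derivation (d j)) -> (forall j, is_derivation (dL j)) ->
  (forall j c, iota (d j c) = dL j (iota c)) -> dpoint dL x ->
  prime_dideal d (fun f => ev iota x f = 0).
Proof.
move=> dD dLD io dx; split; first split.
- exact: rmorph0.
- by move=> f g f0 g0; rewrite rmorphD /= f0 g0 addr0.
- by move=> f g g0; rewrite rmorphM /= g0 mulr0.
- by move=> j f f0; rewrite (ev_pdel dD dLD io dx) f0 (der0 (is_der_along dLD j)).
- by rewrite rmorph1 => /eqP; rewrite oner_eq0.
by move=> f g /eqP; rewrite rmorphM mulf_eq0 => /orP[] /eqP; [left | right].
Qed.

Lemma cat_ptl {T : Type} {n : nat} (a b : 'I_n -> T) : (fun i => cat_pt a b (lshift n i)) = a.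
Proof. by apply/funext => i; rewrite /cat_pt (unsplitK (inl i)). Qed.

Lemma cat_ptr {T : Type} {n : nat} (a b : 'I_n -> T) : (fun i => cat_pt a b (rshift n i)) = b.
Proof. by apply/funext => i; rewrite /cat_pt (unsplitK (inr i)). Qed.

(** Coordinate [i] of [(a, D a)] is [D^(side i)] of [a_(half i)], which makes the pair an instance
    of [subst_D]. *)
Definition half {n : nat} (i : 'I_(n + n)) : 'I_n :=
  match split i with inl j => j | inr j => j end.
Definition side {n : nat} (i : 'I_(n + n)) : nat :=
  match split i with inl _ => 0 | inr _ => 1 end.

(** * Jets of bounded order in the extra derivation *)

Section Jets.
Context {n : nat} (r : nat).
Local Notation N := #|{: 'I_n * 'I_r.+1}|.

(* [jet i k] indexes the variable that stands for [D^k x_i]. *)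
Definition jet (i : 'I_n) (k : nat) : 'I_N := enum_rank (i, inord k : 'I_r.+1).
Definition jbase (i : 'I_N) : 'I_n := (enum_val i).1.
Definition jlev (i : 'I_N) : 'I_r.+1 := (enum_val i).2.
Definition jnext (i : 'I_N) : 'I_N := jet (jbase i) (jlev i).+1.

Lemma jbaseK i k : jbase (jet i k) = i.
Proof. by rewrite /jbase enum_rankK. Qed.

Lemma jlevK i k : (k <= r)%N -> jlev (jet i k) = k :> nat.
Proof. by move=> kr; rewrite /jlev enum_rankK /= inordK. Qed.

Lemma jnextK i k : (k < r)%N -> jnext (jet i k) = jet i k.+1.
Proof. by move=> kr; rewrite /jnext jbaseK jlevK // ltnW. Qed.

Lemma jlev_next i : jlev i != ord_max -> jlev (jnext i) = (jlev i).+1 :> nat.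
Proof.
by move=> ir; rewrite jlevK // ltn_neqAle -ltnS ltn_ord andbT; apply: contraNneq ir => e; apply/eqP/val_inj.
Qed.

Lemma jet_rec {T : Type} (E : T -> T) (c : 'I_N -> T) :
  (forall i, jlev i != ord_max -> c (jnext i) = E (c i)) ->
  forall i k, (k <= r)%N -> c (jet i k) = iter k E (c (jet i 0)).
Proof.
move=> cE i; elim=> // k IHk kr; have kr' := ltnW kr; rewrite /= -jnextK // cE ?IHk //.
by apply: contraTneq kr => e; rewrite -(jlevK i kr') e ltnn.
Qed.

(** For an order in [D] above [r] the index is a default value, hence the bound in [ev_jet_poly]. *)
Definition jet_var {m : nat} (v : dvar n m.+1) : dvar N m :=
  (jet v.1 (v.2 ord_max), [ffun j => v.2 (lift ord_max j)]).

Definition jet_poly {K : comNzRingType} {m : nat} (f : mpol (dvar n m.+1) K) : mpol (dvar N m) K :=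
  ev (@pC _ K) (fun v => pX K (jet_var v)) f.

Lemma ev_jet_poly {K L : comNzRingType} {m : nat} (iota : {rmorphism K -> L})
    (dl : 'I_m.+1 -> L -> L) (b : 'I_n -> L) (c : 'I_N -> L)
    (f : mpol (dvar n m.+1) K) : commuting_family dl ->
  (forall i k, (k <= r)%N -> c (jet i k) = iter k (dl ord_max) (b i)) ->
  {in pvars f, forall v : dvar n m.+1, v.2 ord_max <= r}%N ->
  ev iota (tpt (fun j => dl (lift ord_max j)) c) (jet_poly f) = ev iota (tpt dl b) f.
Proof.
move=> dlC cE fr; rewrite /jet_poly ev_comp.
transitivity (ev iota (fun v => tpt (fun j => dl (lift ord_max j)) c (jet_var v)) f).
  by apply: eq_ev => [k|v]; rewrite ?evC ?evX.
apply: eq_ev_in => v /fr vr; rewrite /tpt /= cE // -theta_vext //.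
by rewrite vext_restrict.
Qed.

End Jets.

(** * Equivalence of closedness with the prolongation condition *)

Section Characterization.
Context {K : fieldType} {m : nat} (d : 'I_m -> K -> K) (D : K -> K).
Hypothesis ch : [pchar K] =i pred0.
Hypothesis dD : forall j, is_derivation (d j).
Hypothesis DD : is_derivation D.
Hypothesis dC : commuting_family d.
Hypothesis DC : forall j x, d j (D x) = D (d j x).

Let ext_lift : (fun j => ext_der d D (lift ord_max j)) = d.
Proof. by apply/funext => j; rewrite ext_der_lift. Qed.

Lemma ev_subst_ext {n N : nat} (sigma : 'I_N -> 'I_n) (kappa : 'I_N -> nat) (b : 'I_n -> K) q :
  ev idfun (tpt (ext_der d D) b) (subst_D sigma kappa q) =
  ev idfun (tpt d (fun i => iter (kappa i) D (b (sigma i)))) q.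
Proof.
by rewrite ev_subst_D ?ext_lift ?ext_der_max //; exact: ext_der_comm.
Qed.

Lemma dcf_reduct : DCF (ext_der d D) -> DCF d.
Proof.
case=> _ ec; split; first by split.
move=> n fs gs [L [iota [dL [a [dLD dLC io fs0 gs0]]]]].
have chL : [pchar L] =i pred0 by move=> p; rewrite (fmorph_pchar iota) ch.
have [Da Dm] := DD.
have D0 : D 0 = 0 by apply: (@addrI _ (D 0)); rewrite -Da !addr0.
have D1 : D 1 = 0.
  by apply: (@addrI _ (D 1)); rewrite addr0 -{3}(mulr1 1) Dm mulr1 mul1r.
pose G : set (L * L) := fun z => exists c, z = (iota c, iota (D c)).
have gG : der_graph G.
  split.
  - by exists 0; rewrite D0 !rmorph0.
  - by exists 1; rewrite D1 rmorph1 rmorph0.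
  - move=> _ _ _ _ [c [-> ->]] [c' [-> ->]]; exists (c - c').
    have DN : D (- c') = - D c' by apply: (@addrI _ (D c')); rewrite -Da !subrr.
    by rewrite Da DN !rmorphB.
  - move=> _ _ _ _ [c [-> ->]] [c' [-> ->]]; exists (c * c').
    by rewrite Dm rmorphD !rmorphM.
  - by move=> x [c [/esym/eqP]]; rewrite fmorph_eq0 => /eqP -> ->; rewrite D0 rmorph0.
have [D' [D'a D'm] D'G] := derivation_extension chL gG.
have ioD c : iota (D c) = D' (iota c) by apply/esym/D'G; exists c.
(* The system does not involve [D], hence order [0] in [D]; the lift is needed because [D'] need not
   commute with the derivations of [L]. *)
have [M [jota [dM [b [dMD dMC jo bE]]]]] := lift_derivation (sigma := id) (kappa := fun=> 0%N)
  ch dD DD dC DC dLD dLC io (conj D'a D'm) ioD (fun i e => erefl (theta_app dL e (a i))).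
pose S := subst_D (K := K) (m := m) (n := n) id (fun=> 0%N).
have [|c [cf cg]] := ec n [seq S f | f <- fs] [seq S g | g <- gs].
  exists M, jota, dM, b; split=> // _ /mapP[f fI ->]; rewrite devalE.
    by apply/bE; rewrite -devalE; apply: fs0.
  by apply/eqP => /bE e; have := gs0 _ fI; rewrite devalE e eqxx.
exists c; split=> [f fI|g gI].
  have := cf (S f) (map_f _ fI); rewrite !devalE => <-.
  by apply/esym; exact: (ev_subst_ext id (fun=> 0%N)).
have := cg (S g) (map_f _ gI); rewrite !devalE; apply: contraNneq => <-.
by apply/eqP; exact: (ev_subst_ext id (fun=> 0%N)).
Qed.

Lemma cat_pt_half {n : nat} (a : 'I_n -> K) :
  (fun i => iter (side i) D (a (half i))) = cat_pt a (fun i => D (a i)).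
Proof. by apply/funext => i; rewrite /cat_pt /side /half; case: split. Qed.

Lemma dcf_prolongation (rk : forall n, rel (dvar n m)) : (forall n, is_ranking (rk n)) ->
  DCF (ext_der d D) ->
  forall (n : nat) (Lam : seq (dpoly K n m)) (O : ('I_n -> K) -> Prop)
         (W : ('I_(n + n) -> K) -> Prop),
  (exists I, is_prime_dideal d I /\ is_charset (rk n) I Lam) ->
  dopen_in d (Vset d (fun f => f \in Lam)) O ->
  (exists a, O a) ->
  (forall a, O a -> deval id d a (H_of (rk n) Lam) != 0) ->
  dclosed d W ->
  (forall c, W c -> forall f, f \in Lam ->
     deval id d c (xpart f) = 0 /\ deval id d c (tau D f) = 0) ->
  (forall a, O a -> exists b, W (cat_pt a b)) ->
  exists a, O a /\ W (cat_pt a (fun i => D (a i))).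
Proof.
move=> rkP dcfD n Lam O W [I [/is_prime_didealE prI csL]] [SO OE] [a0 Oa0] OH [SW WE] WL OW.
have [_ ec] := dcf_reduct dcfD; have [_ ecD] := dcfD.
have [[I0 ID IM Id] I1 IP] := prI.
have vanish a : O a -> forall f, I f -> ev idfun (tpt d a) f = 0.
  move=> Oa; apply: (charset_vanish (iota := idfun) (rkP n) dD dD (fun _ _ => erefl) prI csL
    (tpt_dpoint dC a)).
    by move=> f fL; have [La _] := (OE a).1 Oa; have := La f fL; rewrite devalE.
  by have := OH a Oa; rewrite devalE.
(* One polynomial that is nonzero at [a0] replaces the family [SO]: on the zeros of [Lam] this
   single inequation suffices for membership in [O]. *)
have [g SOg ga0] : exists2 g, SO g & ev idfun (tpt d a0) g != 0.
  have [_ /existsNP[g /not_implyP[SOg /eqP g0]]] := (OE a0).1 Oa0.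
  by exists g => //; move: g0; rewrite devalE.
have nIg : ~ I g by move=> /(vanish a0 Oa0) e; rewrite e eqxx in ga0.
have inO a : (forall f, f \in Lam -> ev idfun (tpt d a) f = 0) -> ev idfun (tpt d a) g != 0 -> O a.
  move=> La ga; apply/OE; split=> [f fL|]; first by rewrite devalE; apply: La.
  by move/(_ g SOg); rewrite devalE => e; move: ga; rewrite [X in X != _]e eqxx.
pose B (h : mpol (dvar n m) K) : set ('I_n -> K) := [set a | O a /\ ev idfun (tpt d a) h != 0]%classic.
(* The generic point of [I] is a zero of [Lam] at which neither [g] nor [h] vanishes; closedness for
   [Delta] brings such a point down to [K]. *)
have dense h : ~ I h -> exists a, B h a.
  move=> nIh; have [L [iota [dL [a [dLD dLC io aI]]]]] := realize dD dC prI.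
  have [|c [cf cg]] := ec n Lam [:: g; h].
    exists L, iota, dL, a; split=> // [f fL|f].
      by rewrite devalE; apply/aI; have [_ LI _] := csL; apply: LI.
    by rewrite !inE devalE => /orP[] /eqP ->; apply/eqP => /aI.
  exists c; split; last by have := cg h; rewrite !inE eqxx orbT devalE; apply.
  apply: inO => [f fL|]; first by have := cf f fL; rewrite devalE.
  by have := cg g; rewrite !inE eqxx devalE; apply.
have [b bP] : exists b : ('I_n -> K) -> ('I_n -> K), forall a, O a -> W (cat_pt a (b a)).
  have step a : exists b, O a -> W (cat_pt a b).
    by have [/OW[b Wb]|nO] := pselect (O a); [exists b | exists a].
  by have [b bP] := choice step; exists b.
pose Dom : set (mpol (dvar n m) K) := fun h => ~ I h.
have FF : ProperFilter (filter_from Dom B).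
  apply: filter_from_proper; last by move=> h /dense[a]; exists a.
  apply: filter_from_filter; first by exists 1.
  move=> h1 h2 n1 n2; exists (h1 * h2); first by move=> /IP[].
  by move=> a [Oa]; rewrite rmorphM mulf_eq0 negb_or => /andP[]; split; split.
have [U [UU FU]] := ultraFilterLemma FF.
have UF : Filter U by apply: filter_filter.
have UB h : ~ I h -> U (B h) by move=> nIh; apply: FU; exact: in_filter_from.
have UO (A : set ('I_n -> K)) : (forall a, O a -> A a) -> U A.
  by move=> OA; apply: filterS (UB _ I1) => a [/OA].
have prQ := ultra_prime_dideal dD dC (fun a => cat_pt a (b a)) UU.
have [L [iota [dL [c [dLD dLC io cQ]]]]] := realize dD dC prQ.
pose al i := c (lshift n i); pose be i := c (rshift n i).
have alI f : ev iota (tpt dL al) f = 0 <-> I f.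
  rewrite -ev_xpart cQ; split=> [Uf|If]; last first.
    by apply: UO => a Oa /=; rewrite ev_xpart cat_ptl; apply: vanish.
  apply: contrapT => nIf; have [a [/= fa [_]]] := filter_ex (filterI Uf (UB _ nIf)).
  by move: fa; rewrite ev_xpart cat_ptl => ->; rewrite eqxx.
have tau0 f : f \in Lam -> dev iota (fun k => iota (D k)) (tpt dL al) (tpt dL be) f = 0.
  move=> fL; rewrite -ev_tau; apply/cQ; apply: UO => a Oa /=.
  by have [_] := WL _ (bP a Oa) f fL; rewrite devalE.
have W0 p : SW p -> ev iota (tpt dL c) p = 0.
  move=> Sp; apply/cQ; apply: UO => a Oa /=.
  by have := (WE _).1 (bP a Oa) p Sp; rewrite devalE.
pose E := dev iota (fun k => iota (D k)) (tpt dL al) (tpt dL be).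
have iD := iotaD_der iota DD.
have dE : der_along (ev iota (tpt dL al)) E by exact: dev_der.
have E0 f : ev iota (tpt dL al) f = 0 -> E f = 0.
  move=> /alI; apply: (charset_dev (rkP n) dD dLD io prI csL (tpt_dpoint dLC al) _ _ DD DC
    (tpt_dpoint dLC be)) => // [h hL|].
    by apply/alI; have [_ LI _] := csL; apply: LI.
  by apply/eqP => /alI; apply: (charset_H (rkP n) prI ch csL).
(* By [E0] this is single-valued: it is the derivation of the differential ring generated by [al]
   over [K] that extends [D] and sends [al] to [be]. *)
pose G : set (L * L) := fun z => exists f, z = (ev iota (tpt dL al) f, E f).
have gG : der_graph G.
  split.
  - by exists 0; rewrite rmorph0 (der0 dE).
  - by exists 1; rewrite rmorph1 (der1 dE).
  - move=> _ _ _ _ [f [-> ->]] [f' [-> ->]]; exists (f - f').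
    by rewrite rmorphB (derB dE).
  - by move=> _ _ _ _ [f [-> ->]] [f' [-> ->]]; exists (f * f'); rewrite rmorphM dE.2.
  - by move=> x [f [/esym/E0 e ->]].
have chL : [pchar L] =i pred0 by move=> p; rewrite (fmorph_pchar iota) ch.
have [D' [D'a D'm] D'G] := derivation_extension chL gG.
have ioD k : iota (D k) = D' (iota k).
  by apply/esym/D'G; exists (pC _ k); rewrite evC /E (devC iD).
have cE i e : theta_app dL e (c i) = iter (side i) D' (theta_app dL e (al (half i))).
  rewrite /side /half; case: (splitP i) => j ij.
    by have -> : i = lshift n j by apply: val_inj.
  have -> : i = rshift n j by apply: val_inj.
  by apply/esym/D'G; exists (pX K (j, e)); rewrite evX /E (devX iD).
have [M [jota [dM [e [dMD dMC jo eE]]]]] :=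
  lift_derivation ch dD DD dC DC dLD dLC io (conj D'a D'm) ioD cE.
pose S := subst_D (K := K) (m := m) (@half n) (@side n).
(* [SW] may be infinite, whereas [DCF] only handles finite systems. *)
have [FW [FWS FWb]] := finite_basis ch dD dC SW (rkP (n + n)%N).
have [|u [uf ug]] := ecD n [seq S p | p <- [seq (xpart f : mpol (dvar (n + n) m) K) | f <- Lam] ++ FW]
    [:: S (xpart g)].
  exists M, jota, dM, e; split=> // [_ /mapP[p pI ->]|f].
    rewrite devalE; apply/eE; move: pI; rewrite mem_cat => /orP[/mapP[f fL ->]|/FWS/W0 //].
    by rewrite ev_xpart; apply/alI; have [_ LI _] := csL; apply: LI.
  rewrite inE => /eqP ->; rewrite devalE; apply/eqP => /eE; rewrite ev_xpart => /alI.
  exact: nIg.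
have Su p : ev idfun (tpt (ext_der d D) u) (S p) =
    ev idfun (tpt d (cat_pt u (fun i => D (u i)))) p.
  by rewrite /S ev_subst_ext cat_pt_half.
exists u; split.
  apply: inO => [f fL|].
    have := uf (S (xpart f)); rewrite map_f ?mem_cat ?(map_f (fun f => xpart f : mpol _ K)) // => /(_ isT).
    by rewrite devalE [LHS]Su ev_xpart cat_ptl.
  by have := ug (S (xpart g)); rewrite inE eqxx devalE [X in X != _]Su ev_xpart cat_ptl; apply.
apply/WE => p Sp; rewrite devalE; apply: FWb => // q qF.
have := uf (S q); rewrite map_f ?mem_cat ?qF ?orbT // => /(_ isT).
by rewrite devalE [LHS]Su.
Qed.

Lemma prolongation_dcf (rk : forall n, rel (dvar n m)) : (forall n, is_ranking (rk n)) ->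
  DCF d ->
  (forall (n : nat) (Lam : seq (dpoly K n m)) (O : ('I_n -> K) -> Prop)
          (W : ('I_(n + n) -> K) -> Prop),
   (exists I, is_prime_dideal d I /\ is_charset (rk n) I Lam) ->
   dopen_in d (Vset d (fun f => f \in Lam)) O ->
   (exists a, O a) ->
   (forall a, O a -> deval id d a (H_of (rk n) Lam) != 0) ->
   dclosed d W ->
   (forall c, W c -> forall f, f \in Lam ->
      deval id d c (xpart f) = 0 /\ deval id d c (tau D f) = 0) ->
   (forall a, O a -> exists b, W (cat_pt a b)) ->
   exists a, O a /\ W (cat_pt a (fun i => D (a i)))) ->
  DCF (ext_der d D).
Proof.
move=> rkP dcf prol; have [_ ec] := dcf.
have extC := ext_der_comm dC DC.
split; first by split=> //; exact: ext_derP.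
move=> n fs gs [L [iota [dL [a [dLD dLC io fs0 gs0]]]]].
pose dL' j := dL (lift ord_max j); pose DL := dL ord_max.
have dLC' : commuting_family dL' := restrict_comm dLC.
have dLD' j : is_derivation (dL' j) by apply: dLD.
have io' j c : iota (d j c) = dL' j (iota c) by rewrite /dL' -io ext_der_lift.
have ioD c : iota (D c) = DL (iota c) by rewrite /DL -io ext_der_max.
pose r := (\max_(f <- fs ++ gs) \max_(v <- enum_fset (pvars f)) v.2 ord_max)%N.
have rP f : f \in fs ++ gs -> {in pvars f, forall v : dvar n m.+1, v.2 ord_max <= r}%N.
  move=> fI v vf; apply: (@leq_trans (\max_(w <- enum_fset (pvars f)) w.2 ord_max)%N).
    by apply: (leq_bigmax_seq (F := fun w : dvar n m.+1 => w.2 ord_max)).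
  exact: (leq_bigmax_seq (F := fun f : dpoly K n m.+1 =>
    \max_(w <- enum_fset (pvars f)) w.2 ord_max)%N).
pose N := #|{: 'I_n * 'I_r.+1}|.
pose nxt : 'I_N -> 'I_N := @jnext n r.
pose S : dpoly K n m.+1 -> mpol (dvar N m) K := @jet_poly n r K m.
pose c (i : 'I_N) := iter (jlev i) DL (a (jbase i)).
have cE i k : (k <= r)%N -> c (jet r i k) = iter k DL (a i).
  by move=> kr; rewrite /c jbaseK jlevK.
pose x := tpt dL' c.
have cS f : f \in fs ++ gs -> ev iota x (S f) = ev iota (tpt dL a) f.
  by move=> fI; apply: ev_jet_poly => //; apply: rP.
pose P := fun f : mpol (dvar N m) K => ev iota x f = 0.
have prP : prime_dideal d P by apply: (vanishing_prime_dideal dD dLD' io'); exact: tpt_dpoint.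
have [idP P1 PM] := prP.
have [Lam csL] := charset_exists (rkP N) P.
have nPH := charset_H (rkP N) prP ch csL.
have LP f : f \in Lam -> P f by have [_ LI _] := csL; apply: LI.
(* [F] marks the top level of the jets, where the derivative is free. Below it the derivative [y] of
   the jet [c] is the next coordinate of [c], which is what [t] records. *)
pose F (v : dvar N m) := jlev v.1 == ord_max.
pose t (v : dvar N m) := pX K (nxt v.1, v.2).
pose y := tpt dL' (fun i => DL (c i)).
have FS j v : F (vshift j v) = F v by [].
have yt v : ~~ F v -> y v = ev iota x (t v).
  move=> Fv; rewrite /t evX /x /y /tpt /=; congr theta_app.
  by rewrite /c jlev_next //= /nxt /jnext jbaseK.
have dev0 g : P g -> dev iota (fun k => iota (D k)) x y g = 0.
  have xD : der_along (ev iota x) (fun g => DL (ev iota x g)).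
    have [h1 h2] := dLD ord_max.
    by split=> f f'; rewrite ?rmorphD ?rmorphM /= ?h1 ?h2.
  have iD := iotaD_der iota DD.
  have -> : dev iota (fun k => iota (D k)) x y g = DL (ev iota x g).
    move: g; apply: der_eq; [exact: dev_der | exact: xD | |] => [k|v].
      by rewrite (devC iD) evC ioD.
    by rewrite (devX iD) evX /x /y /tpt /DL theta_restrict_comm.
  by move=> ->; exact: der0 (is_der_along dLD ord_max).
have [h [nPh spec]] := specialize_derivation (rkP N) dD DD prP FS (fun f => iff_refl _) yt dev0.
pose H : mpol (dvar N m) K := H_of (rk N) Lam.
(* Each factor has its use on [O]: [H] makes zeros of [Lam] zeros of [P], [h] makes the fibres of
   [W] nonempty, and the [S g] are the inequations of the system. *)
pose q := H * h * \prod_(g <- gs) S g.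
have nPq : ~ P q.
  move=> /PM[/PM[]//|]; rewrite /P (rmorph_prod (ev iota x)) => /eqP.
  rewrite prodf_seq_eq0 => /hasP[g gI /andP[_]].
  by rewrite /= cS ?mem_cat ?gI ?orbT // -devalE (negPf (gs0 g gI)).
pose O b := Vset d (fun f => f \in Lam) b /\ ~ Vset d (fun f => f = q) b.
have OE b : O b -> (forall f, P f -> ev idfun (tpt d b) f = 0) /\ ev idfun (tpt d b) q != 0.
  move=> [Lb qb]; have q0 : ev idfun (tpt d b) q != 0.
    by apply/eqP => q0; apply: qb => _ ->; rewrite devalE.
  split=> //; apply: (charset_vanish (iota := idfun) (rkP N) dD dD (fun _ _ => erefl) prP csL
    (tpt_dpoint dC b)).
    by move=> f fL; rewrite -devalE; apply: Lb.
  by move: q0; rewrite !rmorphM /= !mulf_eq0 !negb_or => /andP[/andP[]].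
pose z0 : {ffun 'I_m -> nat} := [ffun=> 0%N].
(* The second family links the derivative of each coordinate below the top level to the next
   coordinate; at a point [(b, D b)] it forces [b] to be a jet. *)
pose SW (p : dpoly K (N + N) m) := (exists2 f : dpoly K N m, f \in Lam & p = xpart f \/ p = tau D f) \/
  (exists2 i, jlev i != ord_max & p = pX K (rshift N i, z0) - pX K (lshift N (nxt i), z0)).
have SWlink (b : 'I_N -> K) (e : 'I_N -> K) i :
    ev idfun (tpt d (cat_pt b e)) (pX K (rshift N i, z0) - pX K (lshift N (nxt i), z0)) = e i - b (nxt i).
  rewrite (rmorphB (ev idfun _)) /= !evX /tpt /= !theta_app0; congr (_ - _).
    by rewrite -{2}[e](cat_ptr b).
  by rewrite -{2}[b](cat_ptl b e).
have [b [Ob Wb]] : exists b, O b /\ Vset d SW (cat_pt b (fun i => D (b i))).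
  apply: (prol N Lam O (Vset d SW)).
  - by exists P; split=> //; apply/is_prime_didealE.
  - by exists (fun f => f = q).
  - have [|b [bL bq]] := ec N Lam [:: q].
      exists L, iota, dL', c; split=> // f; first by rewrite devalE => /LP.
      by rewrite inE => /eqP ->; rewrite devalE; apply/eqP.
    exists b; split=> // /(_ q erefl) e.
    by have := bq q; rewrite inE eqxx e eqxx => /(_ isT).
  - move=> b /OE[_]; rewrite devalE !rmorphM /= !mulf_eq0 !negb_or.
    by case/andP=> /andP[].
  - by exists SW.
  - by move=> e We f fL; split; apply: We; left; exists f; rewrite // ; [left | right].
  (* Over a point of [O] the recursion yields an algebraic solution [psi], and [lift_point] replaces
     it by a tuple that respects the links. *)
  move=> b Ob; have [bP bq] := OE b Ob.
  have [|psi [psiF psi0]] := spec (tpt d b) bP.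
    by move: bq; rewrite !rmorphM /= !mulf_eq0 !negb_or => /andP[/andP[]].
  pose s (v : dvar N m) := tpt d b (nxt v.1, v.2).
  have sS j v : ~~ F v -> s (vshift j v) = d j (s v).
    by move=> _; exact: (tpt_dpoint dC b j (nxt v.1, v.2)).
  have psis v : ~~ F v -> psi v = s v by move=> /psiF ->; rewrite evX.
  have [e [e0 eF]] := lift_point dcf DD DC idP FS sS psis psi0 LP.
  exists e => p [[f fL [->|->]]|[i ir ->]].
  - by rewrite devalE; apply: etrans (ev_xpart idfun d _ f) _; rewrite cat_ptl; apply/bP/LP.
  - by rewrite devalE; apply: etrans (ev_tau idfun d D _ f) _; rewrite cat_ptl cat_ptr; apply: e0.
  rewrite devalE SWlink eF // /s /tpt /= theta_app0 subrr //.
have [bP bq] := OE b Ob.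
have bnext i : jlev i != ord_max -> b (nxt i) = D (b i).
  move=> ir; have := Wb _ (or_intror (ex_intro2 _ _ i ir erefl)).
  by rewrite devalE SWlink => /eqP; rewrite subr_eq0 eq_sym => /eqP.
pose u i := b (jet r i 0).
have uS f : f \in fs ++ gs -> deval id (ext_der d D) u f = ev idfun (tpt d b) (S f).
  move=> fI; rewrite devalE -(@ev_jet_poly n r K K m idfun (ext_der d D) u b f) //; last exact: rP.
    by congr (ev _ (tpt _ _) _); apply/funext => j; rewrite ext_der_lift.
  by move=> i k kr; rewrite ext_der_max; apply: jet_rec.
exists u; split=> [f fI|g gI].
  rewrite uS ?mem_cat ?fI //; apply: bP.
  by rewrite /P cS ?mem_cat ?fI // -devalE; apply: fs0.
rewrite uS ?mem_cat ?gI ?orbT //; move: bq.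
rewrite rmorphM mulf_eq0 negb_or => /andP[_]; rewrite (rmorph_prod (ev idfun _)).
by rewrite (big_rem g) //= mulf_eq0 negb_or => /andP[].
Qed.

End Characterization.

Theorem theorem4 (K : fieldType) (m : nat) (d : 'I_m -> K -> K) (D : K -> K)
  (rk : forall n : nat, rel (dvar n m)) :
  [pchar K] =i pred0 ->
  (forall j, is_derivation (d j)) -> is_derivation D ->
  commuting_family d -> (forall j x, d j (D x) = D (d j x)) ->
  (forall n, is_ranking (rk n)) ->
  DCF (ext_der d D) <->
  (DCF d /\
   forall (n : nat) (Lam : seq (dpoly K n m)) (O : ('I_n -> K) -> Prop)
          (W : ('I_(n + n) -> K) -> Prop),
     (exists I, is_prime_dideal d I /\ is_charset (rk n) I Lam) ->
     dopen_in d (Vset d (fun f => f \in Lam)) O ->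
     (exists a, O a) ->
     (forall a, O a -> deval id d a (H_of (rk n) Lam) != 0) ->
     dclosed d W ->
     (forall c, W c -> forall f, f \in Lam ->
        deval id d c (xpart f) = 0 /\ deval id d c (tau D f) = 0) ->
     (forall a, O a -> exists b, W (cat_pt a b)) ->
     exists a, O a /\ W (cat_pt a (fun i => D (a i)))).
Proof.
move=> ch dD DD dC DC rkP; split=> [dcfD|[dcf prol]]; last exact: (prolongation_dcf ch dD DD dC DC rkP).
split; first exact: (dcf_reduct ch dD DD dC DC dcfD).
exact: (dcf_prolongation ch dD DD dC DC rkP dcfD).
Qed.
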